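(* Let $1<p<\infty$. Suppose $(1+|x|^2)^{\tau/2}q\in L_r(\mathbb{R}^3)$, where $\tau r>3$, and $3<r<\infty$ if $1<p\le3$, $p\le r<\infty$ if $p>3$. Let $H$ be the Schrödinger operator in $L_p(\mathbb{R}^3)$ associated with $-\Delta+q$. Then every eigenvalue $\lambda\in\mathbb{C}\setminus[0,\infty)$ of $H$ satisfies $$|\lambda|^{r-3}\le C_1(r,\theta)\int_{\mathbb{R}^3}\bigl|(1+|x|^2)^{\tau/2}q(x)\bigr|^r\,dx,$$ where $\theta=\arg\lambda\in(0,2\pi)$, $C_1(r,\theta)=2\pi\,B\!\left(\tfrac32,\tfrac{\tau r}{2}-\tfrac32\right)C(r,\theta)$ and $$C(r,\theta)=(4\pi)^{-2}\,\Gamma\!\left(\frac{2(r-3)}{r-2}\right)^{r-2}\left(\frac{r-2}{r\sin(\theta/2)}\right)^{2(r-3)}.$$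
   Context: Here $n=3$. $\Gamma$ is the gamma function and $B(x,y)=\int_0^1t^{x-1}(1-t)^{y-1}\,dt$ is the beta function. For $1<p<\infty$, $p'$ is defined by $1/p+1/p'=1$. The complex-valued measurable potential $q$ is factorized as $q=ab$ with $a(x)=(1+|x|^2)^{-\tau/2}$, $b(x)=(1+|x|^2)^{\tau/2}q(x)$. $H_0$ is the operator $-\Delta$ in $L_p(\mathbb{R}^n)$ with domain the Sobolev space $W_p^2(\mathbb{R}^n)$, and (as operators) multiplication by $a$ and by $b$ in $L_p(\mathbb{R}^n)$ are taken with maximal domains and denoted $\mathcal A$ and $\mathcal B$. For $u\in L_{p,\mathrm{loc}}(\mathbb{R}^n)$ put $M_{\nu,p}(u)=\sup_{x}\int_{|x-y|<1}|u(y)|^p|x-y|^{\nu-n}\,dy$. Standing assumptions: $M_{\nu,p'}(a)<\infty$ for some $0<\nu<p'$; $M_{\mu,p}(b)<\infty$ for some $0<\mu<p$; and $\int_{|x-y|<1}|q(y)|\,dy\to0$ as $|x|\to\infty$. Under these assumptions, for $z\in\mathbb{C}\setminus[0,\infty)$ the operator $\mathcal B(H_0-z)^{-1}\mathcal A$ is densely defined and has a unique bounded extension $Q(z)$ to $L_p(\mathbb{R}^n)$, which is compact, and $H_0+\mathcal A\mathcal B$ admits a closed extension $H$ with $\sigma_{ess}(H)=\sigma_{ess}(H_0)=[0,\infty)$ such that $\lambda\in\mathbb{C}\setminus[0,\infty)$ is an eigenvalue of $H$ if and only if $-1$ is an eigenvalue of $Q(\lambda)$. This $H$ is the Schrödinger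 operator associated with $-\Delta+q$. *)

(* Defs.v *)
From HB Require Import structures.
From mathcomp Require Import all_boot all_order all_algebra.
From mathcomp Require Import all_classical all_reals all_analysis.
From mathcomp Require Import complex.

Set Implicit Arguments.
Unset Strict Implicit.
Unset Printing Implicit Defensive.
Import Order.TTheory GRing.Theory Num.Theory.
Import numFieldNormedType.Exports.

Local Open Scope classical_set_scope.
Local Open Scope ring_scope.
Local Open Scope complex_scope.

(* R^3 is R * R * R: this type carries both the product sigma-algebra and the
   normed-module structure used for partial derivatives. The norm of the latter
   is the sup norm, so the Euclidean one is [norm3]. *)
Notation space3 R := (R * R * R)%type.

(* Complex functions on R^3; elements of L_p are such functions up to
   almost-everywhere equality. *)
Notation cfun3 R := (space3 R -> R[i]).

Section Space.
Context {R : realType}.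

Definition norm3 (x : space3 R) : R :=
  Num.sqrt (x.1.1 ^+ 2 + x.1.2 ^+ 2 + x.2 ^+ 2).

Definition ball3 (x : space3 R) : set (space3 R) := [set y | norm3 (x - y) < 1].

(* [lebesgue_measure] lives on [measurableTypeR R], an alias of R. *)
Definition lebesgue3 :
    {measure set (measurableTypeR R * measurableTypeR R *
                 measurableTypeR R)%type -> \bar R} :=
  (((@lebesgue_measure R) \x (@lebesgue_measure R))
    \x (@lebesgue_measure R))%E.

Definition cabs (z : R[i]) : R := Normc.normc z.

Definition cmeasurable (u : cfun3 R) : Prop :=
  measurable_fun setT (fun x => complex.Re (u x)) /\
  measurable_fun setT (fun x => complex.Im (u x)).

Definition cintegral (u : cfun3 R) : R[i] :=
  (\int[lebesgue3]_x complex.Re (u x)) +i* (\int[lebesgue3]_x complex.Im (u x)).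

Definition Lp_norm (p : R) (u : cfun3 R) : \bar R :=
  Lnorm lebesgue3 p%:E (fun x => (cabs (u x))%:E).

Definition in_Lp (p : R) (u : cfun3 R) : Prop :=
  cmeasurable u /\ (Lp_norm p u < +oo)%E.

Definition aeq (u v : cfun3 R) : Prop := u = v %[ae lebesgue3].

End Space.

Section Sobolev.
Context {R : realType}.

Definition basis3 (i : 'I_3) : space3 R :=
  ((i == 0 :> nat)%:R, (i == 1 :> nat)%:R, (i == 2 :> nat)%:R).

Fixpoint partial (s : seq 'I_3) (f : space3 R -> R) : space3 R -> R :=
  if s is i :: s' then fun x => 'D_(basis3 i) (partial s' f) x else f.

Definition smooth (f : space3 R -> R) : Prop :=
  forall s : seq 'I_3, continuous (partial s f) /\
    forall (i : 'I_3) (x : space3 R), derivable (partial s f) x (basis3 i).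

Definition test_function (f : space3 R -> R) : Prop :=
  smooth f /\ compact (closure [set x | f x != 0]).

(* [s] lists the directions of differentiation: |s| is the order. *)
Definition weak_derivative (s : seq 'I_3) (u v : cfun3 R) : Prop :=
  forall phi, test_function phi ->
    cintegral (fun x => u x * (partial s phi x)%:C) =
    (-1) ^+ size s * cintegral (fun x => v x * (phi x)%:C).

Definition in_W2p (p : R) (u : cfun3 R) : Prop :=
  in_Lp p u /\ forall s : seq 'I_3, (size s <= 2)%N ->
    exists2 v, in_Lp p v & weak_derivative s u v.

End Sobolev.

Section Operators.
Context {R : realType} (p : R).

(* A (possibly unbounded) operator in L_p is given by its graph:
   [T u f] means that u is in the domain of T and T u = f. *)
Definition operator := cfun3 R -> cfun3 R -> Prop.

Implicit Types S T Q : operator.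

Definition linear_operator T : Prop :=
  [/\ forall u f, T u f -> in_Lp p u /\ in_Lp p f,
      forall u u' f f', in_Lp p u' -> in_Lp p f' -> aeq u u' -> aeq f f' ->
        T u f -> T u' f',
      T (fun=> 0) (fun=> 0),
      forall (c : R[i]) u v f g, T u f -> T v g ->
        T (fun x => c * u x + v x) (fun x => c * f x + g x)
    & forall u f g, T u f -> T u g -> aeq f g].

Definition extends T S : Prop := forall u f, S u f -> T u f.

Definition Lp_converges (u_ : nat -> cfun3 R) (u : cfun3 R) : Prop :=
  Lp_norm p (fun x => u_ n x - u x) @[n --> \oo] --> 0%E.

Definition closed_operator T : Prop :=
  linear_operator T /\
  forall (u_ f_ : nat -> cfun3 R) u f, (forall n, T (u_ n) (f_ n)) ->
    in_Lp p u -> in_Lp p f -> Lp_converges u_ u -> Lp_converges f_ f -> T u f.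

Definition densely_defined T : Prop :=
  forall u, in_Lp p u -> forall e : R, 0 < e ->
    exists v f, T v f /\ (Lp_norm p (fun x => (u x - v x)%R) < e%:E)%E.

Definition bounded_operator T : Prop :=
  [/\ linear_operator T,
      forall u, in_Lp p u -> exists f, T u f
    & exists M : R, forall u f, T u f -> (Lp_norm p f <= M%:E * Lp_norm p u)%E].

(* Q is the unique bounded extension of the densely defined operator T. *)
Definition bounded_extension T Q : Prop :=
  [/\ densely_defined T, bounded_operator Q & extends Q T].

Definition op_add S T : operator := fun u f =>
  in_Lp p f /\ exists g h, [/\ S u g, T u h & aeq f (fun x => g x + h x)].

Definition op_comp S T : operator := fun u f => exists2 g, T u g & S g f.

Definition op_inv T : operator := fun u f => T f u.

(* T - z *)
Definition op_shift T (z : R[i]) : operator := fun u f =>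
  in_Lp p f /\ exists2 g, T u g & aeq f (fun x => g x - z * u x).

Definition op_mult (w : cfun3 R) : operator := fun u f =>
  [/\ in_Lp p u, in_Lp p f & aeq f (fun x => w x * u x)].

(* H_0 = - Delta with domain W_p^2 *)
Definition free_hamiltonian : operator := fun u f =>
  [/\ in_W2p p u, in_Lp p f &
      exists d : 'I_3 -> cfun3 R,
        (forall i, in_Lp p (d i) /\ weak_derivative [:: i; i] u (d i)) /\
        aeq f (fun x => - \sum_(i < 3) d i x)].

Definition eigenvalue_of T (z : R[i]) : Prop :=
  exists u, T u (fun x => z * u x) /\ ~ aeq u (fun=> 0).

Definition fredholm T : Prop :=
  [/\ exists n (e : 'I_n -> cfun3 R), forall u, T u (fun=> 0) ->
        exists c : 'I_n -> R[i], aeq u (fun x => \sum_(i < n) c i * e i x),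
      forall (u_ f_ : nat -> cfun3 R) f, (forall n, T (u_ n) (f_ n)) ->
        in_Lp p f -> Lp_converges f_ f -> exists u, T u f
    & exists n (e : 'I_n -> cfun3 R), (forall i, in_Lp p (e i)) /\
        forall f, in_Lp p f -> exists (c : 'I_n -> R[i]) u g,
          T u g /\ aeq f (fun x => g x + \sum_(i < n) c i * e i x)].

Definition essential_spectrum T : set R[i] :=
  [set z | ~ fredholm (op_shift T z)].

End Operators.

Section Schroedinger.
Context {R : realType}.

Definition nonneg_axis : set R[i] :=
  [set z | complex.Im z = 0 /\ 0 <= complex.Re z].

Definition japanese (s : R) (x : space3 R) : R := (1 + norm3 x ^+ 2) `^ s.

Definition factor_a (tau : R) : cfun3 R := fun x => (japanese (- (tau / 2)) x)%:C.

Definition factor_b (tau : R) (q : cfun3 R) : cfun3 R :=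
  fun x => (japanese (tau / 2) x)%:C * q x.

Definition M_fun (nu p : R) (u : cfun3 R) : \bar R :=
  ereal_sup (range (fun x : space3 R =>
    \int[lebesgue3]_(y in ball3 x)
      (cabs (u y) `^ p * norm3 (x - y) `^ (nu - 3))%:E)%E).

Definition standing_assumptions (p p' tau : R) (q : cfun3 R) : Prop :=
  [/\ exists nu : R, [/\ 0 < nu, nu < p' & (M_fun nu p' (factor_a tau) < +oo)%E],
      exists mu : R, [/\ 0 < mu, mu < p & (M_fun mu p (factor_b tau q) < +oo)%E]
    & forall e : R, 0 < e -> exists N : R, forall x : space3 R, N < norm3 x ->
        (\int[lebesgue3]_(y in ball3 x) (cabs (q y))%:E < e%:E)%E].

(* B (H_0 - z)^-1 A *)
Definition sandwiched_resolvent (p tau : R) (q : cfun3 R) (z : R[i]) : operator :=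
  op_comp (op_mult p (factor_b tau q))
    (op_comp (op_inv (op_shift p (free_hamiltonian p) z))
             (op_mult p (factor_a tau))).

(* In the last clause Q is the operator usually written Q(z); it is determined
   up to almost-everywhere equality by [bounded_extension]. *)
Definition schroedinger_operator (p tau : R) (q : cfun3 R) (H : operator) : Prop :=
  [/\ closed_operator p H,
      extends H (op_add p (free_hamiltonian p)
        (op_comp (op_mult p (factor_a tau)) (op_mult p (factor_b tau q)))),
      essential_spectrum p H = essential_spectrum p (free_hamiltonian p),
      essential_spectrum p (free_hamiltonian p) = nonneg_axis
    & forall z : R[i], ~ nonneg_axis z ->
        (eigenvalue_of H z <->
         exists2 Q : operator,
           bounded_extension p (sandwiched_resolvent p tau q z) Q
           & eigenvalue_of Q (-1))].

End Schroedinger.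

Section Constants.
Context {R : realType}.

Definition Gamma_fun (s : R) : R :=
  \int[lebesgue_measure]_(t in `]0%R, +oo[) (t `^ (s - 1) * expR (- t)).

(* The library's [beta_fun] only takes natural-number arguments. *)
Definition Beta_fun (x y : R) : R :=
  \int[lebesgue_measure]_(t in `]0%R, 1%R[) (t `^ (x - 1) * (1 - t) `^ (y - 1)).

Definition C_const (r theta : R) : R :=
  (4 * pi) ^- 2 * Gamma_fun (2 * (r - 3) / (r - 2)) `^ (r - 2)
  * ((r - 2) / (r * sin (theta / 2))) `^ (2 * (r - 3)).

Definition C1_const (tau r theta : R) : R :=
  2 * pi * Beta_fun (3 / 2) (tau * r / 2 - 3 / 2) * C_const r theta.

End Constants.

(* Main.v *)
From HB Require Import structures.
Require Import Defs.
From mathcomp Require Import all_boot all_order all_algebra.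
From mathcomp Require Import all_classical all_reals all_analysis.
From mathcomp Require Import complex ring lra measurable_realfun.
Import Order.TTheory GRing.Theory Num.Theory.
Import numFieldNormedType.Exports.
Local Open Scope classical_set_scope.
Local Open Scope ring_scope.
Local Open Scope complex_scope.
Set Implicit Arguments.
Unset Strict Implicit.
Unset Printing Implicit Defensive.

(* Write sqrt lambda = sig + i kap with kap > 0. The resolvent of the Laplacian is
   dominated by a Yukawa potential: 4 pi |u| <= (e^(-kap |x|) / |x|) * |f| almost
   everywhere if (H_0 - lambda) u = f. To see it from the weak equation alone, test
   with cut-offs of e^(i sqrt lambda rho) / rho, rho^2 = |x - y|^2 + e^2; this
   kernel solves the Helmholtz equation up to a defect that is an approximate
   identity as e tends to 0. Hence a function w with Q(lambda) w = - w satisfies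
   4 pi |w| <= |b| ((e^(-kap |x|) / |x|) * (a |w|)), in the sense of integrals
   against suitable weights.
   Integrate this against the weight a e^(-d |x|), 0 < d < kap. By the triangle
   inequality the weight e^(-d |x|) passes through the kernel at the cost of
   replacing kap by kap - d, and Hoelder's inequality with the exponents r/2 and
   r/(r-2) bounds the right-hand side by the integral of a e^(-d |x|) |w| times the
   product of the norms of a b in L_(r/2) and of e^(-(kap - d) |x|) / |x| in
   L_(r/(r-2)). The integral of a e^(-d |x|) |w| is finite and positive, so it
   cancels; now let d tend to 0. Cauchy-Schwarz for a b and the explicit integrals
   of a^r (beta function) and of the kernel (gamma function) give the constant. *)

(** * The law of a random variable *)

(** The factor e^(-d |x|) is forced by the lack of information on the eigenfunction w: it lies in
    L_p, but a need not lie in the dual space, so a |w| may fail to be integrable, whereas e^(-d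
    |x|) lies in every L_(p'). The factor a in the weight makes the estimate close on itself: once
    the two integrations are exchanged, the other side carries a e^(-d |x|) |w| again. So no
    operator norm on L_p is ever estimated, and p leaves no trace in the constant. Boundedness of Q
    serves only to carry the kernel bound from the domain of B (H_0 - z)^-1 A to its extension. The
    kernel is regularised because weak derivatives may be tested on smooth functions only. Its
    defect is 4 e^2 times the second derivative of the kernel with respect to rho^2; the leading
    part 3 e^2 / rho^5 has mass 4 pi, the rest has mass O(e). With k = r/(r-2), local integrability
    of |x|^(-k) means k < 3, that is r > 3, and 3 - k = 2(r-3)/(r-2) is the argument of the gamma
    function. Raising the final inequality to the power r produces the remaining exponents, and kap
    = |lambda|^(1/2) sin(theta/2) the dependence on theta. *)

Section Density.
Local Open Scope ereal_scope.
Context d (T : measurableType d) (R : realType) (m : {measure set T -> \bar R}).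
Variables (rho : T -> \bar R) (mrho : measurable_fun setT rho)
  (rho0 : forall x, 0 <= rho x).

(** The two proofs are arguments so that the measure structure declared below can be inferred from
    the term alone. *)
Definition density of (measurable_fun setT rho) & (forall x, 0 <= rho x) :=
  fun A : set T => \int[m]_(x in A) rho x.

Let density0 : density mrho rho0 set0 = 0.
Proof. exact: integral_set0. Qed.

Let density_ge0 A : 0 <= density mrho rho0 A.
Proof. exact: integral_ge0. Qed.

Let density_additive : semi_sigma_additive (density mrho rho0).
Proof. exact: semi_sigma_additive_nng_induced. Qed.

HB.instance Definition _ := isMeasure.Build _ _ _ (density mrho rho0)
  density0 density_ge0 density_additive.

End Density.

Section Law.
Local Open Scope ereal_scope.
Context d (T : measurableType d) (R : realType).
Variable m : {sigma_finite_measure set T -> \bar R}.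
Variables (X : T -> R) (rho : T -> \bar R) (w : R -> \bar R).
Hypotheses (mX : measurable_fun setT X) (mrho : measurable_fun setT rho)
  (rho0 : forall x, 0 <= rho x) (mw : measurable_fun setT w)
  (w0 : forall x, 0 <= w x).
Hypothesis XE : forall b : R, \int[m]_(x in X @^-1` `]-oo, b[) rho x =
  \int[lebesgue_measure]_(s in `]-oo, b[) w s.
Hypothesis Xfin : forall b : R, \int[lebesgue_measure]_(s in `]-oo, b[) w s < +oo.

(** The open left rays are stable under intersection, generate the Borel sets, exhaust the line and
    have finite mass by [Xfin]; so two measures that agree on them agree everywhere. *)
Lemma law_eq (A : set R) : measurable A ->
  \int[m]_(x in X @^-1` A) rho x = \int[lebesgue_measure]_(s in A) w s.
Proof.
move=> mA.
have mw' : measurable_fun [set: measurableTypeR R] w by [].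
have mX' : measurable_fun setT (X : T -> measurableTypeR R) by [].
pose G : set (set (measurableTypeR R)) := @RGenInftyO.G R.
apply: (@measure_unique _ R (measurableTypeR R) G (fun n => `]-oo, n%:R[%classic)
  _ _ _ _ (pushforward (density m mrho rho0) (X : T -> measurableTypeR R))
  (density (@lebesgue_measure R) mw' w0)) => //.
- exact: RGenInftyO.measurableE.
- move=> _ _ [a ->] [b ->]; exists (Num.min a b).
  by apply/seteqP; split=> x /=; rewrite !in_itv /= lt_min => /andP.
- by move=> i; exists i%:R.
- apply/seteqP; split=> x //= _; exists (Num.trunc x).+1 => //=.
  by rewrite in_itv /= truncnS_gt.
- by move=> _ [a ->]; exact: XE.
- by move=> k; rewrite /= /pushforward /density XE.
Qed.

(* Layer cake: both sides are integrals over u of the masses of the level sets [u < F]. *)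
Lemma law_integral (F : R -> R) : measurable_fun setT F -> (forall s, (0 <= F s)%R) ->
  \int[m]_x ((F (X x))%:E * rho x) = \int[lebesgue_measure]_s ((F s)%:E * w s).
Proof.
move=> mF F0.
(* For r >= 0 the section u |-> [ind u r] is the indicator of [[0, r[], whose length is r. *)
pose ind (u : measurableTypeR R) (r : R) : R := ((0 <= u) && (u < r))%R%:R%R.
have layer (r : R) (c : \bar R) : (0 <= r)%R -> 0 <= c ->
  r%:E * c = \int[lebesgue_measure]_u ((ind u r)%:E * c).
  move=> r0 c0.
  have indE : (fun u => (ind u r)%:E) = EFin \o \1_(`[0%R, r[%classic : set (measurableTypeR R)).
    by apply/funext => u; rewrite /= indicE /ind mem_setE in_itv.
  rewrite ge0_integralZr//; first last.
  - by move=> u _; rewrite lee_fin.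
  - by rewrite indE; apply/measurable_EFinP/measurable_indic.
  rewrite indE integral_indic//= setIT.
  have -> := @lebesgue_measure_itv R `[0%R, r[.
  rewrite /= lte_fin sube0.
  by case: ltP => // r0'; congr (_%:E * _); apply/eqP; rewrite eq_le r0 r0'.
have mind d' (S : measurableType d') (f : S -> R) (g : S -> R) :
    measurable_fun setT f -> measurable_fun setT g ->
    measurable_fun setT (fun s => (ind (f s) (g s))%:E).
  move=> mf mg; apply/measurable_EFinP.
  apply: (measurableT_comp (f := fun b : bool => b%:R%R : R)) => //.
  by apply: measurable_and; [exact: measurable_fun_ler|exact: measurable_fun_ltr].
have ind0 u r : 0 <= (ind u r)%:E by rewrite lee_fin.
transitivity (\int[m]_x \int[lebesgue_measure]_u ((ind u (F (X x)))%:E * rho x)).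
  by apply: eq_integral => x _; rewrite layer.
transitivity (\int[lebesgue_measure]_s \int[lebesgue_measure]_u ((ind u (F s))%:E * w s));
  last by apply: eq_integral => s _; rewrite layer.
rewrite (@fubini_tonelli _ _ _ _ _ m lebesgue_measure
  (fun xu : T * measurableTypeR R => (ind xu.2 (F (X xu.1)))%:E * rho xu.1)); first last.
- by move=> x; rewrite mule_ge0.
- apply: emeasurable_funM; last exact: (measurableT_comp mrho).
  apply: mind => //; apply: (measurableT_comp mF).
  exact: (measurableT_comp mX).
rewrite (@fubini_tonelli _ _ _ _ _ lebesgue_measure lebesgue_measure
  (fun xu : measurableTypeR R * measurableTypeR R => (ind xu.2 (F xu.1))%:E * w xu.1)); first last.
- by move=> x; rewrite mule_ge0.
- apply: emeasurable_funM; last exact: (measurableT_comp mw).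
  by apply: mind => //; exact: (measurableT_comp mF).
apply: eq_integral => u _ /=.
pose A := [set s : measurableTypeR R | (0 <= u) && (u < F s)]%R.
have mA : measurable A.
  have h : measurable_fun setT (fun s : measurableTypeR R => (0 <= u) && (u < F s))%R.
    by apply: measurable_and => //; exact: measurable_fun_ltr.
  by rewrite -[A]setTI; exact: (h measurableT [set true]).
transitivity (\int[m]_(x in X @^-1` A) rho x); last rewrite law_eq//.
  rewrite [RHS]integral_mkcond; apply: eq_integral => x _.
  rewrite /patch /ind; case: ifPn => [|]; rewrite ?inE ?notin_setE /A /=.
    by move=> ->; rewrite mul1e.
  by move/negP/negbTE => ->; rewrite mul0e.
rewrite [LHS]integral_mkcond; apply: eq_integral => x _.
rewrite /patch /ind; case: ifPn => [|]; rewrite ?inE ?notin_setE /A /=.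
  by move=> ->; rewrite mul1e.
by move/negP/negbTE => ->; rewrite mul0e.
Qed.

End Law.

(** * Integration over three-dimensional space *)

Section Space3.
Local Open Scope ereal_scope.
Context {R : realType}.
Notation mu := (@lebesgue_measure R).

Lemma product_sigma_finite d1 d2 (T1 : measurableType d1) (T2 : measurableType d2)
  (m1 : {sigma_finite_measure set T1 -> \bar R})
  (m2 : {sigma_finite_measure set T2 -> \bar R}) :
  sigma_finite setT (m1 \x m2).
Proof.
have /sigma_finiteP[F [TF ndF Foo]] := sigma_finiteT m1.
have /sigma_finiteP[G [TG ndG Goo]] := sigma_finiteT m2.
exists (fun n => F n `*` G n).
  rewrite -setXTT TF TG predeqE => -[x y]; split; last by move=> [n _ []/= ? ?]; split; exists n.
  move=> [/= [n _ Fnx] [k _ Gky]]; exists (maxn n k) => //; split.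
  - by move: x Fnx; exact/subsetPset/ndF/leq_maxl.
  - by move: y Gky; exact/subsetPset/ndG/leq_maxr.
move=> k; have [? ?] := Foo k; have [? ?] := Goo k.
split; first exact: measurableX.
by rewrite product_measure1E// lte_mul_pinfty// ge0_fin_numE.
Qed.

(* Convertible to the factors of [lebesgue3], with the sigma-finite structure
   that the Fubini-Tonelli theorem requires. *)
Definition leb2 : set (measurableTypeR R * measurableTypeR R) -> \bar R := (mu \x mu).
HB.instance Definition _ := Measure.copy leb2 ((mu \x mu) : {measure set (measurableTypeR R * measurableTypeR R) -> \bar R}).
HB.instance Definition _ := Measure_isSigmaFinite.Build _ _ _ leb2 (product_sigma_finite mu mu).

Definition leb3 : set (measurableTypeR R * measurableTypeR R * measurableTypeR R) -> \bar R := (leb2 \x mu).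
HB.instance Definition _ := Measure.copy leb3 ((leb2 \x mu) : {measure set (measurableTypeR R * measurableTypeR R * measurableTypeR R) -> \bar R}).
HB.instance Definition _ := Measure_isSigmaFinite.Build _ _ _ leb3 (product_sigma_finite leb2 mu).

Notation T1 := (measurableTypeR R).
Notation T2 := (measurableTypeR R * measurableTypeR R)%type.
Notation T3 := (measurableTypeR R * measurableTypeR R * measurableTypeR R)%type.

Lemma integral3E (f : T3 -> \bar R) :
  measurable_fun setT f -> (forall x, 0 <= f x) ->
  \int[lebesgue3]_x f x = \int[mu]_x \int[mu]_y \int[mu]_z f (x, y, z).
Proof.
move=> mf f0.
rewrite [LHS](@fubini_tonelli1 _ _ _ _ _ leb2 mu f mf f0).
apply: (@fubini_tonelli1 _ _ _ _ _ mu mu (fun x => \int[mu]_z f (x, z))).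
- exact: (measurable_fun_fubini_tonelli_F f).
- by move=> x; exact: integral_ge0.
Qed.

Lemma measurable_sub3 (c : space3 R) : measurable_fun [set: T3] ((fun x : space3 R => (c - x)%R) : T3 -> T3).
Proof.
apply/measurable_fun_pairP; split => /=; first apply/measurable_fun_pairP; first split => /=.
- apply: measurable_funB => //. apply: (measurableT_comp measurable_fst) => //.
- apply: measurable_funB => //. apply: measurableT_comp => //.
- apply: measurable_funB => //.
Qed.

(** Reflection sends []a, b]] to an interval half-open on the other side but of the same length, and
    lengths of such intervals determine Lebesgue measure. *)
Lemma lebesgue_measure_subl (c : R) (A : set T1) : measurable A ->
  pushforward mu ((fun x => c - x)%R : _ -> T1) A = mu A.
Proof.
have mc : measurable_fun setT ((fun x => c - x)%R : T1 -> T1).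
  exact: measurable_funB.
move=> mA; apply/esym/lebesgue_measure_unique => //= _ [[a b]] _ <-.
rewrite /pushforward.
have -> : (fun x : R => (c - x)%R) @^-1` [set` `]a, b]] = `[(c - b)%R, (c - a)%R[%classic.
  by apply/seteqP; split=> x /=; rewrite !in_itv /= => /andP[h1 h2]; apply/andP; split; lra.
rewrite !lebesgue_measure_itv /= !lte_fin ltrD2l ltrN2 -!EFinB.
by case: ifP => // _; congr EFin; ring.
Qed.

Lemma ge0_integral_subl (c : R) (f : T1 -> \bar R) :
  measurable_fun setT f -> (forall x, 0 <= f x) ->
  \int[mu]_x f (c - x)%R = \int[mu]_x f x.
Proof.
move=> mf f0.
have mc : measurable_fun setT ((fun x => c - x)%R : T1 -> T1).
  exact: measurable_funB.
rewrite -(@ge0_integral_pushforward _ _ _ _ _ _ mc mu setT f) //.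
by apply: eq_measure_integral => //= A mA AS; exact: lebesgue_measure_subl.
Qed.

Lemma ge0_integral_sub3 (c : space3 R) (f : T3 -> \bar R) :
  measurable_fun setT f -> (forall x, 0 <= f x) ->
  \int[lebesgue3]_x f (c - x)%R = \int[lebesgue3]_x f x.
Proof.
move=> mf f0; rewrite (integral3E mf f0).
have h : \int[lebesgue3]_x f (c - x)%R = \int[mu]_x \int[mu]_y \int[mu]_z f ((c.1.1 - x)%R, (c.1.2 - y)%R, (c.2 - z)%R).
  have mfc : measurable_fun setT (fun x : T3 => f (c - x)%R).
    exact: (measurableT_comp mf (measurable_sub3 c)).
  exact: (integral3E mfc (fun x => f0 _)).
rewrite {}h.
have m1 : measurable_fun setT (fun x : T2 => \int[mu]_z f (x, z)).
  exact: (measurable_fun_fubini_tonelli_F f).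
have m2 : measurable_fun setT (fun x : T1 => \int[mu]_y \int[mu]_z f (x, y, z)).
  apply: (measurable_fun_fubini_tonelli_F (fun x : T2 => \int[mu]_z f (x, z))) => // x.
  exact: integral_ge0.
rewrite -(ge0_integral_subl c.1.1 m2); last by move=> x; do 2!apply: integral_ge0 => ? _.
apply: eq_integral => x _.
rewrite -(@ge0_integral_subl c.1.2 (fun y => \int[mu]_z f ((c.1.1 - x)%R, y, z))).
- apply: eq_integral => y _.
  rewrite -(@ge0_integral_subl c.2 (fun z => f ((c.1.1 - x)%R, (c.1.2 - y)%R, z)))//.
  apply: measurableT_comp => //.
- apply: (measurableT_comp m1).
  exact: measurable_fun_pair.
- by move=> y; apply: integral_ge0.
Qed.

End Space3.

Section Radial.
Context {R : realType}.
Notation mu := (@lebesgue_measure R).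
Notation T1 := (measurableTypeR R).
Notation T3 := (measurableTypeR R * measurableTypeR R * measurableTypeR R)%type.

Lemma ge0_integralRZl d (T : measurableType d) (m : {measure set T -> \bar R}) (k : R) (f : T -> R) :
  0 <= k -> measurable_fun setT f -> (forall x, 0 <= f x) ->
  (\int[m]_x (k * f x)%:E = k%:E * \int[m]_x (f x)%:E)%E.
Proof.
move=> k0 mf f0; under eq_integral do rewrite EFinM.
by rewrite ge0_integralZl//; [exact/measurable_EFinP|move=> x _; rewrite lee_fin].
Qed.

(** The area of a half disc, through the substitution y = r sin t. *)
Lemma integral_sqrt_disc (r : R) : 0 < r ->
  (\int[mu]_(y in `[(- r)%R, r]) (Num.sqrt (r ^+ 2 - y ^+ 2))%:E = (pi / 2 * r ^+ 2)%:E)%E.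
Proof.
move=> r0.
pose F (t : R) : R := r * sin t.
have dF (x : R) : is_derive x 1 F (r * cos x).
  exact: is_deriveZ.
have F'E : (derive1 F) = (fun x => r * cos x).
  by apply/funext => x; rewrite derive1E; apply: derive_val.
have pi0 := @pi_gt0 R.
have Fl : F (- (pi / 2)) = - r by rewrite /F sinN sin_pihalf mulrN1.
have Fr : F (pi / 2) = r by rewrite /F sin_pihalf mulr1.
have cF : continuous F.
  by move=> x; apply: cvgM; [exact: cvg_cst|exact: continuous_sin].
have cF' : continuous (derive1 F).
  by rewrite F'E => x; apply: cvgM; [exact: cvg_cst|exact: continuous_cos].
have dFlr : derivable_oo_LRcontinuous F (- (pi / 2)) (pi / 2).
  split; first by move=> x _; exact: ex_derive.
  - by apply: cvg_at_right_filter; exact: cF.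
  - by apply: cvg_at_left_filter; exact: cF.
have E := @integration_by_substitution_increasing R F (fun y : R => Num.sqrt (r ^+ 2 - y ^+ 2)) (- (pi / 2)) (pi / 2).
rewrite Fl Fr in E; rewrite E {E}.
- transitivity (\int[mu]_(x in `[(- (pi / 2))%R, (pi / 2)%R]) (r ^+ 2 * cos x ^+ 2)%:E)%E.
    apply: eq_integral => x; rewrite inE /= in_itv /= => /andP[x1 x2]; congr EFin.
    rewrite !fctE F'E /F exprMn -{1}(mulr1 (r ^+ 2)) -mulrBr -(cos2Dsin2 x) addrK.
    have c0 : 0 <= cos x by apply: cos_ge0_pihalf; rewrite x1 x2.
    rewrite -exprMn sqrtr_sqr ger0_norm; first by ring.
    by rewrite mulr_ge0// ltW.
  pose G (t : R) : R := r ^+ 2 / 2 * (t + sin t * cos t).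
  have dG (x : R) : is_derive x 1 G (r ^+ 2 * cos x ^+ 2).
    have h : is_derive x 1 (fun t : R => t + sin t * cos t) (1 + (sin x * (- sin x) + cos x * cos x)).
      apply: is_deriveD; apply: is_deriveM.
    have h2 : is_derive x 1 G (r ^+ 2 / 2 * (1 + (sin x * (- sin x) + cos x * cos x))) by exact: is_deriveZ.
    apply: is_derive_eq.
    have -> : sin x * - sin x = cos x ^+ 2 - 1 by rewrite -(cos2Dsin2 x); ring.
    by field.
  have G'E : (derive1 G) = (fun x => r ^+ 2 * cos x ^+ 2).
    by apply/funext => x; rewrite derive1E; apply: derive_val.
  have cG : continuous G by move=> x; apply/differentiable_continuous/derivable1_diffP; exact: ex_derive.
  rewrite (@continuous_FTC2 _ (fun x : R => r ^+ 2 * cos x ^+ 2 : R) G) //.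
  + rewrite -EFinB /G sinN cosN sin_pihalf cos_pihalf; congr EFin; by field.
  + lra.
  + apply: continuous_subspaceT => x; apply: cvgM; first exact: cvg_cst.
    apply: (@continuous_comp _ _ _ (@cos R) (fun y : R => y ^+ 2)); [exact: continuous_cos|exact: exprn_continuous].
  + split; first by move=> x _; exact: ex_derive.
    * by apply: cvg_at_right_filter; exact: cG.
    * by apply: cvg_at_left_filter; exact: cG.
  + by move=> x _; rewrite G'E.
- lra.
- move=> x y xI yI xy; rewrite /F ltr_pM2l// ltr_sin//.
- by move=> x _; exact: cF'.
- by apply/cvg_ex; exists ((derive1 F) (- (pi / 2))); apply: cvg_at_right_filter; exact: cF'.
- by apply/cvg_ex; exists ((derive1 F) (pi / 2)); apply: cvg_at_left_filter; exact: cF'.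
- exact: dFlr.
- apply: continuous_subspaceT => x; apply: (@continuous_comp _ _ _ (fun y : R => r ^+ 2 - y ^+ 2 : R) (@Num.sqrt R)).
    by apply: cvgB; [exact: cvg_cst|exact: exprn_continuous].
  exact: sqrt_continuous.
Qed.

(** [Num.sqrt] vanishes on negative numbers, so the integrand is supported where y^2 <= d and the
    integral may run over the whole line. *)
Lemma integral_sqrt (d : R) :
  (\int[mu]_y (Num.sqrt (d - y ^+ 2))%:E = (pi / 2 * Num.max d 0)%:E)%E.
Proof.
have [d0|d0] := leP d 0.
  rewrite mulr0; apply: integral0_eq => y _; congr EFin; apply: ler0_sqrtr.
  by rewrite subr_le0 (le_trans d0)// sqr_ge0.
rewrite -[in RHS](sqr_sqrtr (ltW d0)) -integral_sqrt_disc ?sqrtr_gt0//.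
rewrite [RHS]integral_mkcond; apply: eq_integral => y _.
rewrite /patch mem_setE sqr_sqrtr ?(ltW d0)//; case: ifPn => // yN.
congr EFin; apply: ler0_sqrtr; rewrite subr_le0 leNgt; apply: contra yN => yd.
rewrite in_itv /= -ler_norml -sqrtr_sqr ler_sqrt ?(ltW yd)//.
exact: ltW.
Qed.

Lemma integral_indic_sqr (c : R) :
  (\int[mu]_z ((z ^+ 2 < c)%R%:R : R)%:E = (2 * Num.sqrt c)%:E)%E.
Proof.
have -> : (fun z : R => ((z ^+ 2 < c)%R%:R : R)%:E) = EFin \o \1_(`](- Num.sqrt c), (Num.sqrt c)[%classic : set T1).
  apply/funext => z; rewrite /= indicE mem_setE in_itv /= -ltr_norml.
  have [c0|c0] := leP c 0.
    rewrite (ler0_sqrtr c0) normr_lt0.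
    by rewrite ltNge (le_trans c0)// sqr_ge0.
  by rewrite -sqrtr_sqr ltr_sqrt.
rewrite integral_indic//= setIT.
have -> := @lebesgue_measure_itv R `](- Num.sqrt c), (Num.sqrt c)[.
rewrite /= lte_fin; case: ltP => h; first by rewrite -EFinB opprK mulrDl !mul1r.
have : Num.sqrt c = 0 by have := sqrtr_ge0 c; lra.
by move=> ->; rewrite mulr0.
Qed.

Lemma integral_pos_part (b : R) : 0 <= b ->
  (\int[mu]_x (Num.max (b - x ^+ 2) 0)%:E = (4 / 3 * (b * Num.sqrt b))%:E)%E.
Proof.
rewrite le_eqVlt => /predU1P[<-|b0].
  rewrite mul0r mulr0; apply: integral0_eq => y _; congr EFin; apply/max_idPr.
  by rewrite sub0r oppr_le0 sqr_ge0.
have b0' := ltW b0; set s := Num.sqrt b; have s0 : 0 < s by rewrite sqrtr_gt0.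
have sb : s ^+ 2 = b by rewrite sqr_sqrtr.
transitivity (\int[mu]_(x in `[(- s)%R, s]) (b - x ^+ 2)%:E)%E.
  rewrite [RHS]integral_mkcond; apply: eq_integral => y _.
  rewrite /patch mem_setE in_itv /= -ler_norml -sqrtr_sqr ler_sqrt//; case: (leP (y ^+ 2) b) => yb.
    by congr EFin; apply/max_idPl; rewrite subr_ge0.
  by congr EFin; apply/max_idPr; rewrite subr_le0 ltW.
pose G (t : R) : R := b * t - 3^-1 * (t * t * t).
have dG (x : R) : is_derive x 1 G (b - x ^+ 2).
  have h : is_derive x 1 G (b * 1 - 3^-1 * ((x * x) * 1 + x * (x * 1 + x * 1))).
    apply: is_deriveB; apply: is_deriveZ; apply: is_deriveM.
  apply: is_derive_eq; by field.
have G'E : (derive1 G) = (fun x => b - x ^+ 2).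
  by apply/funext => x; rewrite derive1E; apply: derive_val.
have cG : continuous G by move=> x; apply/differentiable_continuous/derivable1_diffP; exact: ex_derive.
have cf : continuous (fun x : R => b - x ^+ 2 : R).
  by move=> x; apply: cvgB; [exact: cvg_cst|exact: exprn_continuous].
rewrite (@continuous_FTC2 _ (fun x : R => b - x ^+ 2 : R) G) //.
+ rewrite -EFinB /G; congr EFin; rewrite -sb; by field.
+ lra.
+ exact: continuous_subspaceT.
+ split; first by move=> x _; exact: ex_derive.
  * by apply: cvg_at_right_filter; exact: cG.
  * by apply: cvg_at_left_filter; exact: cG.
+ by move=> x _; rewrite G'E.
Qed.

Definition sqn3 (x : space3 R) : R := x.1.1 ^+ 2 + x.1.2 ^+ 2 + x.2 ^+ 2.

Lemma measurable_sqn3 : measurable_fun [set: T3] (sqn3 : T3 -> R).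
Proof.
apply: measurable_funD; first apply: measurable_funD; apply: measurable_funX.
- exact: (measurableT_comp measurable_fst).
- exact: (measurableT_comp measurable_snd).
- exact: measurable_snd.
Qed.

(** Slicing: the z-section is an interval of length 2 sqrt(b - x^2 - y^2), the (y, z)-section a
    disc, and the last integral is that of a parabola. The parameter b is the squared radius; the
    right-hand side is (4/3) pi b^(3/2), and 0 for b <= 0. *)
Lemma ball_volume (b : R) :
  (\int[lebesgue3]_x ((sqn3 x < b)%R%:R : R)%:E =
   (4 / 3 * pi * (Num.max b 0 * Num.sqrt b))%:E)%E.
Proof.
have mf : measurable_fun [set: T3] ((fun x : space3 R => ((sqn3 x < b)%R%:R : R)%:E) : T3 -> \bar R).
  apply/measurable_EFinP.
  apply: (measurableT_comp (f := fun c : bool => c%:R : R)) => //.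
  by apply: measurable_fun_ltr => //; exact: measurable_sqn3.
rewrite (integral3E mf); last by move=> x; rewrite lee_fin.
transitivity (\int[mu]_x \int[mu]_y (2 * Num.sqrt ((b - x ^+ 2) - y ^+ 2))%:E)%E.
  apply: eq_integral => x _; apply: eq_integral => y _.
  rewrite -integral_indic_sqr; apply: eq_integral => z _.
  by rewrite /sqn3 /= -ltrBrDl opprD addrA.
transitivity (\int[mu]_x (pi * (Num.max (b - x ^+ 2) 0))%:E)%E.
  apply: eq_integral => x _.
  rewrite ge0_integralRZl//=.
  - rewrite integral_sqrt -!EFinM; congr EFin; by field.
  - apply: (@measurableT_comp _ _ _ _ _ _ (@Num.sqrt R)).
      apply: continuous_measurable_fun; exact: sqrt_continuous.
    by apply: measurable_funB => //; exact: measurable_funX.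
rewrite ge0_integralRZl//=.
- have [b0|b0] := leP 0 b.
    rewrite integral_pos_part// -EFinM; congr EFin; ring.
  rewrite ltr0_sqrtr// !mulr0 integral0_eq ?mule0// => x _; congr EFin; apply/max_idPr.
  by rewrite subr_le0 (le_trans (ltW b0))// sqr_ge0.
- exact: pi_ge0.
- apply: measurable_maxr => //.
  by apply: measurable_funB => //; exact: measurable_funX.
- by move=> y; rewrite le_max lexx orbT.
Qed.

(** The density 2 pi sqrt(s) is the derivative of the ball volume in the squared radius s. *)
Lemma integral_sqrt_ray (b : R) :
  (\int[mu]_(s in `]-oo, b[) (2 * pi * Num.sqrt s)%:E =
   (4 / 3 * pi * (Num.max b 0 * Num.sqrt b))%:E)%E.
Proof.
have [b0|b0] := leP b 0.
  rewrite mul0r mulr0; apply: integral0_eq => s; rewrite /= in_itv /= => sb.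
  by rewrite ler0_sqrtr ?mulr0// ltW// (lt_le_trans sb).
pose f (s : R) : R := 2 * pi * Num.sqrt s.
have cf : continuous f.
  move=> x; apply: cvgM; [exact: cvg_cst|exact: sqrt_continuous].
pose G (s : R) : R := 4 / 3 * pi * (s * Num.sqrt s).
have cG : continuous G.
  move=> x; apply: cvgM; first exact: cvg_cst.
  by apply: cvgM; [exact: cvg_id|exact: sqrt_continuous].
have dG (x : R) : 0 < x -> is_derive x 1 G (f x).
  move=> x0.
  have h : is_derive x 1 (fun s : R => s * Num.sqrt s) (x * (2 * Num.sqrt x)^-1 + Num.sqrt x * 1).
    by apply: is_deriveM; exact: is_derive1_sqrt.
  have h2 : is_derive x 1 G (4 / 3 * pi * (x * (2 * Num.sqrt x)^-1 + Num.sqrt x * 1)) by exact: is_deriveZ.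
  apply: is_derive_eq; rewrite /f.
  have s0 : Num.sqrt x != 0 by rewrite sqrtr_eq0 -ltNge.
  rewrite -{1}(sqr_sqrtr (ltW x0)); by field.
transitivity (\int[mu]_(s in `[0%R, b]) (f s)%:E)%E.
  rewrite [RHS](@integral_itv_bndoo _ _ _ _ true false)//; last first.
    apply/measurable_EFinP; exact: (measurable_funTS (continuous_measurable_fun cf)).
  rewrite integral_mkcond [RHS]integral_mkcond; apply: eq_integral => s _.
  rewrite /patch !mem_setE !in_itv /=.
  case: (ltP s b) => sb; rewrite ?andbF//= andbT; case: (ltP 0 s) => // s0.
  by rewrite ler0_sqrtr// mulr0.
rewrite (@continuous_FTC2 _ f G) //.
- by rewrite -EFinB /G mul0r mulr0 subr0.
- exact: continuous_subspaceT.
- split.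
  + by move=> x; rewrite in_itv /= => /andP[x0 _]; have [] := dG x x0.
  + by apply: cvg_at_right_filter; exact: cG.
  + by apply: cvg_at_left_filter; exact: cG.
- move=> x; rewrite in_itv /= => /andP[x0 _]; rewrite derive1E.
  by have [] := dG x x0.
Qed.

(** The function [sqn3] is treated as a random variable with the ball volume as distribution
    function; this replaces polar coordinates. *)
Lemma radial_integral (F : R -> R) : measurable_fun setT F -> (forall s, 0 <= F s) ->
  (\int[lebesgue3]_x (F (sqn3 x))%:E =
   \int[mu]_s ((F s)%:E * (2 * pi * Num.sqrt s)%:E))%E.
Proof.
move=> mF F0.
have msqrt : measurable_fun setT (fun s : R => (2 * pi * Num.sqrt s)%:E).
  apply/measurable_EFinP; apply: measurable_funM => //.
  apply: continuous_measurable_fun; exact: sqrt_continuous.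
rewrite -(@law_integral _ T3 R leb3 sqn3 (cst 1%E) (fun s => (2 * pi * Num.sqrt s)%:E)) //.
- by apply: eq_integral => x _; rewrite mule1.
- exact: measurable_sqn3.
- by move=> s; rewrite lee_fin !mulr_ge0 ?pi_ge0.
- move=> b; rewrite integral_sqrt_ray -ball_volume integral_mkcond.
  apply: eq_integral => x _; rewrite /patch.
  have -> : (x \in sqn3 @^-1` `]-oo, b[) = (sqn3 x < b).
    by apply/idP/idP; rewrite inE /= in_itv.
  by case: ifP.
- by move=> b; rewrite integral_sqrt_ray ltry.
Qed.

End Radial.

Ltac nneg := repeat match goal with
  | |- is_true (0 <= ?x) => assumption
  | |- is_true (0 <= _ + _) => apply: addr_ge0
  | |- is_true (0 <= _ * _) => apply: mulr_ge0
  | |- is_true (0 <= _^-1) => rewrite invr_ge0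
  | |- is_true (0 <= _ ^+ 2) => exact: sqr_ge0
  | |- is_true (0 <= _ ^+ _) => apply: exprn_ge0
  | |- is_true (0 <= pi) => exact: pi_ge0
  | |- is_true (0 <= _ `^ _) => exact: powR_ge0
  | |- is_true (0 <= expR _) => exact: expR_ge0
  | |- is_true (0 <= Num.sqrt _) => exact: sqrtr_ge0
  | |- is_true (0 <= _) => first [by [] | by apply: ltW]
  end.

Section RadialIntegrals.
Context {R : realType}.
Notation mu := (@lebesgue_measure R).
Notation T3 := (measurableTypeR R * measurableTypeR R * measurableTypeR R)%type.

Lemma norm3E (x : space3 R) : norm3 x = Num.sqrt (sqn3 x).
Proof. by []. Qed.

Lemma sqn3_ge0 (x : space3 R) : 0 <= sqn3 x.
Proof. by rewrite /sqn3 !addr_ge0 ?sqr_ge0. Qed.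

Lemma norm3_ge0 (x : space3 R) : 0 <= norm3 x.
Proof. exact: sqrtr_ge0. Qed.

Lemma sqr_norm3 (x : space3 R) : norm3 x ^+ 2 = sqn3 x.
Proof. by rewrite sqr_sqrtr// sqn3_ge0. Qed.

Lemma measurable_norm3 : measurable_fun [set: T3] (norm3 : T3 -> R).
Proof.
apply: (@measurableT_comp _ _ _ _ _ _ (@Num.sqrt R) _ sqn3); last exact: measurable_sqn3.
by apply: continuous_measurable_fun; exact: sqrt_continuous.
Qed.

(** Here c |x| is the random variable: c |x| < b is a ball of volume (4/3) pi (b/c)^3, with
    derivative 4 pi b^2 / c^3. The scale c is built in so that e^(-c |x|) becomes e^(-s). *)
Lemma radial_integral_norm (c : R) (F : R -> R) : 0 < c ->
  measurable_fun setT F -> (forall s, 0 <= F s) ->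
  (\int[lebesgue3]_x (F (c * norm3 x))%:E =
   \int[mu]_(s in `]0%R, +oo[) (F s * (4 * pi * s ^+ 2 / c ^+ 3))%:E)%E.
Proof.
move=> c0 mF F0.
pose w (s : R) : \bar R := ((0 < s)%R%:R * (4 * pi * s ^+ 2 / c ^+ 3))%:E.
have w0 s : (0 <= w s)%E.
  rewrite lee_fin; apply: mulr_ge0; first exact: ler0n.
  apply: divr_ge0; last by rewrite exprn_ge0// ltW.
  by rewrite mulr_ge0 ?sqr_ge0// mulr_ge0// pi_ge0.
have mw : measurable_fun setT w.
  apply/measurable_EFinP; apply: measurable_funM.
    apply: (measurableT_comp (f := fun b : bool => b%:R : R)) => //.
    by apply: measurable_fun_ltr.
  by apply: measurable_funM => //; apply: measurable_funM.
have mX : measurable_fun [set: T3] ((fun x : space3 R => c * norm3 x) : T3 -> R).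
  by apply: measurable_funM => //; exact: measurable_norm3.
transitivity (\int[mu]_s ((F s)%:E * w s))%E; last first.
  rewrite [RHS]integral_mkcond; apply: eq_integral => s _.
  rewrite /patch mem_setE in_itv /= andbT /w; case: ifP => _.
    by rewrite mul1r EFinM.
  by rewrite mul0r mule0.
have wE (b : R) : (\int[mu]_(s in `]-oo, b[) w s = (4 / 3 * pi * (Num.max b 0 / c) ^+ 3)%:E)%E.
  have [b0|b0] := leP b 0.
    rewrite mul0r expr0n /= mulr0; apply: integral0_eq => s; rewrite /= in_itv /= => sb.
    by rewrite /w ltNge (ltW (lt_le_trans sb b0)) mul0r.
  pose f (s : R) : R := 4 * pi * s ^+ 2 / c ^+ 3.
  pose G (s : R) : R := 4 / 3 * pi / c ^+ 3 * (s * s * s).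
  have dG (x : R) : is_derive x 1 G (f x).
    have h : is_derive x 1 G (4 / 3 * pi / c ^+ 3 * ((x * x) * 1 + x * (x * 1 + x * 1))).
      apply: is_deriveZ; apply: is_deriveM.
    apply: is_derive_eq; rewrite /f; field; exact: lt0r_neq0.
  have cG : continuous G by move=> x; apply/differentiable_continuous/derivable1_diffP; exact: ex_derive.
  have cf : continuous f.
    move=> x; apply: cvgM; last exact: cvg_cst.
    by apply: cvgM; [exact: cvg_cst|exact: exprn_continuous].
  transitivity (\int[mu]_(s in `[0%R, b]) (f s)%:E)%E.
    rewrite [RHS](@integral_itv_bndoo _ _ _ _ true false)//; last first.
      apply/measurable_EFinP; exact: (measurable_funTS (continuous_measurable_fun cf)).
    rewrite integral_mkcond [RHS]integral_mkcond; apply: eq_integral => s _.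
    rewrite /patch !mem_setE !in_itv /= /w.
    case: (ltP s b) => sb; rewrite ?andbF//= andbT; case: (ltP 0 s) => // s0.
      by rewrite mul1r.
    by rewrite mul0r.
  rewrite (@continuous_FTC2 _ f G) //.
  - rewrite -EFinB /G; congr EFin; field; exact: lt0r_neq0.
  - exact: continuous_subspaceT.
  - split; first by move=> x _; exact: ex_derive.
    + by apply: cvg_at_right_filter; exact: cG.
    + by apply: cvg_at_left_filter; exact: cG.
  - by move=> x _; rewrite derive1E; apply: derive_val.
rewrite -(@law_integral _ T3 R leb3 (fun x => c * norm3 x) (cst 1%E) w) //.
- by apply: eq_integral => x _; rewrite mule1.
- move=> b; rewrite wE.
  have bE : 4 / 3 * pi * (Num.max b 0 / c) ^+ 3 =
      4 / 3 * pi * (Num.max ((Num.max b 0 / c) ^+ 2) 0 * Num.sqrt ((Num.max b 0 / c) ^+ 2)).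
    have h0 : 0 <= Num.max b 0 / c by rewrite divr_ge0 ?(ltW c0)// le_max lexx orbT.
    rewrite (max_l (sqr_ge0 (Num.max b 0 / c))) sqrtr_sqr ger0_norm//; ring.
  rewrite bE -ball_volume integral_mkcond.
  apply: eq_integral => x _; rewrite /patch.
  have -> : (x \in (fun x => c * norm3 x) @^-1` `]-oo, b[) = (sqn3 x < (Num.max b 0 / c) ^+ 2).
    have -> : (x \in (fun x => c * norm3 x) @^-1` `]-oo, b[) = (c * norm3 x < b).
      by apply/idP/idP; rewrite inE /= in_itv.
    rewrite -sqr_norm3.
    have [b0|b0] := leP b 0.
      rewrite mul0r expr0n /= (ltNge (norm3 x ^+ 2)) sqr_ge0; apply/negbTE; rewrite -leNgt.
      by rewrite (le_trans b0)// mulr_ge0 ?norm3_ge0// ltW.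
    rewrite ltr_pXn2r ?nnegrE ?norm3_ge0 ?divr_ge0 ?ltW//.
    by rewrite ltr_pdivlMr// mulrC.
  by case: ifP.
- by move=> b; rewrite wE ltry.
Qed.

(** The convention 0^-1 = 0 breaks continuity at the origin, so the line is split into [[set 0]] and
    its open complement. *)
Lemma measurable_invr : measurable_fun setT (@GRing.inv R).
Proof.
have -> : setT = [set 0 : R] `|` ~` [set 0] by rewrite setUv.
apply/measurable_funU => //; first exact: measurableC.
split; first exact: measurable_fun_set1.
apply: open_continuous_measurable_fun.
  apply: closed_openC; exact: closed_eq.
move=> x; rewrite inE /= => /eqP x0; exact: inv_continuous.
Qed.

Lemma powR_cvgy0 (c x : R) : 0 < x -> (c + s) `^ (- x) @[s --> +oo] --> 0.
Proof.
move=> x0; apply/cvgrPdist_lt => e e0.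
near=> s.
have cs : e^-1 `^ x^-1 < c + s.
  by rewrite -ltrBlDl; near: s; apply: nbhs_pinfty_gt; exact: num_real.
have ex0 : 0 < e^-1 `^ x^-1 by rewrite powR_gt0// invr_gt0.
rewrite sub0r normrN ger0_norm ?powR_ge0// powRN invf_plt ?posrE ?powR_gt0//; last first.
  exact: lt_trans cs.
have -> : e^-1 = (e^-1 `^ x^-1) `^ x.
  by rewrite -powRrM mulVf ?gt_eqF// powRr1// invr_ge0 ltW.
by rewrite gt0_ltr_powR// ?nnegrE ltW//; exact: lt_trans cs.
Unshelve. all: by end_near. Qed.

Lemma within_ray_continuous (f : R -> R) (a : R) :
  (forall x, a <= x -> {for x, continuous f}) -> {within `[a, +oo[, continuous f}.
Proof.
move=> cf; apply: continuous_in_subspaceT => x; rewrite inE /= in_itv /= andbT.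
exact: cf.
Qed.

Lemma FTC2y (f F : R -> R) (a l : R) : (forall x, a <= x -> 0 <= f x) ->
  (forall x, a <= x -> {for x, continuous f}) ->
  F x @[x --> +oo] --> l -> {for a, continuous F} ->
  (forall x, a < x -> is_derive x 1 F (f x)) ->
  (\int[mu]_(x in `]a, +oo[) (f x)%:E = (l - F a)%:E)%E.
Proof.
move=> f0 cf Fl cF dF.
have cf' := within_ray_continuous cf.
have E := @ge0_continuous_FTC2y R f F a l f0 cf' Fl.
rewrite EFinB -E.
- rewrite integral_itv_obnd_cbnd//; apply/measurable_EFinP.
  apply: measurable_funS (subspace_continuous_measurable_fun _ cf') => //.
  by move=> x /=; rewrite !in_itv /= !andbT => /ltW.
- by move=> x ax; have [] := dF x ax.
- exact: cvg_at_right_filter.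
- by move=> x; rewrite in_itv /= andbT => ax; rewrite derive1E; have [] := dF x ax.
Qed.

(** This is the Plummer density. With q = s / (e^2 + s), its mass inside the ball of squared radius
    s is q^(3/2), which is the primitive G below and tends to 1. *)
Lemma integral_core_density (e : R) : 0 < e ->
  (\int[lebesgue3]_x (3 / (4 * pi) * (e ^+ 2 * (e ^+ 2 + sqn3 x) ^- 2 / Num.sqrt (e ^+ 2 + sqn3 x)))%:E = 1)%E.
Proof.
move=> e0.
pose F (s : R) : R := 3 / (4 * pi) * (e ^+ 2 * (e ^+ 2 + s) ^- 2 / Num.sqrt (e ^+ 2 + s)).
have e20 : 0 < e ^+ 2 by rewrite exprn_gt0.
have F0 s : 0 <= F s.
  rewrite /F; apply: mulr_ge0; first by rewrite divr_ge0// mulr_ge0// pi_ge0.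
  by rewrite divr_ge0 ?sqrtr_ge0// mulr_ge0 ?sqr_ge0// invr_ge0 sqr_ge0.
have msqrt : measurable_fun setT (@Num.sqrt R).
  by apply: continuous_measurable_fun; exact: sqrt_continuous.
have minv : measurable_fun setT (@GRing.inv R) by exact: measurable_invr.
have mes : measurable_fun setT (fun s : R => e ^+ 2 + s) by exact: measurable_funD.
have mF : measurable_fun setT F.
  apply: measurable_funM => //; apply: measurable_funM; first apply: measurable_funM => //.
    by apply: (measurableT_comp minv); exact: measurable_funX.
  by apply: (measurableT_comp minv); exact: (measurableT_comp msqrt).
rewrite (radial_integral mF F0).
pose q (s : R) : R := s / (e ^+ 2 + s).
pose f (s : R) : R := F s * (2 * pi * Num.sqrt s).
transitivity (\int[mu]_(s in `]0%R, +oo[) (f s)%:E)%E.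
  rewrite [RHS]integral_mkcond; apply: eq_integral => s _.
  rewrite /patch mem_setE in_itv /= andbT /f; case: ltP => // s0.
  by rewrite ler0_sqrtr// mulr0 mule0.
have es0 (x : R) : 0 <= x -> 0 < e ^+ 2 + x by move=> x0; rewrite ltr_pwDl.
have cq (x : R) : 0 <= x -> {for x, continuous q}.
  move=> x0; apply: cvgM; first exact: cvg_id.
  apply: cvgV; first by rewrite gt_eqF// es0.
  by apply: cvgD; [exact: cvg_cst|exact: cvg_id].
have csq (x : R) : 0 <= x -> {for x, continuous (fun s => Num.sqrt (q s))}.
  move=> x0; apply: (@continuous_comp _ _ _ q (@Num.sqrt R)); first exact: cq.
  exact: sqrt_continuous.
pose G (s : R) : R := q s * Num.sqrt (q s).
have cG (x : R) : 0 <= x -> {for x, continuous G}.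
  by move=> x0; apply: cvgM; [exact: cq|exact: csq].
transitivity ((1 - G 0)%:E); last by rewrite /G /q mul0r mul0r subr0.
apply: FTC2y.
- move=> x x0; apply: mulr_ge0; first exact: F0.
  by rewrite mulr_ge0 ?sqrtr_ge0// mulr_ge0// pi_ge0.
- move=> x x0; apply: cvgM; last first.
    by apply: cvgM; [exact: cvg_cst|exact: sqrt_continuous].
  apply: cvgM; first exact: cvg_cst.
  have ces : {for x, continuous (fun s : R => e ^+ 2 + s : R)}.
    by apply: cvgD; [exact: cvg_cst|exact: cvg_id].
  apply: cvgM; first apply: cvgM; first exact: cvg_cst.
    apply: cvgV; first by rewrite expf_neq0// gt_eqF// es0.
    apply: (@continuous_comp _ _ _ (fun s : R => e ^+ 2 + s : R) (fun y : R => y ^+ 2)) => //.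
    exact: exprn_continuous.
  apply: cvgV; first by rewrite gt_eqF// sqrtr_gt0 es0.
  apply: (@continuous_comp _ _ _ (fun s : R => e ^+ 2 + s : R) (@Num.sqrt R)) => //.
  exact: sqrt_continuous.
- have q1 : q x @[x --> +oo] --> (1 : R).
    have h : (1 - e ^+ 2 * (e ^+ 2 + s) `^ (- 1)) @[s --> +oo] --> (1 - e ^+ 2 * 0 : R).
      by apply: cvgB; [exact: cvg_cst|apply: cvgM; [exact: cvg_cst|exact: powR_cvgy0]].
    rewrite mulr0 subr0 in h; apply: cvg_trans h; apply: near_eq_cvg.
    near=> s.
    have s0 : 0 <= s by near: s; apply: nbhs_pinfty_ge; exact: num_real.
    rewrite powR_inv1 ?(ltW (es0 _ s0))// /q; field; exact: lt0r_neq0 (es0 _ s0).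
  have : G x @[x --> +oo] --> (1 * Num.sqrt 1 : R).
    apply: cvgM => //; apply: (cvg_comp q (@Num.sqrt R) q1); exact: sqrt_continuous.
  by rewrite sqrtr1 mulr1.
- exact: cG.
- move=> x x0.
  have dq : is_derive x 1 q (e ^+ 2 / (e ^+ 2 + x) ^+ 2).
    have h1 : is_derive x 1 (fun s : R => (e ^+ 2 + s)^-1) (- (e ^+ 2 + x) ^- 2 *: (0 + 1)).
      by apply: is_deriveV; rewrite gt_eqF// es0// ltW.
    have h : is_derive x 1 q (x *: (- (e ^+ 2 + x) ^- 2 *: (0 + 1)) + (e ^+ 2 + x)^-1 *: 1).
      exact: is_deriveM.
    apply: is_derive_eq; rewrite /GRing.scale /=; field; exact: lt0r_neq0 (es0 _ (ltW x0)).
  have q0 : 0 < q x by rewrite divr_gt0// es0// ltW.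
  have dsq : is_derive x 1 (fun s => Num.sqrt (q s)) ((2 * Num.sqrt (q x))^-1 * (e ^+ 2 / (e ^+ 2 + x) ^+ 2)).
    by apply: is_derive1_comp; exact: is_derive1_sqrt.
  have h : is_derive x 1 G (q x *: ((2 * Num.sqrt (q x))^-1 * (e ^+ 2 / (e ^+ 2 + x) ^+ 2)) + Num.sqrt (q x) *: (e ^+ 2 / (e ^+ 2 + x) ^+ 2)).
    exact: is_deriveM.
  apply: is_derive_eq; rewrite /GRing.scale /= -{1}(sqr_sqrtr (ltW q0)).
  have sq0 : Num.sqrt (q x) != 0 by rewrite gt_eqF// sqrtr_gt0.
  rewrite /f /F.
  have -> : Num.sqrt x = Num.sqrt (q x) * Num.sqrt (e ^+ 2 + x).
    by rewrite -sqrtrM ?(ltW q0)// /q mulfVK// gt_eqF// es0// ltW.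
  have se0 : Num.sqrt (e ^+ 2 + x) != 0 by rewrite gt_eqF// sqrtr_gt0 es0// ltW.
  have ee0 : e ^+ 2 + x != 0 by rewrite gt_eqF// es0// ltW.
  have pi0 : (pi : R) != 0 by rewrite gt_eqF// pi_gt0.
  move: sq0 se0 ee0 pi0; move: (Num.sqrt (q x)) (Num.sqrt (e ^+ 2 + x)) (e ^+ 2 + x) (pi : R).
  move=> A B D P hA hB hD hP; field.
  by rewrite ?hA ?hB ?hD ?hP.
Unshelve. all: by end_near. Qed.

(** Enlarging sqrt(s) to sqrt(e^2 + s) turns the radial integrand into a pure power of e^2 + s with
    an explicit primitive. The constant is not sharp; what matters is that the mass is O(e). *)
Lemma integral_tail_profile (e : R) : 0 < e ->
  (\int[lebesgue3]_x (e ^+ 2 * (e ^+ 2 + sqn3 x) ^- 2)%:E <= (4 * pi * e)%:E)%E.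
Proof.
move=> e0.
pose F (s : R) : R := e ^+ 2 * (e ^+ 2 + s) ^- 2.
have e20 : 0 < e ^+ 2 by rewrite exprn_gt0.
have es0 (x : R) : 0 <= x -> 0 < e ^+ 2 + x by move=> x0; rewrite ltr_pwDl.
have F0 s : 0 <= F s.
  by rewrite /F mulr_ge0 ?sqr_ge0// invr_ge0 sqr_ge0.
have msqrt : measurable_fun setT (@Num.sqrt R).
  by apply: continuous_measurable_fun; exact: sqrt_continuous.
have mF : measurable_fun setT F.
  apply: measurable_funM => //.
  apply: (measurableT_comp measurable_invr); apply: measurable_funX.
  exact: measurable_funD.
rewrite (radial_integral mF F0).
pose f (s : R) : R := 2 * pi * e ^+ 2 * (e ^+ 2 + s) `^ (- (3 / 2)).
pose G (s : R) : R := - (4 * pi * e ^+ 2) * (e ^+ 2 + s) `^ (- 2^-1).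
have dP (a x : R) : 0 <= x -> is_derive x 1 (fun s : R => (e ^+ 2 + s) `^ a) (a * (e ^+ 2 + x) `^ (a - 1)).
  move=> x0.
  have h : is_derive x 1 (fun s : R => (e ^+ 2 + s) `^ a) (a * (e ^+ 2 + x) `^ (a - 1) * (0 + 1)).
    apply: (@is_derive1_comp _ (fun y => y `^ a) (fun s : R => e ^+ 2 + s)).
    by apply: is_derive1_powR; exact: es0.
  by apply: is_derive_eq; rewrite add0r mulr1.
have cP (a x : R) : 0 <= x -> {for x, continuous (fun s : R => (e ^+ 2 + s) `^ a)}.
  by move=> x0; apply/differentiable_continuous/derivable1_diffP; have [] := dP a x x0.
have -> : 4 * pi * e = 0 - G 0.
  rewrite /G addr0 powRN powR12_sqrt ?sqr_ge0// sqrtr_sqr ger0_norm ?ltW//.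
  by field; exact: lt0r_neq0.
suff <- : (\int[mu]_(x in `]0%R, +oo[) (f x)%:E = (0 - G 0)%:E)%E; last first.
  apply: FTC2y; first last.
  - move=> x x0.
    have h : is_derive x 1 G (- (4 * pi * e ^+ 2) *: (- 2^-1 * (e ^+ 2 + x) `^ (- 2^-1 - 1))).
      by apply: is_deriveZ; apply: dP; exact: ltW.
    apply: is_derive_eq; rewrite /f /GRing.scale /=.
    by have -> : - 2^-1 - 1 = - (3 / 2) :> R; [field|field].
  - by apply: cvgM; [exact: cvg_cst|exact: cP].
  - rewrite -[X in _ --> X](mulr0 (- (4 * pi * e ^+ 2))); apply: cvgM; first exact: cvg_cst.
    by apply: powR_cvgy0; lra.
  - by move=> x x0; apply: cvgM; [exact: cvg_cst|exact: cP].
  - by move=> x x0; rewrite /f; nneg.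
rewrite [leRHS]integral_mkcond; apply: ge0_le_integral => //.
- by move=> x _; rewrite -EFinM lee_fin /F; nneg.
- apply/measurable_EFinP; apply: measurable_funM => //.
  by apply: measurable_funM => //.
- apply/(measurable_restrictT _ _).1 => //.
  apply/measurable_EFinP/measurable_funTS; apply: measurable_funM => //.
  apply: (@measurableT_comp _ _ _ _ _ _ (fun y : R => y `^ (- (3 / 2)))) => //.
  exact: measurable_funD.
move=> s _; rewrite /patch mem_setE in_itv /= andbT; case: ltP => s0; last first.
  by rewrite ler0_sqrtr// mulr0 mule0.
rewrite -EFinM lee_fin /f /F.
have -> : - (3 / 2) = - 2%:R + 2^-1 :> R by field.
have := es0 _ (ltW s0) => ess.
rewrite powRD; last by apply/implyP => _; rewrite gt_eqF.
rewrite powRN powR_mulrn ?(ltW ess)// powR12_sqrt ?(ltW ess)//.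
rewrite [leLHS](_ : _ = 2 * pi * e ^+ 2 * ((e ^+ 2 + s) ^- 2 * Num.sqrt s)); last by ring.
apply: ler_wpM2l; first by nneg.
apply: ler_wpM2l; first by rewrite invr_ge0 sqr_ge0.
by apply: ler_wsqrtr; rewrite lerDr ltW.
Qed.

End RadialIntegrals.

(** * The gamma and beta integrals *)

Section SpecialFunctions.
Context {R : realType}.
Notation mu := (@lebesgue_measure R).
Notation T1 := (measurableTypeR R).

Lemma powRDp (x a b : R) : 0 < x -> x `^ (a + b) = x `^ a * x `^ b.
Proof. by move=> x0; rewrite powRD// (gt_eqF x0) implybT. Qed.

(** From e^t = (e^(t/4))^4 >= (1 + t/4)^4 and t^2 <= (4 + t)^2 = 16 (1 + t/4)^2, the integrand is at
    most 16 (1 + t/4)^(-2). *)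
Lemma gamma_tail_lty :
  (\int[mu]_(t in `]0%R, +oo[) (t ^+ 2 * expR (- t))%:E < +oo)%E.
Proof.
pose f (t : R) : R := 16 * (1 + t / 4) `^ (- 2).
pose G (t : R) : R := - 64 * (1 + t / 4) `^ (- 1).
have pos (x : R) : 0 <= x -> 0 < 1 + x / 4 by move=> x0; rewrite ltr_pwDl// divr_ge0.
have dP (a x : R) : 0 <= x -> is_derive x 1 (fun s : R => (1 + s / 4) `^ a) (a * (1 + x / 4) `^ (a - 1) * 4^-1).
  move=> x0.
  have h0 : is_derive x 1 (fun s : R => 1 + s / 4) (0 + 4^-1 *: 1).
    apply: is_deriveD; have h1 : is_derive x 1 (fun s : R => 4^-1 * s) (4^-1 *: 1) by exact: is_deriveZ.
    by rewrite (_ : (fun s : R => s / 4) = (fun s : R => 4^-1 * s))//; apply/funext => s; rewrite mulrC.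
  have h : is_derive x 1 (fun s : R => (1 + s / 4) `^ a) (a * (1 + x / 4) `^ (a - 1) * (0 + 4^-1 *: 1)).
    apply: (@is_derive1_comp _ (fun y => y `^ a) (fun s : R => 1 + s / 4)).
    by apply: is_derive1_powR; exact: pos.
  by apply: is_derive_eq; rewrite add0r /GRing.scale /= mulr1.
have cP (a x : R) : 0 <= x -> {for x, continuous (fun s : R => (1 + s / 4) `^ a)}.
  by move=> x0; apply/differentiable_continuous/derivable1_diffP; have [] := dP a x x0.
have fin : (\int[mu]_(x in `]0%R, +oo[) (f x)%:E = (0 - G 0)%:E)%E.
  apply: FTC2y.
  - by move=> x x0; rewrite /f; nneg.
  - by move=> x x0; apply: cvgM; [exact: cvg_cst|exact: cP].
  - rewrite -[X in _ --> X](mulr0 (- 64)); apply: cvgM; first exact: cvg_cst.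
    have h : (4^-1 `^ (- 1) * (4 + s) `^ (- 1)) @[s --> +oo] --> (4^-1 `^ (- 1) * 0 : R).
      by apply: cvgM; [exact: cvg_cst|exact: powR_cvgy0].
    rewrite mulr0 in h; apply: cvg_trans h; apply: near_eq_cvg; near=> s.
    have s0 : 0 <= s by near: s; apply: nbhs_pinfty_ge; exact: num_real.
    rewrite -powRM ?invr_ge0// ?addr_ge0//; congr (_ `^ _); by field.
  - by apply: cvgM; [exact: cvg_cst|exact: cP].
  - move=> x x0.
    have h : is_derive x 1 G (- 64 *: (- 1 * (1 + x / 4) `^ (- 1 - 1) * 4^-1)).
      by apply: is_deriveZ; apply: dP; exact: ltW.
    apply: is_derive_eq; rewrite /f /GRing.scale /= (_ : - 1 - 1 = - 2 :> R); [by field|by field].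
apply: (@le_lt_trans _ _ (\int[mu]_(x in `]0%R, +oo[) (f x)%:E)%E); last by rewrite fin ltry.
apply: ge0_le_integral => //.
- by move=> t _; rewrite lee_fin; nneg.
- apply/measurable_EFinP/measurable_funTS; apply: measurable_funM; first exact: measurable_funX.
  by apply: measurableT_comp => //; exact: measurable_expR.
- apply/measurable_EFinP/measurable_funTS; apply: measurable_funM => //.
  apply: (@measurableT_comp _ _ _ _ _ _ (fun y : R => y `^ (- 2))) => //.
  by apply: measurable_funD => //; exact: measurable_funM.
- move=> t; rewrite /= in_itv /= andbT => t0; rewrite lee_fin /f.
  have p := pos _ (ltW t0).
  rewrite powRN powR_mulrn ?(ltW p)// expRN ler_pdivrMr ?expR_gt0// mulrAC ler_pdivlMr ?exprn_gt0//.
  have -> : expR t = (expR (t / 4)) ^+ 4 by rewrite -expRM_natl; congr expR; field.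
  have e1 : 1 + t / 4 <= expR (t / 4) by apply: expR_ge1Dx.
  have e4 : (1 + t / 4) ^+ 4 <= (expR (t / 4)) ^+ 4.
    by rewrite lerXn2r// nnegrE ?expR_ge0// ltW.
  apply: (@le_trans _ _ (16 * (1 + t / 4) ^+ 4)); last by rewrite ler_pM2l.
  rewrite -[(1 + t / 4) ^+ 4]/((1 + t / 4) ^+ (2 + 2)) exprD mulrA ler_pM2r ?exprn_gt0//.
  have -> : 16 * (1 + t / 4) ^+ 2 = (4 + t) ^+ 2 by field.
  by rewrite lerXn2r// ?nnegrE ?addr_ge0 ?(ltW t0)// lerDr.
Unshelve. all: by end_near. Qed.

Lemma powR_int01_lty (a : R) : -1 < a ->
  (\int[mu]_(t in `]0%R, 1%R]) (t `^ a)%:E < +oo)%E.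
Proof.
move=> a1.
have a0 : 0 < a + 1 by lra.
(* The offset 2 keeps the left endpoint strictly below 1, as the fundamental theorem on a segment
   requires. *)
pose I (n : nat) : set T1 := `[n.+2%:R^-1, 1%R]%classic.
have mf (D : set T1) : measurable_fun D (fun t : T1 => (t `^ a)%:E).
  by apply/measurable_EFinP/measurable_funTS.
have IU : \bigcup_i I i = (`]0%R, 1%R]%classic : set T1).
  apply/seteqP; split=> x /=.
    by move=> [n _]; rewrite /I /= !in_itv /= => /andP[h ->]; rewrite andbT (lt_le_trans _ h)// invr_gt0.
  rewrite in_itv /= => /andP[x0 x1]; exists (Num.trunc x^-1) => //=.
  rewrite /I /= in_itv /= x1 andbT invf_ple ?posrE//; apply: (ltW (lt_le_trans (truncnS_gt _) _)); by rewrite ler_nat.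
have nd : {homo I : n m / (n <= m)%N >-> (n <= m)%O}.
  move=> n m nm; apply/subsetPset => x; rewrite /I /= !in_itv /= => /andP[h ->]; rewrite andbT.
  by apply: le_trans h; rewrite lef_pV2 ?posrE// ler_nat.
have mI i : measurable (I i) by rewrite /I; exact: measurable_itv.
have f0 : forall (i : nat) (x : T1), I i x -> (0%R <= (x `^ a)%:E)%E by move=> i x _; rewrite lee_fin powR_ge0.
have cvgI := @ge0_nondecreasing_set_cvg_integral _ T1 R I (fun t => (t `^ a)%:E) mu nd mI (fun i => mf _) f0.
rewrite IU in cvgI.
apply: (@le_lt_trans _ _ ((a + 1)^-1)%:E); last by rewrite ltry.
rewrite -(cvg_lim _ cvgI)//; apply: lime_le; first by apply/cvg_ex; eexists; exact: cvgI.
apply: nearW => n.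
pose G (t : R) : R := (a + 1)^-1 * t `^ (a + 1).
have n0 : (0 : R) < n.+2%:R^-1 by rewrite invr_gt0.
have dP (b x : R) : 0 < x -> {for x, continuous (fun s : R => s `^ b)}.
  by move=> x0; apply/differentiable_continuous/derivable1_diffP; have [] := is_derive1_powR b x0.
have cG (x : R) : 0 < x -> {for x, continuous G}.
  by move=> x0; apply: cvgM; [exact: cvg_cst|exact: dP].
have dG (x : R) : 0 < x -> is_derive x 1 G (x `^ a).
  move=> x0.
  have h : is_derive x 1 G ((a + 1)^-1 *: ((a + 1) * x `^ (a + 1 - 1))).
    by apply: is_deriveZ; exact: is_derive1_powR.
  by apply: is_derive_eq; rewrite /GRing.scale /= addrK mulKf// gt_eqF.
rewrite /I (@continuous_FTC2 _ (fun t : R => t `^ a) G) //.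
- by rewrite -EFinB lee_fin /G powR1 mulr1 gerBl mulr_ge0 ?powR_ge0// invr_ge0 ltW//.
- by rewrite invf_lt1 ?ltr1n.
- apply: continuous_in_subspaceT => x; rewrite inE /= in_itv /= => /andP[x0 _].
  by apply: dP; exact: lt_le_trans x0.
- split.
  + by move=> x; rewrite in_itv /= => /andP[x0 _]; have [] := dG x (lt_trans n0 x0).
  + by apply: cvg_at_right_filter; exact: cG.
  + by apply: cvg_at_left_filter; exact: cG.
- by move=> x; rewrite in_itv /= => /andP[x0 _]; rewrite derive1E; have [] := dG x (lt_trans n0 x0).
Qed.

(** Near 0 the exponential is at most 1 and t^a is integrable; beyond 1, t^a <= t^2 because a <=
    2. *)
Lemma gamma_lty (a : R) : -1 < a -> a <= 2 ->
  (\int[mu]_(t in `]0%R, +oo[) (t `^ a * expR (- t))%:E < +oo)%E.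
Proof.
move=> a1 a2.
have mg (b : R) (D : set T1) : measurable_fun D (fun t : T1 => (t `^ b)%:E).
  by apply/measurable_EFinP/measurable_funTS.
have me : measurable_fun setT (fun t : T1 => expR (- t)).
  by apply: measurableT_comp => //; exact: measurable_expR.
have mf (D : set T1) : measurable_fun D (fun t : T1 => (t `^ a * expR (- t))%:E).
  by apply/measurable_EFinP/measurable_funTS; apply: measurable_funM.
have -> : (`]0%R, +oo[%classic : set T1) = `]0%R, 1%R] `|` `]1%R, +oo[.
  apply/seteqP; split=> x /=; rewrite !in_itv /= ?andbT.
    by move=> ->; case: (leP x 1); [left|right].
  by case=> [/andP[]//|]; apply: lt_trans.
rewrite ge0_integral_setU//=; first last.
- by apply/disj_setPS => x /= []; rewrite !in_itv /= andbT => /andP[_ h1] h2; lra.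
- by move=> x _; rewrite lee_fin; nneg.
rewrite lte_add_pinfty//.
- apply: le_lt_trans (powR_int01_lty a1); apply: ge0_le_integral => //.
  + by move=> t _; rewrite lee_fin; nneg.
  + move=> t; rewrite /= in_itv /= => /andP[t0 _]; rewrite lee_fin ler_piMr ?powR_ge0//.
    by rewrite expR_le1 oppr_le0 ltW.
- apply: le_lt_trans gamma_tail_lty.
  apply: (@le_trans _ _ (\int[mu]_(t in `]1%R, +oo[) (t ^+ 2 * expR (- t))%:E)%E).
    apply: ge0_le_integral => //.
    + by move=> t _; rewrite lee_fin; nneg.
    + by apply/measurable_EFinP/measurable_funTS; apply: measurable_funM.
    + move=> t; rewrite /= in_itv /= andbT => t1; rewrite lee_fin ler_pM2r ?expR_gt0//.
      have t0 : 0 < t by lra.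
      by rewrite -powR_mulrn ?(ltW t0)//; apply: ler_powR => //; exact: ltW.
  apply: ge0_subset_integral => //.
  + by apply/measurable_EFinP/measurable_funTS; apply: measurable_funM.
  + by move=> t _; rewrite lee_fin; nneg.
  + by move=> t /=; rewrite !in_itv /= !andbT; apply: lt_trans.
Qed.

(** [Gamma_fun] is a real-valued integral, which would silently be 0 if the extended one were
    infinite; finiteness is therefore the content. The range s <= 3 suffices since the argument will
    be 3 - k with k > 0. *)
Lemma Gamma_funE (s : R) : 0 < s -> s <= 3 ->
  ((Gamma_fun s)%:E = \int[mu]_(t in `]0%R, +oo[) (t `^ (s - 1) * expR (- t))%:E)%E.
Proof.
move=> s0 s3; rewrite /Gamma_fun /Rintegral fineK// ge0_fin_numE.
  by apply: gamma_lty; lra.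
by apply: integral_ge0 => t _; rewrite lee_fin; nneg.
Qed.

(** After the substitution t = k c |x| the k-th power of the exponential is e^(-t), and t^2 t^(-k)
    is the integrand of the gamma function at 3 - k. The condition k < 3 is integrability at the
    origin. *)
Lemma yukawa_integral (c k : R) : 0 < c -> 0 < k -> k < 3 ->
  (\int[lebesgue3]_x ((expR (- (c * norm3 x)) / (4 * pi * norm3 x)) `^ k)%:E =
   ((4 * pi) `^ (1 - k) * Gamma_fun (3 - k) * (k * c) `^ (k - 3))%:E)%E.
Proof.
move=> c0 k0 k3.
pose C := k * c; have C0 : 0 < C by exact: mulr_gt0.
have pi0 := @pi_gt0 R.
have pi4 : (0 : R) < 4 * pi by rewrite mulr_gt0.
pose F (u : R) : R := (expR (- (u / k)) * C / (4 * pi * u)) `^ k.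
have mF : measurable_fun setT F.
  apply: (@measurableT_comp _ _ _ _ _ _ (fun y : R => y `^ k)) => //.
  apply: measurable_funM; first apply: measurable_funM => //.
    apply: measurableT_comp; first exact: measurable_expR.
    by apply: measurableT_comp => //; exact: measurable_funM.
  by apply: (measurableT_comp measurable_invr); exact: measurable_funM.
have F0 s : 0 <= F s by exact: powR_ge0.
transitivity (\int[lebesgue3]_x (F (C * norm3 x))%:E)%E.
  apply: eq_integral => x _; rewrite /F; congr EFin; congr (_ `^ _).
  have -> : C * norm3 x / k = c * norm3 x by rewrite /C; field; exact: lt0r_neq0.
  rewrite [4 * pi * (C * _)](_ : _ = C * (4 * pi * norm3 x)); last by ring.
  by rewrite (invfM C) mulrA mulfK// gt_eqF.
rewrite (radial_integral_norm C0 mF F0).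
transitivity (\int[mu]_(t in `]0%R, +oo[) (((4 * pi) `^ (1 - k) * C `^ (k - 3))%:E * (t `^ (3 - k - 1) * expR (- t))%:E))%E.
  apply: eq_integral => t; rewrite inE /= in_itv /= andbT => t0; rewrite -EFinM; congr EFin.
  have t4 : 0 < 4 * pi * t by rewrite mulr_gt0.
  rewrite /F -mulrA powRM; [|exact: expR_ge0|by rewrite divr_ge0// ltW].
  have -> : expR (- (t / k)) `^ k = expR (- t).
    by rewrite -expRM; congr expR; rewrite mulNr divfK// gt_eqF.
  have -> : (C / (4 * pi * t)) `^ k = C `^ k * (4 * pi) `^ (- k) * t `^ (- k).
    rewrite powRM ?(ltW C0) ?invr_ge0 ?(ltW t4)// -(mulrA (C `^ k)); congr (_ * _).
    by rewrite -powR_inv1 ?(ltW t4)// -powRrM mulN1r powRM// ltW.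
  rewrite (powRDp 1 (- k) pi4).
  rewrite powRr1 ?(ltW pi4)//.
  have -> : C `^ (k - 3) = C `^ k / C ^+ 3.
    by rewrite (powRDp k (- 3) C0) powRN powR_mulrn// ltW.
  have -> : t `^ (3 - k - 1) = t ^+ 2 * t `^ (- k).
    rewrite (_ : 3 - k - 1 = 2%:R + - k); last by ring.
    by rewrite (powRDp _ _ t0) powR_mulrn// ltW.
  by field; rewrite gt_eqF.
rewrite ge0_integralZl//.
- rewrite -Gamma_funE ?subr_gt0//; last by lra.
  by rewrite -EFinM; congr EFin; ring.
- apply/measurable_EFinP/measurable_funTS; apply: measurable_funM => //.
  by apply: measurableT_comp => //; exact: measurable_expR.
- by move=> t _; rewrite lee_fin; nneg.
- by rewrite lee_fin; nneg.
Qed.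

Lemma integral_oneDV (b : R) : 0 < b ->
  (\int[mu]_(u in `]0%R, (b / (1 + b))%R[) ((1 - u) ^- 2)%:E = b%:E)%E.
Proof.
move=> b0.
set v := b / (1 + b).
have b1 : 0 < 1 + b by lra.
have v0 : 0 < v by exact: divr_gt0.
have v1 : v < 1 by rewrite ltr_pdivrMr// mul1r ltrDr.
pose f (u : R) : R := (1 - u) ^- 2.
pose G (u : R) : R := (1 - u)^-1.
have p (x : R) : x <= v -> 1 - x != 0 by move=> xv; rewrite gt_eqF//; lra.
have dG (x : R) : x <= v -> is_derive x 1 G (f x).
  move=> xv.
  have h : is_derive x 1 G (- (1 - x) ^- 2 *: (0 - 1)).
    by apply: is_deriveV => /=; exact: p.
  by apply: is_derive_eq; rewrite /GRing.scale /= sub0r mulrN1 opprK.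
have cG (x : R) : x <= v -> {for x, continuous G}.
  by move=> x0; apply/differentiable_continuous/derivable1_diffP; have [] := dG x x0.
have cf (x : R) : x <= v -> {for x, continuous f}.
  move=> xv; apply: cvgV; first by rewrite expf_neq0// p.
  apply: (@continuous_comp _ _ _ (fun s : R => 1 - s : R) (fun y : R => y ^+ 2)).
    by apply: cvgB; [exact: cvg_cst|exact: cvg_id].
  exact: exprn_continuous.
have cf' : {within `[0, v], continuous f}.
  by apply: continuous_in_subspaceT => x; rewrite inE /= in_itv /= => /andP[_ xv]; exact: cf.
transitivity (\int[mu]_(u in `[0%R, v]) (f u)%:E)%E.
  rewrite [RHS](@integral_itv_bndoo _ _ _ _ true false)//.
  apply/measurable_EFinP; apply: measurable_funS (subspace_continuous_measurable_fun _ cf') => //.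
  by apply: subset_itvW.
rewrite (@continuous_FTC2 _ f G) //.
- rewrite -EFinB /G /v subr0 invr1; congr EFin.
  have -> : 1 - b / (1 + b) = (1 + b)^-1 by field; exact: lt0r_neq0.
  by rewrite invrK addrC addKr.
- split.
  + by move=> x; rewrite in_itv /= => /andP[_ /ltW xv]; have [] := dG x xv.
  + by apply: cvg_at_right_filter; apply: cG; exact: ltW.
  + by apply: cvg_at_left_filter; exact: cG.
- by move=> x; rewrite in_itv /= => /andP[_ /ltW xv]; rewrite derive1E; have [] := dG x xv.
Qed.

(** The substitution s = u / (1 - u), obtained from distribution functions: u / (1 - u) < b means u
    < b / (1 + b), and (1 - u)^(-2) has integral b up to that point. *)
Lemma integral_ray_onto_unit (F : R -> R) : measurable_fun setT F -> (forall s, 0 <= F s) ->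
  (\int[mu]_(s in `]0%R, +oo[) (F s)%:E =
   \int[mu]_(u in `]0%R, 1%R[) (F (u / (1 - u)) * (1 - u) ^- 2)%:E)%E.
Proof.
move=> mF F0.
pose X (u : R) : R := u / (1 - u).
pose i01 (u : R) : R := ((0 < u) && (u < 1))%R%:R.
pose rho (u : R) : \bar R := (i01 u * (1 - u) ^- 2)%:E.
pose w (s : R) : \bar R := (((0 < s)%R%:R) : R)%:E.
have mb (h : T1 -> bool) : measurable_fun setT h -> measurable_fun setT (fun x => (h x)%:R : R).
  by move=> mh; apply: (measurableT_comp (f := fun b : bool => b%:R : R)).
have m1 : measurable_fun setT (fun u : T1 => 1 - u) by exact: measurable_funB.
have mX : measurable_fun setT X.
  by apply: measurable_funM => //; exact: (measurableT_comp measurable_invr).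
have mrho : measurable_fun setT rho.
  apply/measurable_EFinP; apply: measurable_funM.
    by apply: mb; apply: measurable_and; exact: measurable_fun_ltr.
  by apply: (measurableT_comp measurable_invr); exact: measurable_funX.
have mw : measurable_fun setT w.
  by apply/measurable_EFinP; apply: mb; exact: measurable_fun_ltr.
have wE (b : R) : (\int[mu]_(s in `]-oo, b[) w s = (Num.max b 0)%:E)%E.
  transitivity (\int[mu]_s (EFin \o \1_(`]0%R, b[%classic : set T1)) s)%E.
    rewrite integral_mkcond; apply: eq_integral => s _.
    rewrite /patch mem_setE /= indicE mem_setE !in_itv /= /w.
    by case: (ltP s b); rewrite ?andbT ?andbF.
  rewrite integral_indic//= setIT.
  have -> := @lebesgue_measure_itv R `]0, b[.
  by rewrite /= lte_fin; case: ltP => // b0; rewrite sube0.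
have rhoE (b : R) : (\int[mu]_(u in X @^-1` `]-oo, b[) rho u = (Num.max b 0)%:E)%E.
  have [b0|b0] := leP b 0.
    apply: integral0_eq => u; rewrite /= in_itv /= /X /rho /i01 => ub.
    case: (ltP 0 u) => [u0|]; last by rewrite mul0r.
    case: (ltP u 1) => [u1|]; last by rewrite mul0r.
    have h : 0 < u / (1 - u) by rewrite divr_gt0//; lra.
    by have := lt_le_trans (lt_trans h ub) b0; rewrite ltxx.
  rewrite -[RHS](integral_oneDV b0) integral_mkcond [RHS]integral_mkcond.
  apply: eq_integral => u _; rewrite /patch.
  have -> : (u \in X @^-1` `]-oo, b[) = (X u < b).
    by apply/idP/idP; rewrite inE /= in_itv.
  rewrite mem_setE in_itv /= /rho /i01.
  have [u0|u0] := ltP 0 u; last by rewrite mul0r; case: ifP.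
  have b1 : 0 < 1 + b by lra.
  have [u1|u1] := ltP u 1; rewrite /=.
    rewrite mul1r /X ltr_pdivrMr ?subr_gt0// ltr_pdivlMr//.
    by rewrite (_ : (u < b * (1 - u)) = (u * (1 + b) < b))//; apply/idP/idP => ?; lra.
  have h : b / (1 + b) <= u by apply: le_trans u1; rewrite ler_pdivrMr// mul1r; lra.
  by rewrite mul0r (ltNge u) h; case: ifP.
have := @law_integral _ T1 R mu X rho w mX mrho _ mw _ _ _ F mF F0.
have -> : (\int[mu]_x ((F (X x))%:E * rho x) = \int[mu]_(u in `]0%R, 1%R[) (F (u / (1 - u)) * (1 - u) ^- 2)%:E)%E.
  rewrite [RHS]integral_mkcond; apply: eq_integral => u _.
  rewrite /patch mem_setE in_itv /= /rho /i01; case: ifP => _; first by rewrite mul1r EFinM.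
  by rewrite mul0r mule0.
have -> : (\int[mu]_s ((F s)%:E * w s) = \int[mu]_(s in `]0%R, +oo[) (F s)%:E)%E.
  rewrite [RHS]integral_mkcond; apply: eq_integral => s _.
  rewrite /patch mem_setE in_itv /= andbT /w; case: ifP => _; first by rewrite mule1.
  by rewrite mule0.
move=> ->//.
- by move=> u; rewrite lee_fin mulr_ge0 ?invr_ge0 ?sqr_ge0// ler0n.
- by move=> s; rewrite lee_fin ler0n.
- by move=> b; rewrite wE rhoE.
- by move=> b; rewrite wE ltry.
Qed.

(** In the variable s = |x|^2 the integral is that of 2 pi sqrt(s) (1 + s)^(-m), and u = s / (1 + s)
    carries it to u^(1/2) (1 - u)^(m - 5/2) on the unit interval. It will be used with m = tau r /
    2. *)
Lemma japanese_integral (m : R) : 3 / 2 < m ->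
  (\int[lebesgue3]_x ((1 + norm3 x ^+ 2) `^ (- m))%:E =
   (2 * pi * Beta_fun (3 / 2) (m - 3 / 2))%:E)%E.
Proof.
move=> m32.
have pi0 := @pi_gt0 R.
pose F (s : R) : R := (1 + s) `^ (- m).
have mpow (a : R) : measurable_fun setT (fun s : T1 => (1 + s) `^ a).
  apply: (@measurableT_comp _ _ _ _ _ _ (fun y : R => y `^ a)) => //.
  exact: measurable_funD.
have mF : measurable_fun setT F by exact: mpow.
have msqrt : measurable_fun setT (@Num.sqrt R).
  by apply: continuous_measurable_fun; exact: sqrt_continuous.
pose g (s : R) : R := F s * (2 * pi * Num.sqrt s).
have mg : measurable_fun setT g by apply: measurable_funM => //; exact: measurable_funM.
have g0 s : 0 <= g s by rewrite /g /F; nneg.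
transitivity (\int[mu]_(s in `]0%R, +oo[) (g s)%:E)%E.
  under eq_integral do rewrite sqr_norm3.
  rewrite (@radial_integral _ F)//; last by move=> s; exact: powR_ge0.
  rewrite [RHS]integral_mkcond; apply: eq_integral => s _.
  rewrite /patch mem_setE in_itv /= andbT /g -EFinM; case: ltP => // s0.
  by rewrite ler0_sqrtr// !mulr0.
(* Finiteness is settled first because [Beta_fun] is a real integral, equal to 0 by convention if
   the extended integral is infinite. *)
have gfin : (\int[mu]_(s in `]0%R, +oo[) (g s)%:E < +oo)%E.
  pose f (s : R) : R := 2 * pi * (1 + s) `^ (2^-1 - m).
  pose G (s : R) : R := 2 * pi / (3 / 2 - m) * (1 + s) `^ (- (m - 3 / 2)).
  have dP (a x : R) : 0 <= x -> is_derive x 1 (fun s : R => (1 + s) `^ a) (a * (1 + x) `^ (a - 1)).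
    move=> x0.
    have h : is_derive x 1 (fun s : R => (1 + s) `^ a) (a * (1 + x) `^ (a - 1) * (0 + 1)).
      apply: (@is_derive1_comp _ (fun y => y `^ a) (fun s : R => 1 + s)).
      by apply: is_derive1_powR; rewrite ltr_pwDl.
    by apply: is_derive_eq; rewrite add0r mulr1.
  have cP (a x : R) : 0 <= x -> {for x, continuous (fun s : R => (1 + s) `^ a)}.
    by move=> x0; apply/differentiable_continuous/derivable1_diffP; have [] := dP a x x0.
  have fin : (\int[mu]_(x in `]0%R, +oo[) (f x)%:E = (0 - G 0)%:E)%E.
    apply: FTC2y.
    - by move=> x x0; rewrite /f; nneg.
    - by move=> x x0; apply: cvgM; [exact: cvg_cst|exact: cP].
    - rewrite -[X in _ --> X](mulr0 (2 * pi / (3 / 2 - m))); apply: cvgM; first exact: cvg_cst.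
      by apply: powR_cvgy0; lra.
    - by apply: cvgM; [exact: cvg_cst|exact: cP].
    - move=> x x0.
      have h : is_derive x 1 G (2 * pi / (3 / 2 - m) *: (- (m - 3 / 2) * (1 + x) `^ (- (m - 3 / 2) - 1))).
        by apply: is_deriveZ; apply: dP; exact: ltW.
      apply: is_derive_eq; rewrite /f /GRing.scale /=.
      rewrite (_ : - (m - 3 / 2) - 1 = 2^-1 - m); last by field.
      have m0 : 3 / 2 - m != 0 by rewrite lt_eqF//; lra.
      rewrite mulrA (_ : - (m - 3 / 2) = 3 / 2 - m); last by ring.
      by rewrite divfK.
  apply: (@le_lt_trans _ _ (\int[mu]_(x in `]0%R, +oo[) (f x)%:E)%E); last by rewrite fin ltry.
  apply: ge0_le_integral => //.
  - by move=> s _; rewrite lee_fin.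
  - exact/measurable_EFinP/measurable_funTS.
  - by apply/measurable_EFinP/measurable_funTS; apply: measurable_funM.
  - move=> s; rewrite /= in_itv /= andbT => s0; rewrite lee_fin /g /f /F.
    have p : 0 < 1 + s by lra.
    rewrite (addrC 2^-1) (powRDp _ _ p).
    rewrite powR12_sqrt ?(ltW p)// mulrC -!mulrA ler_pM2l// ler_pM2l//.
    rewrite mulrC; apply: ler_wpM2l; first exact: powR_ge0.
    by apply: ler_wsqrtr; lra.
have gE : (\int[mu]_(s in `]0%R, +oo[) (g s)%:E =
    \int[mu]_(u in `]0%R, 1%R[) ((2 * pi) * (u `^ (3 / 2 - 1) * (1 - u) `^ (m - 3 / 2 - 1)))%:E)%E.
  rewrite (integral_ray_onto_unit mg g0); apply: eq_integral => u.
  rewrite inE /= in_itv /= => /andP[u0 u1]; congr EFin; rewrite /g /F.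
  have v0 : 0 < 1 - u by lra.
  have -> : 1 + u / (1 - u) = (1 - u)^-1 by field; exact: lt0r_neq0.
  have -> : (1 - u)^-1 `^ (- m) = (1 - u) `^ m.
    by rewrite -powR_inv1 ?ltW// -powRrM mulN1r opprK.
  rewrite sqrtrM ?ltW// sqrtrV ?(ltW v0)// -!powR12_sqrt ?ltW//.
  rewrite (_ : 3 / 2 - 1 = 2^-1); last by field.
  rewrite (_ : m - 3 / 2 - 1 = m - 2^-1 - 2%:R); last by field.
  rewrite !(powRDp _ _ v0) !powRN powR_mulrn ?(ltW v0)//.
  by ring.
rewrite gE; rewrite gE in gfin; rewrite /Beta_fun.
have mB : measurable_fun setT (fun u : T1 => u `^ (3 / 2 - 1) * (1 - u) `^ (m - 3 / 2 - 1)).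
  apply: measurable_funM => //.
  apply: (@measurableT_comp _ _ _ _ _ _ (fun y : R => y `^ _)) => //.
  exact: measurable_funB.
have E : (\int[mu]_(u in `]0%R, 1%R[) ((2 * pi) * (u `^ (3 / 2 - 1) * (1 - u) `^ (m - 3 / 2 - 1)))%:E =
  (2 * pi)%:E * \int[mu]_(u in `]0%R, 1%R[) (u `^ (3 / 2 - 1) * (1 - u) `^ (m - 3 / 2 - 1))%:E)%E.
  under eq_integral do rewrite EFinM.
  rewrite ge0_integralZl//; last by rewrite lee_fin; nneg.
  - exact/measurable_EFinP/measurable_funTS.
  - by move=> u _; rewrite lee_fin; nneg.
rewrite E in gfin *; rewrite [RHS]EFinM /Rintegral [in RHS]fineK// ge0_fin_numE.
  rewrite ltey; apply/eqP => Ioo; move: gfin.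
  by rewrite Ioo gt0_muley// lte_fin mulr_gt0.
by apply: integral_ge0 => u _; rewrite lee_fin; nneg.
Qed.

End SpecialFunctions.

(** * Cut-off Helmholtz kernels as test functions *)

Section Bump.
Context {R : realType}.
Implicit Types (n : nat) (v : R).

(** For n = 0 the standard flat function. The factors v^(-n) make the family closed, up to linear
    combinations, under differentiation. *)
Definition bump n v : R := if 0 < v then v ^- n * expR (- v^-1) else 0.

Lemma bump_ge0 n v : 0 <= bump n v.
Proof.
rewrite /bump; case: ltP => // v0.
by rewrite mulr_ge0 ?expR_ge0// invr_ge0 exprn_ge0// ltW.
Qed.

(** One term of the exponential series: e^(1/v) >= (1/v)^(n+2) / (n+2)!. Order two is what makes the
    derivative at 0 vanish. *)
Lemma bump_le_sqr n v : bump n v <= (n.+2)`!%:R * v ^+ 2.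
Proof.
rewrite /bump; case: ltP => [v0|_]; last by rewrite mulr_ge0// sqr_ge0.
have vi : 0 <= v^-1 by rewrite invr_ge0 ltW.
have f0 : (0 : R) < (n.+2)`!%:R by rewrite ltr0n fact_gt0.
have h : v^-1 ^+ n.+2 / (n.+2)`!%:R <= expR v^-1.
  by apply: le_trans (expR_ge1Dxn n.+1 vi); rewrite lerDr.
rewrite expRN ler_pdivrMr ?expR_gt0//.
apply: (@le_trans _ _ ((n.+2)`!%:R * v ^+ 2 * (v^-1 ^+ n.+2 / (n.+2)`!%:R))).
  rewrite -exprVn !exprS; move: (v^-1 ^+ n) => W.
  rewrite le_eqVlt; apply/orP; left; apply/eqP; field.
  by rewrite !gt_eqF.
by rewrite ler_wpM2l// mulr_ge0 ?sqr_ge0// ltW.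
Qed.

Lemma bump_le n v : v <= 1 -> bump n v <= (n.+2)`!%:R.
Proof.
move=> v1; have [v0|v0] := leP v 0.
  by rewrite /bump ltNge v0.
apply: (le_trans (bump_le_sqr n v)); rewrite ler_piMr//.
by rewrite expr_le1// ltW.
Qed.

Lemma is_derive_bump n v :
  is_derive v 1 (bump n) (bump n.+2 v - n%:R * bump n.+1 v).
Proof.
have [v0|] := ltP 0 v.
  have d1 : is_derive v 1 (fun x : R => x^-1) (- v ^- 2 *: 1).
    by apply: is_deriveV; rewrite gt_eqF.
  have d2 : is_derive v 1 (fun x : R => expR (- x^-1)) (expR (- v^-1) * v ^- 2).
    have h : is_derive v 1 (fun x : R => - x^-1) (- (- v ^- 2 *: 1)) by exact: is_deriveN.
    have := @is_derive1_comp _ expR (fun x : R => - x^-1) v _ _ (is_derive_expR _) h.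
    by rewrite /GRing.scale /= mulr1 opprK.
  have d3 : is_derive v 1 (fun x : R => x ^- n) ((n%:R * v^-1 ^+ n.-1) *: (- v ^- 2 *: 1)).
    rewrite (_ : (fun x : R => x ^- n) = (fun x : R => x^-1) ^+ n); first exact: is_deriveX.
    by apply/funext => x; rewrite fctE exprVn.
  have d : is_derive v 1 (fun x : R => x ^- n * expR (- x^-1)) (bump n.+2 v - n%:R * bump n.+1 v).
    have := is_deriveM d3 d2; move/is_derive_eq; apply.
    rewrite /bump v0 /GRing.scale /= mulr1.
    have vn : v != 0 by rewrite gt_eqF.
    case: n {d3} => [|n]; first by rewrite mul0r expr0 invr1 mul1r !mul0r subr0 mulr0 addr0 mulrC.
    rewrite -!exprVn /= !exprS; move: (v^-1 ^+ n) => W; field; exact: vn.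
  apply: (near_eq_is_derive (f := fun x : R => x ^- n * expR (- x^-1))) d.
  by near=> x; rewrite /bump ifT//; near: x; exact: lt_nbhsr.
rewrite le_eqVlt => /predU1P[->|v0]; last first.
  rewrite /bump !ltNge !(ltW v0) /= mulr0 subr0.
  apply: (near_eq_is_derive (f := cst 0)).
  by near=> x; rewrite ifN// -leNgt; apply/ltW; near: x; exact: lt_nbhsl.
rewrite /bump !ltxx mulr0 subr0.
(* At the origin the quadratic bound makes the difference quotient at most (n+2)! |x|. *)
have h : (fun h : R => h^-1 *: ((bump n \o shift 0) (h *: 1) - bump n 0)) @ 0^' --> (0 : R).
  apply/cvgrPdist_le => e e0; near=> x.
  have x0 : x != 0 by near: x; exact: nbhs_dnbhs_neq.
  have f0 : (0 : R) < (n.+2)`!%:R by rewrite ltr0n fact_gt0.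
  rewrite sub0r normrN /= addr0 /GRing.scale /= mulr1 [bump n 0]/bump ltxx subr0.
  rewrite normrM normrV ?unitfE// (ger0_norm (bump_ge0 _ _)).
  rewrite ler_pdivrMl ?normr_gt0//.
  apply: (le_trans (bump_le_sqr n x)).
  rewrite -real_normK ?num_real// expr2 mulrCA ler_pM2l ?normr_gt0//.
  rewrite -ler_pdivlMl//.
  near: x; apply: dnbhs0_le; rewrite mulr_gt0// invr_gt0//.
by apply: DeriveDef; [apply/cvg_ex; exists 0; exact: h|exact: cvg_lim h].
Unshelve. all: by end_near. Qed.

Lemma continuous_bump n : continuous (bump n).
Proof.
by move=> v; apply/differentiable_continuous/derivable1_diffP; have [] := is_derive_bump n v.
Qed.

End Bump.

Section Waves.
Context {R : realType}.
Variables (kap sig : R).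
Implicit Types (t a b : R) (n : nat).

(* [wave1] and [wave2] are the real and imaginary parts of e^(i (sig + i kap) sqrt t). *)
Definition wave1 t : R := expR (- (kap * Num.sqrt t)) * cos (sig * Num.sqrt t).
Definition wave2 t : R := expR (- (kap * Num.sqrt t)) * sin (sig * Num.sqrt t).
(** Here t stands for rho^2. The case n = 1 contains the kernel, and the larger n are what its
    derivatives require. *)
Definition wave a b n t : R := (a * wave1 t + b * wave2 t) * (Num.sqrt t) ^- n.

Lemma is_derive_wave1 t : 0 < t ->
  is_derive t 1 wave1 ((- kap * wave1 t - sig * wave2 t) / (2 * Num.sqrt t)).
Proof.
move=> t0.
have ds := is_derive1_sqrt t0.
have s0 : Num.sqrt t != 0 by rewrite gt_eqF// sqrtr_gt0.
have de : is_derive t 1 (fun x => expR (- (kap * Num.sqrt x))) (expR (- (kap * Num.sqrt t)) * - (kap *: (2 * Num.sqrt t)^-1)).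
  apply: (@is_derive1_comp _ expR (fun x => - (kap * Num.sqrt x))).
have dc : is_derive t 1 (fun x => cos (sig * Num.sqrt x)) (- sin (sig * Num.sqrt t) * (sig *: (2 * Num.sqrt t)^-1)).
  apply: (@is_derive1_comp _ cos (fun x => sig * Num.sqrt x)).
have := is_deriveM de dc; move/is_derive_eq; apply.
by rewrite /GRing.scale /= /wave1 /wave2; field.
Qed.

Lemma is_derive_wave2 t : 0 < t ->
  is_derive t 1 wave2 ((- kap * wave2 t + sig * wave1 t) / (2 * Num.sqrt t)).
Proof.
move=> t0.
have ds := is_derive1_sqrt t0.
have s0 : Num.sqrt t != 0 by rewrite gt_eqF// sqrtr_gt0.
have de : is_derive t 1 (fun x => expR (- (kap * Num.sqrt x))) (expR (- (kap * Num.sqrt t)) * - (kap *: (2 * Num.sqrt t)^-1)).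
  apply: (@is_derive1_comp _ expR (fun x => - (kap * Num.sqrt x))).
have dc : is_derive t 1 (fun x => sin (sig * Num.sqrt x)) (cos (sig * Num.sqrt t) * (sig *: (2 * Num.sqrt t)^-1)).
  apply: (@is_derive1_comp _ sin (fun x => sig * Num.sqrt x)).
have := is_deriveM de dc; move/is_derive_eq; apply.
by rewrite /GRing.scale /= /wave1 /wave2; field.
Qed.

Lemma is_derive_sqrtVn n t : 0 < t ->
  is_derive t 1 (fun x : R => (Num.sqrt x) ^- n) (- (n%:R / 2) * (Num.sqrt t) ^- n.+2).
Proof.
move=> t0.
have s0 : Num.sqrt t != 0 by rewrite gt_eqF// sqrtr_gt0.
have ds : is_derive t 1 (@Num.sqrt R) (2 * Num.sqrt t)^-1 by exact: is_derive1_sqrt.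
have dv : is_derive t 1 (fun x : R => (Num.sqrt x)^-1) (- (Num.sqrt t) ^- 2 *: (2 * Num.sqrt t)^-1).
  by apply: is_deriveV.
rewrite (_ : (fun x : R => (Num.sqrt x) ^- n) = (fun x : R => (Num.sqrt x)^-1) ^+ n); last first.
  by apply/funext => x; rewrite fctE exprVn.
have := is_deriveX n dv; move/is_derive_eq; apply; rewrite /GRing.scale /=.
case: n => [|n]; first by rewrite !mul0r oppr0 mul0r.
rewrite -!exprVn invfM /= !exprS; move: ((Num.sqrt t)^-1) => w; by field.
Qed.

(** Differentiating in t = rho^2 costs a factor 1 / (2 rho): the exponential then contributes power
    n+1, and the derivative of rho^(-n) power n+2. *)
Lemma is_derive_wave a b n t : 0 < t ->
  is_derive t 1 (wave a b n)
    (wave ((- kap * a + sig * b) / 2) ((- sig * a - kap * b) / 2) n.+1 t +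
     wave (- (n%:R / 2) * a) (- (n%:R / 2) * b) n.+2 t).
Proof.
move=> t0.
have s0 : Num.sqrt t != 0 by rewrite gt_eqF// sqrtr_gt0.
have d1 : is_derive t 1 (fun x => a * wave1 x + b * wave2 x)
  (a *: ((- kap * wave1 t - sig * wave2 t) / (2 * Num.sqrt t)) + b *: ((- kap * wave2 t + sig * wave1 t) / (2 * Num.sqrt t))).
  apply: is_deriveD; apply: is_deriveZ; [exact: is_derive_wave1|exact: is_derive_wave2].
have := is_deriveM d1 (is_derive_sqrtVn n t0); move/is_derive_eq; apply.
rewrite /GRing.scale /= /wave -!exprVn !exprS !invfM; move: ((Num.sqrt t)^-1) => w; move: (w ^+ n) => W; by field.
Qed.

End Waves.

Section Smooth.
Context {R : realType}.
Implicit Types (f g : space3 R -> R) (y v : space3 R).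

(** Restriction to the line through y in direction v, where the one-variable chain rule applies. *)
Lemma is_derive_dirE f y v (df : R) :
  is_derive y v f df <-> is_derive (0 : R) 1 (fun t : R => f (t *: v + y)) df.
Proof.
have E : (fun h : R => h^-1 *: ((f \o shift y) (h *: v) - f y)) =
    (fun h : R => h^-1 *: (((fun t : R => f (t *: v + y)) \o shift 0) (h *: (1 : R)) - f (0 *: v + y))).
  by apply/funext => h /=; rewrite scale0r add0r addr0 [h%:A]mulr1.
split=> -[d1 d2].
  by apply: DeriveDef; [rewrite /derivable -E|rewrite /derive -E].
by apply: DeriveDef; [rewrite /derivable E|rewrite /derive E].
Qed.

Lemma is_derive_dir_comp (h : R -> R) f y v (dh df : R) :
  is_derive (f y) 1 h dh -> is_derive y v f df -> is_derive y v (h \o f) (dh * df).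
Proof.
move=> H /is_derive_dirE F; apply/is_derive_dirE.
apply: (@is_derive1_comp _ h (fun t : R => f (t *: v + y))) => //.
by rewrite scale0r add0r.
Qed.

Lemma is_derive_coord (c : space3 R -> R) y v :
  (forall t y v, c (t *: v + y) = t * c v + c y) -> is_derive y v c (c v).
Proof.
move=> cE; apply/is_derive_dirE.
rewrite (_ : (fun t => c (t *: v + y)) = (fun t : R => t * c v + c y)); last by apply/funext => t.
have h : is_derive (0 : R) 1 (fun t : R => t * c v + c y) ((0 *: 0 + c v *: 1) + 0).
  by apply: is_deriveD; apply: is_deriveM.
by apply: is_derive_eq; rewrite /GRing.scale /= mulr1 mul0r add0r addr0.
Qed.

Definition coord3 (i : 'I_3) y : R := match val i with 0%N => y.1.1 | 1%N => y.1.2 | _ => y.2 end.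

Lemma continuous_coord3 i : continuous (coord3 i).
Proof.
rewrite /coord3; case: i => -[|[|i]] _ y /=.
- by apply: (@continuous_comp _ _ _ fst fst); [exact: cvg_fst|exact: cvg_fst].
- by apply: (@continuous_comp _ _ _ fst snd); [exact: cvg_fst|exact: cvg_snd].
- exact: cvg_snd.
Qed.

Lemma coord3_linear i (t : R) y v : coord3 i (t *: v + y) = t * coord3 i v + coord3 i y.
Proof. by case: i => -[|[|[|//]]] ?. Qed.

Lemma coord3_basis (i j : 'I_3) : coord3 i (basis3 j) = (i == j)%:R :> R.
Proof.
by case: i j => -[|[|[|//]]] ? [[|[|[|//]]] ?]; rewrite /coord3 /basis3 /=.
Qed.

Lemma sqn3_coord y : sqn3 y = \sum_(i < 3) coord3 i y ^+ 2.
Proof. by rewrite !big_ord_recr big_ord0 /= add0r. Qed.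

Variables (x0 : space3 R) (N e kap sig : R).
Hypotheses (N0 : 0 < N) (e0 : 0 < e).

Definition sqdist y : R := sqn3 (x0 - y).
Definition sqrad y : R := sqdist y + e ^+ 2.

Lemma sqrad_gt0 y : 0 < sqrad y.
Proof. by rewrite ltr_wpDl ?sqn3_ge0// exprn_gt0. Qed.

(* Closed under partial derivatives, hence made of smooth functions; the cut-off
   kernels used as test functions belong to it. *)
Inductive elementary : (space3 R -> R) -> Prop :=
| elem_cst c : elementary (fun=> c)
| elem_coord i : elementary (coord3 i)
| elem_inv : elementary (fun y => (Num.sqrt (sqrad y)) ^-1)
| elem_wave1 : elementary (fun y => wave1 kap sig (sqrad y))
| elem_wave2 : elementary (fun y => wave2 kap sig (sqrad y))
| elem_bump n : elementary (fun y => bump n (1 - sqdist y / N))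
| elem_add f g : elementary f -> elementary g -> elementary (fun y => f y + g y)
| elem_mul f g : elementary f -> elementary g -> elementary (fun y => f y * g y).

Lemma is_derive_sqdist (i : 'I_3) y :
  is_derive y (basis3 i) sqdist (- 2 * coord3 i (x0 - y)).
Proof.
have dc (j : 'I_3) : is_derive y (basis3 i) (fun y => (coord3 j x0 - coord3 j y) ^+ 2)
    (2 * (coord3 j x0 - coord3 j y) * - (j == i)%:R).
  have h1 : is_derive y (basis3 i) (fun y => coord3 j x0 - coord3 j y) (0 - (j == i)%:R).
    apply: is_deriveB; rewrite -coord3_basis; apply: is_derive_coord => *; exact: coord3_linear.
  have := is_deriveX 2 h1; move/is_derive_eq; apply.
  by rewrite /GRing.scale /= expr1 sub0r.
have -> : sqdist = (fun y => (coord3 0 x0 - coord3 0 y) ^+ 2 + (coord3 1 x0 - coord3 1 y) ^+ 2 + (coord3 2%R x0 - coord3 2%R y) ^+ 2).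
  by apply/funext => z.
have := is_deriveD (is_deriveD (dc 0) (dc 1)) (dc 2%R); move/is_derive_eq; apply.
by case: i {dc} => -[|[|[|//]]] i; rewrite /coord3 /= ?mulr1n ?mulr0n; ring.
Qed.

Lemma continuous_sqdist : continuous sqdist.
Proof.
have cc (j : 'I_3) : continuous (fun y => (coord3 j x0 - coord3 j y) ^+ 2 : R).
  move=> y; apply: (@continuous_comp _ _ _ (fun y => coord3 j x0 - coord3 j y : R) (fun t : R => t ^+ 2)).
    by apply: cvgB; [exact: cvg_cst|exact: continuous_coord3].
  exact: exprn_continuous.
move=> y; rewrite /sqdist /sqn3.
by apply: cvgD; [apply: cvgD; [exact: (cc 0)|exact: (cc 1)]|exact: (cc 2%R)].
Qed.

Lemma elem_coordB i : elementary (fun y => coord3 i (x0 - y)).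
Proof.
have -> : (fun y => coord3 i (x0 - y)) = (fun y => coord3 i x0 + (- 1) * coord3 i y).
  by apply/funext => y; rewrite addrC -scaleN1r coord3_linear addrC.
by do !constructor.
Qed.

(** By induction on the generation. Every generator has its partial derivatives in the class, which
    is why powers of 1 / rho, both waves and all the [bump n] have to belong to it. *)
Lemma elementary_derive f : elementary f ->
  continuous f /\ forall i, exists2 g, elementary g & forall y, is_derive y (basis3 i) f (g y).
Proof.
have dr i y : is_derive y (basis3 i) sqrad (- 2 * coord3 i (x0 - y)).
  have := is_deriveD (is_derive_sqdist i y) (is_derive_cst (e ^+ 2) y (basis3 i)); move/is_derive_eq; apply.
  by rewrite addr0.
have cr : continuous sqrad.
  by move=> y; apply: cvgD; [exact: continuous_sqdist|exact: cvg_cst].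
(* The waves and powers of rho are differentiable at positive arguments only; [sqrad] is always at
   least e^2 > 0. *)
have comp (h dh : R -> R) : (forall t : R, 0 < t -> is_derive t 1 h (dh t)) ->
    elementary (fun y => dh (sqrad y)) ->
    continuous (fun y => h (sqrad y)) /\ forall i, exists2 g, elementary g & forall y, is_derive y (basis3 i) (fun y => h (sqrad y)) (g y).
  move=> dhE eh; split.
    move=> y; apply: (@continuous_comp _ _ _ sqrad h); first exact: cr.
    by apply/differentiable_continuous/derivable1_diffP; have [] := dhE _ (sqrad_gt0 y).
  move=> i; exists (fun y => dh (sqrad y) * (- 2 * coord3 i (x0 - y))).
    by apply: elem_mul => //; apply: elem_mul; [exact: elem_cst|exact: elem_coordB].
  by move=> y; exact: (is_derive_dir_comp (h := h) (dhE _ (sqrad_gt0 y)) (dr i y)).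
have einv n : elementary (fun y => (Num.sqrt (sqrad y)) ^- n).
  elim: n => [|n ih].
    rewrite (_ : (fun y => _) = fun=> 1); first exact: elem_cst.
    by apply/funext => y; rewrite expr0 invr1.
  rewrite (_ : (fun y => _) = (fun y => (Num.sqrt (sqrad y))^-1 * (Num.sqrt (sqrad y)) ^- n)); first by apply: elem_mul => //; exact: elem_inv.
  by apply/funext => y; rewrite -!exprVn exprS.
have half : elementary (fun y => 2^-1 * (Num.sqrt (sqrad y))^-1).
  by apply: elem_mul; [exact: elem_cst|exact: elem_inv].
elim.
- by move=> c; split=> [y|i]; [exact: cvg_cst|exists (fun=> 0); [exact: elem_cst|move=> y; exact: is_derive_cst]].
- move=> j; split; first exact: continuous_coord3.
  move=> i; exists (fun=> (j == i)%:R); first exact: elem_cst.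
  move=> y; rewrite -coord3_basis; apply: is_derive_coord => *; exact: coord3_linear.
- apply: (comp (fun t => (Num.sqrt t)^-1) (fun t => - (1%:R / 2) * (Num.sqrt t) ^- 3)).
    move=> t t0; have := is_derive_sqrtVn 1 t0.
    by rewrite (_ : (fun x => _) = (fun t => (Num.sqrt t)^-1)).
  by apply: elem_mul; [exact: elem_cst|exact: einv].
- apply: (comp _ _ (@is_derive_wave1 _ kap sig)).
  rewrite (_ : (fun y => _) = (fun y => (- kap * wave1 kap sig (sqrad y) + (- sig) * wave2 kap sig (sqrad y)) * (2^-1 * (Num.sqrt (sqrad y))^-1))).
    apply: elem_mul => //; apply: elem_add; apply: elem_mul; do ?exact: elem_cst; [exact: elem_wave1|exact: elem_wave2].
  by apply/funext => y; rewrite invfM mulNr (mulNr sig).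
- apply: (comp _ _ (@is_derive_wave2 _ kap sig)).
  rewrite (_ : (fun y => _) = (fun y => (- kap * wave2 kap sig (sqrad y) + sig * wave1 kap sig (sqrad y)) * (2^-1 * (Num.sqrt (sqrad y))^-1))).
    apply: elem_mul => //; apply: elem_add; apply: elem_mul; do ?exact: elem_cst; [exact: elem_wave2|exact: elem_wave1].
  by apply/funext => y; rewrite invfM.
- move=> n; have ds i y : is_derive y (basis3 i) (fun y => 1 - sqdist y / N) (N^-1 * (2 * coord3 i (x0 - y))).
    have h : is_derive y (basis3 i) (fun y => N^-1 * sqdist y) (N^-1 *: (- 2 * coord3 i (x0 - y))).
      by apply: is_deriveZ; exact: is_derive_sqdist.
    rewrite (_ : (fun y => _) = (fun y => 1 - N^-1 * sqdist y)); last by apply/funext => z; rewrite (mulrC _ N^-1).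
    have := is_deriveB (is_derive_cst (1 : R) y (basis3 i)) h; move/is_derive_eq; apply.
    by rewrite sub0r /GRing.scale /= mulNr mulrN opprK.
  split.
    move=> y; apply: (@continuous_comp _ _ _ (fun y => 1 - sqdist y / N : R) (bump n)); last exact: continuous_bump.
    apply: cvgB; first exact: cvg_cst.
    by apply: cvgM; [exact: continuous_sqdist|exact: cvg_cst].
  move=> i; exists (fun y => (bump n.+2 (1 - sqdist y / N) + - n%:R * bump n.+1 (1 - sqdist y / N)) * (N^-1 * (2 * coord3 i (x0 - y)))).
    apply: elem_mul; first by apply: elem_add; [exact: elem_bump|apply: elem_mul; [exact: elem_cst|exact: elem_bump]].
    apply: elem_mul; first exact: elem_cst.
    by apply: elem_mul; [exact: elem_cst|exact: elem_coordB].
  move=> y; rewrite mulNr.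
  exact: (is_derive_dir_comp (h := bump n) (is_derive_bump n _) (ds i y)).
- move=> f1 f2 _ [c1 d1] _ [c2 d2]; split; first by move=> y; apply: cvgD; [exact: c1|exact: c2].
  move=> i; have [g1 e1 h1] := d1 i; have [g2 e2 h2] := d2 i.
  exists (fun y => g1 y + g2 y); first exact: elem_add.
  by move=> y; apply: is_deriveD.
- move=> f1 f2 ef1 [c1 d1] ef2 [c2 d2]; split; first by move=> y; apply: cvgM; [exact: c1|exact: c2].
  move=> i; have [g1 e1 h1] := d1 i; have [g2 e2 h2] := d2 i.
  exists (fun y => f1 y * g2 y + f2 y * g1 y); first by apply: elem_add; exact: elem_mul.
  by move=> y; exact: is_deriveM (h1 y) (h2 y).
Qed.

Lemma elementary_smooth f : elementary f -> smooth f.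
Proof.
move=> ef.
have ep s : elementary (partial s f).
  elim: s => //= i s ih; have [_ /(_ i)[g eg dg]] := elementary_derive ih.
  by rewrite (_ : (fun x => _) = g)//; apply/funext => y; have [] := dg y.
move=> s; have [cs ds] := elementary_derive (ep s); split=> // i y.
by have [g _ /(_ y)[]] := ds i.
Qed.

End Smooth.

(** * Exponential weights against L_p functions *)

Section Weight.
Context {R : realType}.
Notation T3 := (measurableTypeR R * measurableTypeR R * measurableTypeR R)%type.

Lemma norm3N (x : space3 R) : norm3 (- x) = norm3 x.
Proof. by rewrite /norm3 /= !sqrrN. Qed.

Lemma norm3B (x y : space3 R) : norm3 (x - y) = norm3 (y - x).
Proof. by rewrite -norm3N opprB. Qed.

(** Lagrange's identity: the difference of the two sides is a sum of three squares. *)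
Lemma cauchy3 (a b c x y z : R) :
  (a * x + b * y + c * z) ^+ 2 <= (a ^+ 2 + b ^+ 2 + c ^+ 2) * (x ^+ 2 + y ^+ 2 + z ^+ 2).
Proof.
rewrite -subr_ge0 (_ : _ - _ = (a * y - b * x) ^+ 2 + (a * z - c * x) ^+ 2 + (b * z - c * y) ^+ 2).
  by rewrite !addr_ge0 ?sqr_ge0.
by ring.
Qed.

Lemma ler_norm3D (x y : space3 R) : norm3 (x + y) <= norm3 x + norm3 y.
Proof.
rewrite -(ler_pXn2r (n := 2))// ?nnegrE ?addr_ge0 ?norm3_ge0//.
rewrite sqrrD !sqr_norm3 /sqn3 /=.
have h : x.1.1 * y.1.1 + x.1.2 * y.1.2 + x.2 * y.2 <= norm3 x * norm3 y.
  apply: le_trans (ler_norm _) _.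
  rewrite -(ler_pXn2r (n := 2))// ?nnegrE ?mulr_ge0 ?norm3_ge0//.
  by rewrite real_normK ?num_real// exprMn !sqr_norm3; exact: cauchy3.
move: h; move: (norm3 x * norm3 y) => n; rewrite -subr_ge0 mulr2n => h.
case: x y h => -[a b] c [[a' b'] c'] /= h.
have -> : a ^+ 2 + b ^+ 2 + c ^+ 2 + (n + n) + (a' ^+ 2 + b' ^+ 2 + c' ^+ 2) =
  ((a + a') ^+ 2 + (b + b') ^+ 2 + (c + c') ^+ 2) + 2 * (n - (a * a' + b * b' + c * c')) by ring.
by rewrite addrAC subrr add0r mulr_ge0// subr_ge0.
Qed.

Lemma ler_norm3_dist (x y : space3 R) : norm3 y <= norm3 x + norm3 (x - y).
Proof.
have := ler_norm3D x (y - x); rewrite (norm3B y x).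
by rewrite addrC subrK.
Qed.

Lemma expw_integral (c : R) : 0 < c ->
  (\int[lebesgue3]_x (expR (- (c * norm3 x)))%:E < +oo)%E.
Proof.
move=> c0.
rewrite (@radial_integral_norm R c (fun s => expR (- s)))//.
- have -> : (\int[lebesgue_measure]_(s in `]0%R, +oo[) (expR (- s) * (4 * pi * s ^+ 2 / c ^+ 3))%:E =
      (4 * pi / c ^+ 3)%:E * \int[lebesgue_measure]_(s in `]0%R, +oo[) (s ^+ 2 * expR (- s))%:E)%E.
    rewrite -ge0_integralZl//.
    + by apply: eq_integral => s _; rewrite -EFinM; congr EFin; ring.
    + apply/measurable_EFinP/measurable_funTS; apply: measurable_funM; first exact: measurable_funX.
      by apply: measurableT_comp => //; exact: measurable_expR.
    + by move=> s _; rewrite lee_fin; nneg.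
    + by rewrite lee_fin; nneg.
  apply: lte_mul_pinfty => //; last exact: gamma_tail_lty.
  by rewrite lee_fin; nneg.
- by apply: measurableT_comp => //; exact: measurable_expR.
Qed.

Lemma measurable_norm3_sub (x0 : space3 R) : measurable_fun [set: T3] ((fun y : space3 R => norm3 (x0 - y)) : T3 -> R).
Proof. exact: (measurableT_comp measurable_norm3 (measurable_sub3 x0)). Qed.

Lemma measurable_expw (c : R) (x0 : space3 R) :
  measurable_fun [set: T3] ((fun y : space3 R => expR (- (c * norm3 (x0 - y)))) : T3 -> R).
Proof.
apply: (measurableT_comp (@measurable_expR R)); apply: measurableT_comp => //.
by apply: measurable_funM => //; exact: measurable_norm3_sub.
Qed.

Lemma cabsE (z : R[i]) : cabs z = Num.sqrt (complex.Re z ^+ 2 + complex.Im z ^+ 2).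
Proof. by case: z. Qed.

Lemma cabs_ge0 (z : R[i]) : 0 <= cabs z.
Proof. by rewrite cabsE sqrtr_ge0. Qed.

Lemma measurable_cabs (u : cfun3 R) : cmeasurable u -> measurable_fun [set: T3] ((cabs \o u) : T3 -> R).
Proof.
move=> [m1 m2].
rewrite (_ : cabs \o u = fun x => Num.sqrt (complex.Re (u x) ^+ 2 + complex.Im (u x) ^+ 2)); last first.
  by apply/funext => x; rewrite /= cabsE.
apply: (@measurableT_comp _ _ _ _ _ _ (@Num.sqrt R)).
  by apply: continuous_measurable_fun; exact: sqrt_continuous.
by apply: measurable_funD; apply: measurable_funX; [exact: m1|exact: m2].
Qed.

Lemma Lnorm_realE d (T : measurableType d) (m : {measure set T -> \bar R}) (p : R) (f : T -> R) :
  (Lnorm m p%:E (EFin \o f) = (\int[m]_x (`|f x| `^ p)%:E) `^ p^-1)%E.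
Proof. by rewrite unlock. Qed.

Lemma ge0_Lnorm_realE d (T : measurableType d) (m : {measure set T -> \bar R}) (p : R) (f : T -> R) :
  (forall x, 0 <= f x) -> (Lnorm m p%:E (EFin \o f) = (\int[m]_x (f x `^ p)%:E) `^ p^-1)%E.
Proof. by move=> f0; rewrite Lnorm_realE; under eq_integral do rewrite ger0_norm//. Qed.

Lemma Lp_normE (p : R) (u : cfun3 R) : 0 < p ->
  (Lp_norm p u = (\int[lebesgue3]_x (cabs (u x) `^ p)%:E) `^ (p^-1))%E.
Proof. by move=> p0; exact: (ge0_Lnorm_realE lebesgue3 p (fun x : T3 => cabs_ge0 (u x))). Qed.

Definition conj_exp (p : R) : R := p / (p - 1).

Lemma conj_expE (p : R) : 1 < p -> (conj_exp p)^-1 + p^-1 = 1.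
Proof. by move=> p1; rewrite /conj_exp; field; rewrite !gt_eqF//; lra. Qed.

Lemma conj_exp_gt0 (p : R) : 1 < p -> 0 < conj_exp p.
Proof. by move=> p1; rewrite divr_gt0; lra. Qed.

Definition weight_const (c p : R) : \bar R :=
  ((\int[lebesgue3]_x (expR (- (c * norm3 x)) `^ conj_exp p)%:E) `^ (conj_exp p)^-1)%E.

Lemma weight_const_lty (c p : R) : 0 < c -> 1 < p -> (weight_const c p < +oo)%E.
Proof.
move=> c0 p1; have q0 := conj_exp_gt0 p1.
apply: poweR_lty.
under eq_integral do rewrite -expRM mulNr -mulrA (mulrC (norm3 _)) mulrA.
exact: expw_integral (mulr_gt0 c0 q0).
Qed.

(** Hoelder's inequality; reflection and translation invariance make the constant independent of the
    centre x0. This is how an L_p function becomes integrable, whatever p > 1 is. *)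
Lemma Lp_weight (p c : R) (x0 : space3 R) (u : cfun3 R) : 1 < p -> 0 < c -> cmeasurable u ->
  (\int[lebesgue3]_y (expR (- (c * norm3 (x0 - y))) * cabs (u y))%:E <=
   weight_const c p * Lp_norm p u)%E.
Proof.
move=> p1 c0 mu.
have p0 : 0 < p by lra.
have q0 := conj_exp_gt0 p1.
have := @hoelder _ T3 R lebesgue3 _ _ (conj_exp p) p (measurable_expw c x0) (measurable_cabs mu) q0 p0 (conj_expE p1).
rewrite Lnorm1.
under eq_integral => y _ do rewrite /= ger0_norm ?mulr_ge0 ?expR_ge0 ?cabs_ge0//.
have m0 : measurable_fun [set: T3] ((fun x : space3 R => (expR (- (c * norm3 x)) `^ conj_exp p)%:E) : T3 -> \bar R).
  apply/measurable_EFinP; apply: (@measurableT_comp _ _ _ _ _ _ (fun y : R => y `^ _)) => //.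
  apply: (measurableT_comp (@measurable_expR R)); apply: measurableT_comp => //.
  by apply: measurable_funM => //; exact: measurable_norm3.
have i0 : (\int[lebesgue3]_x (`|expR (- (c * norm3 (x0 - x)))| `^ conj_exp p)%:E =
    \int[lebesgue3]_x (expR (- (c * norm3 x)) `^ conj_exp p)%:E)%E.
  rewrite -(ge0_integral_sub3 x0 m0); last by move=> x; rewrite lee_fin powR_ge0.
  by apply: eq_integral => x _; rewrite ger0_norm ?expR_ge0.
rewrite (Lnorm_realE lebesgue3 (conj_exp p) (fun y : T3 => expR (- (c * norm3 ((x0 : space3 R) - y))))).
rewrite /weight_const -i0; apply.
Qed.

Lemma Lp_weight_lty (p c : R) (x0 : space3 R) (u : cfun3 R) : 1 < p -> 0 < c -> in_Lp p u ->
  (\int[lebesgue3]_y (expR (- (c * norm3 (x0 - y))) * cabs (u y))%:E < +oo)%E.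
Proof.
move=> p1 c0 [mu fu]; apply: le_lt_trans (Lp_weight x0 p1 c0 mu) _.
have h := weight_const_lty c0 p1.
have h0 : (0 <= weight_const c p)%E by exact: poweR_ge0.
by apply: lte_mul_pinfty => //; rewrite ge0_fin_numE.
Qed.

Lemma abs_Re_le (z : R[i]) : `|complex.Re z| <= cabs z.
Proof. by rewrite cabsE -sqrtr_sqr ler_wsqrtr// lerDl sqr_ge0. Qed.

Lemma abs_Im_le (z : R[i]) : `|complex.Im z| <= cabs z.
Proof. by rewrite cabsE -sqrtr_sqr ler_wsqrtr// lerDr sqr_ge0. Qed.

Lemma Lp_dominated (p c K : R) (x0 : space3 R) (u : cfun3 R) (v h : space3 R -> R) :
  1 < p -> 0 < c -> in_Lp p u ->
  measurable_fun [set: T3] (v : T3 -> R) -> measurable_fun [set: T3] (h : T3 -> R) ->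
  (forall y, `|v y| <= cabs (u y)) ->
  (forall y, `|h y| <= K * expR (- (c * norm3 (x0 - y)))) ->
  lebesgue3.-integrable setT (EFin \o (fun y => v y * h y)).
Proof.
move=> p1 c0 uL mv mh vu hK.
have K0 : 0 <= K.
  have := le_trans (normr_ge0 _) (hK x0); rewrite pmulr_lge0// expR_gt0//.
apply/integrableP; split.
  by apply/measurable_EFinP; apply: measurable_funM.
apply: (@le_lt_trans _ _ (\int[lebesgue3]_y (K * (expR (- (c * norm3 (x0 - y))) * cabs (u y)))%:E)%E).
  apply: ge0_le_integral => //.
  - by apply/measurable_EFinP; apply: measurableT_comp => //; exact: measurable_funM.
  - apply/measurable_EFinP; apply: measurable_funM => //; apply: measurable_funM.
      exact: measurable_expw.
    exact: measurable_cabs uL.1.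
  - move=> y _; rewrite lee_fin normrM mulrC mulrA; apply: ler_pM => //.
rewrite ge0_integralRZl//.
- by apply: lte_mul_pinfty; [rewrite lee_fin|by []|exact: (Lp_weight_lty x0 p1 c0 uL)].
- apply: measurable_funM; [exact: measurable_expw|exact: measurable_cabs uL.1].
- by move=> y; rewrite mulr_ge0 ?expR_ge0 ?cabs_ge0.
Qed.

End Weight.

Section DominatedReal.
Context d (T : measurableType d) (R : realType) (m : {measure set T -> \bar R}).

Lemma Rintegral_dominated (f_ : nat -> T -> R) (f g : T -> R) :
  (forall n, measurable_fun setT (f_ n)) -> measurable_fun setT f ->
  m.-integrable setT (EFin \o g) ->
  (forall n x, `|f_ n x| <= g x) -> (forall x, f_ n x @[n --> \oo] --> f x) ->
  (\int[m]_x f_ n x) @[n --> \oo] --> \int[m]_x f x.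
Proof.
move=> mf_ mf ig fg cf.
have fle x : `|f x| <= g x.
  have cn : `|f_ n x| @[n --> \oo] --> `|f x| by apply: cvg_norm; exact: cf.
  rewrite -(cvg_lim (@Rhausdorff R) cn); apply: limr_le; first by apply/cvg_ex; exists `|f x|.
  by apply: nearW => n; exact: fg.
have iff : m.-integrable setT (EFin \o f).
  apply: (le_integrable measurableT _ _ ig); first exact/measurable_EFinP.
  by move=> x _ /=; rewrite lee_fin (le_trans (fle x))// ler_norm.
have [_ _ h] : [/\ m.-integrable setT (EFin \o f),
    (\int[m]_x `|(f_ n x)%:E - (f x)%:E|)%E @[n --> \oo] --> (0 : \bar R) &
    (\int[m]_x (f_ n x)%:E)%E @[n --> \oo] --> (\int[m]_x (f x)%:E)%E].
  apply: (dominated_convergence _ _ _ _ ig) => //.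
  - by move=> n; apply/measurable_EFinP.
  - exact/measurable_EFinP.
  - by apply: aeW => x _; apply: cvg_EFin; [exact: nearW|exact: cf].
  - by apply: aeW => x n _; rewrite lee_fin.
apply: fine_cvg.
by rewrite fineK//; exact: integral_fune_fin_num.
Qed.

Lemma Rintegral_sum n (F : 'I_n -> T -> R) : (forall i, m.-integrable setT (EFin \o F i)) ->
  \int[m]_x (\sum_(i < n) F i x) = \sum_(i < n) \int[m]_x F i x.
Proof.
move=> iF; suff [] : m.-integrable setT (EFin \o (fun x => \sum_(i < n) F i x)) /\
  \int[m]_x (\sum_(i < n) F i x) = \sum_(i < n) \int[m]_x F i x by [].
elim: n F iF => [|n ih] F iF.
  under eq_fun do rewrite big_ord0.
  by rewrite Rintegral_cst// mul0r big_ord0; split => //; exact: integrable0.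
have [i1 E1] := ih _ (fun i => iF (widen_ord (leqnSn n) i)).
under eq_fun do rewrite big_ord_recr.
rewrite big_ord_recr /= RintegralD//; split; last by rewrite E1.
have -> : EFin \o (fun x => \sum_(i < n) F (widen_ord (leqnSn n) i) x + F ord_max x) =
  (fun x => (\sum_(i < n) F (widen_ord (leqnSn n) i) x)%:E + (F ord_max x)%:E)%E by [].
exact: (integrableD measurableT i1 (iF ord_max)).
Qed.

End DominatedReal.

Section Cutoff.
Context {R : realType}.
Notation T3 := (measurableTypeR R * measurableTypeR R * measurableTypeR R)%type.
Variables (x0 : space3 R) (e kap sig a b : R).
Hypotheses (e0 : 0 < e) (kap0 : 0 < kap).
Implicit Types (N s : R) (y : space3 R).

Notation dist2 := (sqdist x0).
Notation rad2 := (sqrad x0 e).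

Lemma coord3B i x y : coord3 i (x - y) = coord3 i x - coord3 i y :> R.
Proof. by case: i => -[|[|[|//]]] ?. Qed.

(** The factor [expR 1] normalises the value at s = 0 to 1. The variable s is a squared distance, so
    the cut-off lives on a ball of radius sqrt N; [cut1] and [cut2] are its derivatives in s. *)
Definition cut0 N s : R := expR 1 * bump 0 (1 - s / N).
Definition cut1 N s : R := - (expR 1 / N * bump 2 (1 - s / N)).
Definition cut2 N s : R := expR 1 / N ^+ 2 * (bump 4 (1 - s / N) - 2 * bump 3 (1 - s / N)).

Lemma is_derive_cut_arg N s : is_derive s 1 (fun s => 1 - s / N) (- N^-1).
Proof.
have h : is_derive s 1 (fun s : R => s * N^-1) (N^-1 * 1).
  have := is_deriveM (is_derive_id s (1 : R)) (is_derive_cst (N^-1) s (1 : R)); move/is_derive_eq; apply.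
  by rewrite /GRing.scale /= mulr0 add0r.
have := is_deriveB (is_derive_cst (1 : R) s (1 : R)) h; move/is_derive_eq; apply.
by rewrite sub0r mulr1.
Qed.

Lemma is_derive_bump_arg N n s :
  is_derive s 1 (fun s => bump n (1 - s / N)) ((bump n.+2 (1 - s / N) - n%:R * bump n.+1 (1 - s / N)) * - N^-1).
Proof.
exact: (@is_derive1_comp _ (bump n) (fun s => 1 - s / N) s _ _ (is_derive_bump n _) (is_derive_cut_arg N s)).
Qed.

Lemma is_derive_cut0 N s : is_derive s 1 (cut0 N) (cut1 N s).
Proof.
have := is_deriveZ (expR 1) (is_derive_bump_arg N 0 s); move/is_derive_eq; apply.
by rewrite /GRing.scale /= /cut1; ring.
Qed.

Lemma is_derive_cut1 N s : is_derive s 1 (cut1 N) (cut2 N s).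
Proof.
have := is_deriveN (is_deriveZ (expR 1 / N) (is_derive_bump_arg N 2 s)); move/is_derive_eq; apply.
by rewrite /GRing.scale /= /cut2 -exprVn; ring.
Qed.

(* [radw1] and [radw2] are the first two derivatives of [radw0]; these constants
   are the coefficients that differentiation produces. *)
Let a1 := (- kap * a + sig * b) / 2.
Let b1 := (- sig * a - kap * b) / 2.
Definition radw0 s : R := wave kap sig a b 1 (s + e ^+ 2).
Definition radw1 s : R := wave kap sig a1 b1 2 (s + e ^+ 2) +
  wave kap sig (- (1%:R / 2) * a) (- (1%:R / 2) * b) 3 (s + e ^+ 2).
Definition radw2 s : R :=
  (wave kap sig ((- kap * a1 + sig * b1) / 2) ((- sig * a1 - kap * b1) / 2) 3 (s + e ^+ 2) +
   wave kap sig (- (2%:R / 2) * a1) (- (2%:R / 2) * b1) 4 (s + e ^+ 2)) +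
  (wave kap sig ((- kap * (- (1%:R / 2) * a) + sig * (- (1%:R / 2) * b)) / 2)
     ((- sig * (- (1%:R / 2) * a) - kap * (- (1%:R / 2) * b)) / 2) 4 (s + e ^+ 2) +
   wave kap sig (- (3%:R / 2) * (- (1%:R / 2) * a)) (- (3%:R / 2) * (- (1%:R / 2) * b)) 5 (s + e ^+ 2)).

Lemma is_derive_wave_shift (c d : R) n s : 0 <= s ->
  is_derive s 1 (fun s => wave kap sig c d n (s + e ^+ 2))
    (wave kap sig ((- kap * c + sig * d) / 2) ((- sig * c - kap * d) / 2) n.+1 (s + e ^+ 2) +
     wave kap sig (- (n%:R / 2) * c) (- (n%:R / 2) * d) n.+2 (s + e ^+ 2)).
Proof.
move=> s0; have t0 : 0 < s + e ^+ 2 by rewrite ltr_wpDl// exprn_gt0.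
have h : is_derive s 1 (fun s => s + e ^+ 2) (1 + 0).
  exact: is_deriveD.
have := @is_derive1_comp _ (wave kap sig c d n) (fun s => s + e ^+ 2) s _ _ (is_derive_wave kap sig c d n t0) h.
by rewrite addr0 mulr1.
Qed.

Lemma is_derive_radw0 s : 0 <= s -> is_derive s 1 radw0 (radw1 s).
Proof. exact: is_derive_wave_shift. Qed.

Lemma is_derive_radw1 s : 0 <= s -> is_derive s 1 radw1 (radw2 s).
Proof. by move=> s0; apply: is_deriveD; exact: is_derive_wave_shift. Qed.

Definition psi0 N s : R := cut0 N s * radw0 s.
Definition psi1 N s : R := cut1 N s * radw0 s + cut0 N s * radw1 s.
Definition psi2 N s : R := cut2 N s * radw0 s + 2 * (cut1 N s * radw1 s) + cut0 N s * radw2 s.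

Lemma is_derive_psi0 N s : 0 <= s -> is_derive s 1 (psi0 N) (psi1 N s).
Proof.
move=> s0; have := is_deriveM (is_derive_cut0 N s) (is_derive_radw0 s0); move/is_derive_eq; apply.
by rewrite /GRing.scale /= /psi1; ring.
Qed.

Lemma is_derive_psi1 N s : 0 <= s -> is_derive s 1 (psi1 N) (psi2 N s).
Proof.
move=> s0.
have h1 := is_deriveM (is_derive_cut1 N s) (is_derive_radw0 s0).
have h2 := is_deriveM (is_derive_cut0 N s) (is_derive_radw1 s0).
have := is_deriveD h1 h2; move/is_derive_eq; apply.
by rewrite /GRing.scale /= /psi2; ring.
Qed.

Lemma sqdist_ge0 y : 0 <= dist2 y.
Proof. exact: sqn3_ge0. Qed.

Definition test_fun N y : R := psi0 N (dist2 y).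

(** The chain rule for a function of |x0 - y|^2; the inner derivative is -2 (x0 - y)_i, and the term
    2 [psi1] comes from differentiating that factor once more. *)
Lemma partial_test_fun N i y : partial [:: i; i] (test_fun N) y =
  4 * (coord3 i (x0 - y) ^+ 2 * psi2 N (dist2 y)) + 2 * psi1 N (dist2 y).
Proof.
have d1 y' : is_derive y' (basis3 i) (test_fun N) (psi1 N (dist2 y') * (- 2 * coord3 i (x0 - y'))).
  exact: (is_derive_dir_comp (h := psi0 N) (is_derive_psi0 N (sqdist_ge0 y')) (is_derive_sqdist x0 i y')).
have -> : partial [:: i; i] (test_fun N) y = 'D_(basis3 i) (fun y' => psi1 N (dist2 y') * (- 2 * coord3 i (x0 - y'))) y.
  by rewrite /=; congr ('D_(basis3 i) _ y); apply/funext => y'; have [] := d1 y'.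
have d2 : is_derive y (basis3 i) (fun y' => psi1 N (dist2 y')) (psi2 N (dist2 y) * (- 2 * coord3 i (x0 - y))).
  exact: (is_derive_dir_comp (h := psi1 N) (is_derive_psi1 N (sqdist_ge0 y)) (is_derive_sqdist x0 i y)).
have d3 : is_derive y (basis3 i) (fun y' => - 2 * coord3 i (x0 - y')) 2.
  have h1 : is_derive y (basis3 i) (fun y => coord3 i x0 - coord3 i y) (0 - 1).
    apply: is_deriveB.
    have := is_derive_coord y (basis3 i) (@coord3_linear R i); by rewrite coord3_basis eqxx.
  have -> : (fun y' => - 2 * coord3 i (x0 - y')) = (fun y' => - 2 *: (coord3 i x0 - coord3 i y')).
    by apply/funext => y'; rewrite coord3B.
  have := is_deriveZ (- 2) h1; move/is_derive_eq; apply.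
  by rewrite /GRing.scale /=; ring.
have [_ ->] := is_deriveM d2 d3.
by rewrite /GRing.scale /=; ring.
Qed.

Lemma elementary_test_fun N : 0 < N -> elementary x0 N e kap sig (test_fun N).
Proof.
move=> N0; rewrite /test_fun /psi0 /cut0 /radw0 /wave.
apply: (elem_mul (f := fun y => expR 1 * bump 0 (1 - dist2 y / N))
  (g := fun y => (a * wave1 kap sig (rad2 y) + b * wave2 kap sig (rad2 y)) * (Num.sqrt (rad2 y))^-1)).
  by apply: elem_mul; [exact: elem_cst|exact: elem_bump].
apply: elem_mul; last exact: elem_inv.
by apply: elem_add; apply: elem_mul; do ?[exact: elem_cst|exact: elem_wave1|exact: elem_wave2].
Qed.

Lemma coord3_le_sqdist i y : coord3 i (x0 - y) ^+ 2 <= dist2 y.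
Proof.
rewrite /sqdist sqn3_coord (bigD1 i)//= lerDl sumr_ge0// => j _; exact: sqr_ge0.
Qed.

Lemma test_function_test_fun N : 0 < N -> test_function (test_fun N).
Proof.
move=> N0; split; first by apply: elementary_smooth; [exact: e0|exact: elementary_test_fun].
(* The cut-off is nonzero only where |x0 - y|^2 < N, which puts the support inside the compact cube
   K of half-side sqrt N. *)
pose r := Num.sqrt N.
pose K : set (space3 R) := (`[x0.1.1 - r, x0.1.1 + r] `*` `[x0.1.2 - r, x0.1.2 + r]) `*` `[x0.2 - r, x0.2 + r].
have cK : compact K by apply: compact_setX; [apply: compact_setX|]; exact: segment_compact.
have clK : closed K by apply: compact_closed => //; exact: norm_hausdorff.
apply: (subclosed_compact _ cK); first exact: closed_closure.
rewrite ((closure_id K).1 clK); apply: closure_subset => y /=.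
rewrite /test_fun /psi0 /cut0 /bump; case: ltP; last by rewrite mulr0 mul0r eqxx.
rewrite subr_gt0 ltr_pdivrMr// mul1r => yN _.
have h i : `|coord3 i (x0 - y)| <= r.
  rewrite -sqrtr_sqr ler_wsqrtr//; apply: le_trans (coord3_le_sqdist i y) (ltW yN).
have := h 0; have := h 1; have := h 2%R; rewrite /coord3 /= !ler_distlC.
by move=> h2 h1 h0; split=> /=; [split=> /=|]; rewrite in_itv.
Qed.

(** The constant is uniform in n, the index of the cut-off radius, so that one integrable majorant
    serves the limit in n. *)
Definition decays (h : nat -> space3 R -> R) : Prop :=
  exists K, forall n y, `|h n y| <= K * expR (- (kap * norm3 (x0 - y))).

Lemma decaysD h1 h2 : decays h1 -> decays h2 -> decays (fun n y => h1 n y + h2 n y).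
Proof.
move=> [K1 H1] [K2 H2]; exists (K1 + K2) => n y.
by rewrite (le_trans (ler_normD _ _))// mulrDl lerD.
Qed.

Definition bdd (k : nat -> space3 R -> R) : Prop := exists C, forall n y, `|k n y| <= C.

Lemma bddD k1 k2 : bdd k1 -> bdd k2 -> bdd (fun n y => k1 n y + k2 n y).
Proof.
move=> [K1 H1] [K2 H2]; exists (K1 + K2) => n y.
by rewrite (le_trans (ler_normD _ _))// lerD.
Qed.

Lemma bddZ (c : R) k : bdd k -> bdd (fun n y => c * k n y).
Proof. by move=> [K H]; exists (`|c| * K) => n y; rewrite normrM ler_wpM2l. Qed.

Lemma decaysM (k : nat -> space3 R -> R) h : bdd k ->
  decays h -> decays (fun n y => k n y * h n y).
Proof.
move=> [C kC] [K H]; exists (C * K) => n y.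
by rewrite normrM -mulrA; apply: ler_pM.
Qed.

Lemma decaysZ (c : R) h : decays h -> decays (fun n y => c * h n y).
Proof. by apply: decaysM; exists `|c|. Qed.

Lemma norm3_le_sqrad y : norm3 (x0 - y) <= Num.sqrt (rad2 y).
Proof. by rewrite norm3E ler_wsqrtr// lerDl sqr_ge0. Qed.

Lemma le_sqrt_sqrad y : e <= Num.sqrt (rad2 y).
Proof. by rewrite -{1}(ger0_norm (ltW e0)) -sqrtr_sqr ler_wsqrtr// lerDr sqdist_ge0. Qed.

Lemma wave_bound (c d : R) n t : `|wave kap sig c d n t| <=
  (`|c| + `|d|) * (Num.sqrt t) ^- n * expR (- (kap * Num.sqrt t)).
Proof.
rewrite /wave normrM [`|_ ^- n|]ger0_norm ?invr_ge0 ?exprn_ge0//.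
rewrite mulrAC ler_wpM2r ?invr_ge0 ?exprn_ge0//.
apply: (le_trans (ler_normD _ _)); rewrite mulrDl; apply: lerD; rewrite normrM; apply: ler_wpM2l => //.
  rewrite normrM ger0_norm ?expR_ge0// ler_piMr ?expR_ge0// ler_norml.
  by apply/andP; split; [exact: cos_geN1|exact: cos_le1].
rewrite normrM ger0_norm ?expR_ge0// ler_piMr ?expR_ge0// ler_norml.
by apply/andP; split; [exact: sin_geN1|exact: sin_le1].
Qed.

Lemma decays_wave (c d : R) n : decays (fun _ y => wave kap sig c d n (rad2 y)).
Proof.
exists ((`|c| + `|d|) * e ^- n) => _ y; rewrite (le_trans (wave_bound _ _ _ _))//.
have r0 : 0 < Num.sqrt (rad2 y) by rewrite sqrtr_gt0 sqrad_gt0.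
apply: ler_pM; rewrite ?expR_ge0//.
- rewrite ler_wpM2l ?addr_ge0// lef_pV2 ?posrE ?exprn_gt0//.
  by rewrite lerXn2r ?nnegrE ?(ltW e0) ?(ltW r0)// le_sqrt_sqrad.
- by rewrite ler_expR lerN2 ler_wpM2l ?(ltW kap0)// norm3_le_sqrad.
Qed.

(** A squared coordinate is at most rho^2, which is absorbed by two of the powers of 1 / rho. *)
Lemma decays_wave_sqr (c d : R) n i :
  decays (fun _ y => coord3 i (x0 - y) ^+ 2 * wave kap sig c d n.+2 (rad2 y)).
Proof.
have [K H] := decays_wave c d n; have [K' H'] := decays_wave c d n; exists K => n' y; rewrite (le_trans _ (H n' y))//.
have r0 : 0 < Num.sqrt (rad2 y) by rewrite sqrtr_gt0 sqrad_gt0.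
rewrite normrM ger0_norm ?sqr_ge0//.
have -> : wave kap sig c d n (rad2 y) = rad2 y * wave kap sig c d n.+2 (rad2 y).
  have E : rad2 y = Num.sqrt (rad2 y) ^+ 2 by rewrite sqr_sqrtr// ltW// sqrad_gt0.
  rewrite /wave [X in _ = X * _]E -!exprVn !exprS.
  move: (wave1 _ _ _) (wave2 _ _ _) => A B.
  move: (Num.sqrt (rad2 y)) r0 => w w0; move: (w^-1 ^+ n) => W.
  by field; rewrite gt_eqF.
rewrite [`|rad2 y * _|]normrM; apply: ler_wpM2r => //; apply: (le_trans (coord3_le_sqdist _ _)); apply: le_trans (ler_norm _).
by rewrite lerDl sqr_ge0.
Qed.

(** The bump vanishes once the squared distance exceeds n+1, so a bound on w is needed inside that
    ball only; there the argument of the bump is at most 1. *)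
Lemma cut_bounded (c : R) (k : nat) (w : nat -> space3 R -> R) :
  (forall n y, 0 <= w n y) ->
  (forall n y, dist2 y <= n.+1%:R -> w n y <= c) ->
  bdd (fun n y => w n y * bump k (1 - dist2 y / n.+1%:R)).
Proof.
move=> w0 wc; exists (`|c| * (k.+2)`!%:R) => n y.
have n0 : (0 : R) < n.+1%:R by [].
rewrite normrM (ger0_norm (w0 _ _)) (ger0_norm (bump_ge0 _ _)).
have [yn|yn] := leP (dist2 y) n.+1%:R.
  apply: ler_pM => //; first exact: bump_ge0.
    by rewrite (le_trans (wc _ _ yn)) ?ler_norm.
  by apply: bump_le; rewrite lerBlDr lerDl divr_ge0 ?sqdist_ge0.
rewrite /bump ltNge ifN ?mulr0 ?mulr_ge0//.
by rewrite negbK subr_le0 ler_pdivlMr// mul1r ltW.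
Qed.

Lemma bdd_cut0 : bdd (fun n y => cut0 n.+1%:R (dist2 y)).
Proof. by apply: (cut_bounded (c := expR 1)) => // n y; exact: expR_ge0. Qed.

Section Factor.
Variable k : space3 R -> R.
Hypotheses (k0 : forall y, 0 <= k y)
  (kN : forall n y, dist2 y <= n.+1%:R -> k y <= n.+1%:R).

(** Differentiating the cut-off in s brings a factor 1 / N. It compensates k, which will be 1 or a
    squared coordinate and is at most N on the support. *)
Lemma bdd_cut1 : bdd (fun n y => k y * cut1 n.+1%:R (dist2 y)).
Proof.
have : bdd (fun n y => - 1 * (k y * (expR 1 / n.+1%:R) * bump 2 (1 - dist2 y / n.+1%:R))).
  apply/bddZ/(cut_bounded (c := expR 1)) => n y; first by nneg.
  by move=> /kN h; rewrite mulrCA ler_piMr ?expR_ge0// ler_pdivrMr// mul1r.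
move=> [C H]; exists C => n y; rewrite (le_trans _ (H n y))//.
by rewrite le_eqVlt; apply/orP; left; apply/eqP; congr (`|_|); rewrite /cut1; ring.
Qed.

Lemma bdd_cut2 : bdd (fun n y => k y * cut2 n.+1%:R (dist2 y)).
Proof.
have h j : bdd (fun n y => k y * (expR 1 / n.+1%:R ^+ 2) * bump j (1 - dist2 y / n.+1%:R)).
  apply: (cut_bounded (c := expR 1)) => m y; first by nneg.
  move=> /kN h; rewrite mulrCA ler_piMr ?expR_ge0// ler_pdivrMr ?exprn_gt0// mul1r.
  by rewrite (le_trans h)// expr2 ler_peMl// ler1n.
have [C H] := bddD (h 4%N) (bddZ (- 2) (h 3%N)); exists C => n y; rewrite (le_trans _ (H n y))//.
by rewrite le_eqVlt; apply/orP; left; apply/eqP; congr (`|_|); rewrite /cut2; ring.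
Qed.

End Factor.

Lemma eq_decays h1 h2 : (forall n y, h1 n y = h2 n y) -> decays h1 -> decays h2.
Proof. by move=> E [K H]; exists K => n y; rewrite -E. Qed.

Lemma decays_radw0 : decays (fun _ y => radw0 (dist2 y)).
Proof. exact: decays_wave. Qed.

Lemma decays_radw1 : decays (fun _ y => radw1 (dist2 y)).
Proof. by apply: decaysD; exact: decays_wave. Qed.

Lemma decays_sqr_radw2 i : decays (fun _ y => coord3 i (x0 - y) ^+ 2 * radw2 (dist2 y)).
Proof.
apply: (eq_decays (fun n y => esym (mulrDr _ _ _))).
by apply: decaysD; apply: (eq_decays (fun n y => esym (mulrDr _ _ _))); apply: decaysD; exact: decays_wave_sqr.
Qed.

Lemma decays_test_fun : decays (fun n => test_fun n.+1%:R).
Proof. exact: decaysM bdd_cut0 decays_radw0. Qed.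

Lemma decays_partial_test_fun i : decays (fun n => partial [:: i; i] (test_fun n.+1%:R)).
Proof.
pose c y := coord3 i (x0 - y) ^+ 2.
have c0 y : 0 <= c y by exact: sqr_ge0.
have cN n y : dist2 y <= n.+1%:R -> c y <= n.+1%:R by apply: le_trans; exact: coord3_le_sqdist.
have o0 (y : space3 R) : 0 <= (1 : R) by [].
have oN n (y : space3 R) : dist2 y <= n.+1%:R -> (1 : R) <= n.+1%:R by rewrite ler1n.
have d2 := decaysM (bdd_cut2 c0 cN) decays_radw0.
have d1 := decaysZ 2 (decaysM (bdd_cut1 c0 cN) decays_radw1).
have d0 := decaysM bdd_cut0 (decays_sqr_radw2 i).
have e1 := decaysM (bdd_cut1 o0 oN) decays_radw0.
have e2 := decaysM bdd_cut0 decays_radw1.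
apply: eq_decays (decaysD (decaysZ 4 (decaysD (decaysD d2 d1) d0)) (decaysZ 2 (decaysD e1 e2))) => n y.
by rewrite partial_test_fun /psi2 /psi1 /c; ring.
Qed.

Lemma cvg_bump_arg k s : bump k (1 - s / n.+1%:R) @[n --> \oo] --> bump k (1 : R).
Proof.
apply: continuous_cvg; first exact: continuous_bump.
rewrite -[X in _ --> X](subr0 (1 : R)) -(mulr0 s); apply: cvgB; first exact: cvg_cst.
by apply: cvgM; [exact: cvg_cst|exact: cvg_harmonic].
Qed.

Lemma bump1 k : bump k 1 = expR (- 1) :> R.
Proof. by rewrite /bump ltr01 expr1n invr1 mul1r. Qed.

Lemma cvg_cut0 s : cut0 n.+1%:R s @[n --> \oo] --> (1 : R).
Proof.
rewrite -[X in _ --> X](expRxMexpNx_1 1) -(bump1 0).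
by apply: cvgM; [exact: cvg_cst|exact: cvg_bump_arg].
Qed.

Lemma cvg_cut1 s : cut1 n.+1%:R s @[n --> \oo] --> (0 : R).
Proof.
rewrite -oppr0 -(mul0r (bump 2 1)); apply: cvgN; apply: cvgM; last exact: cvg_bump_arg.
by rewrite -(mulr0 (expR 1)); apply: cvgM; [exact: cvg_cst|exact: cvg_harmonic].
Qed.

Lemma cvg_cut2 s : cut2 n.+1%:R s @[n --> \oo] --> (0 : R).
Proof.
rewrite -(mul0r (bump 4 1 - 2 * bump 3 1)); apply: cvgM; last first.
  by apply: cvgB; [|apply: cvgM; first exact: cvg_cst]; exact: cvg_bump_arg.
rewrite -(mulr0 (expR 1)); apply: cvgM; first exact: cvg_cst.
rewrite -(mulr0 0).
have -> : (fun n : nat => (n.+1%:R : R) ^- 2) = (fun n => harmonic n * harmonic n).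
  by apply/funext => n; rewrite /harmonic -exprVn expr2.
by apply: cvgM; exact: cvg_harmonic.
Qed.

Lemma cvg_psi0 s : psi0 n.+1%:R s @[n --> \oo] --> radw0 s.
Proof. by rewrite -[radw0 s]mul1r; apply: cvgM; [exact: cvg_cut0|exact: cvg_cst]. Qed.

Lemma cvg_psi1 s : psi1 n.+1%:R s @[n --> \oo] --> radw1 s.
Proof.
have -> : radw1 s = 0 * radw0 s + 1 * radw1 s by ring.
apply: cvgD; apply: cvgM; [exact: cvg_cut1|exact: cvg_cst|exact: cvg_cut0|exact: cvg_cst].
Qed.

Lemma cvg_psi2 s : psi2 n.+1%:R s @[n --> \oo] --> radw2 s.
Proof.
have -> : radw2 s = 0 * radw0 s + 2 * (0 * radw1 s) + 1 * radw2 s by ring.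
apply: cvgD; first apply: cvgD; [|apply: cvgM; first exact: cvg_cst|]; apply: cvgM;
  [exact: cvg_cut2|exact: cvg_cst|exact: cvg_cut1|exact: cvg_cst|exact: cvg_cut0|exact: cvg_cst].
Qed.

Lemma measurable_sqdist : measurable_fun [set: T3] (dist2 : T3 -> R).
Proof. exact: (measurableT_comp measurable_sqn3 (measurable_sub3 x0)). Qed.

Lemma measurable_cut_arg k N : measurable_fun [set: R] (fun s : R => bump k (1 - s / N)).
Proof.
apply: (measurableT_comp (f := bump k)); first by apply: continuous_measurable_fun; exact: continuous_bump.
by apply: measurable_funB => //; apply: measurable_funM.
Qed.

Lemma measurable_sqrt : measurable_fun [set: R] (@Num.sqrt R).
Proof. by apply: continuous_measurable_fun; exact: sqrt_continuous. Qed.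

Lemma measurable_wave (c d : R) n : measurable_fun [set: R] (wave kap sig c d n).
Proof.
have ms := measurable_sqrt.
have me : measurable_fun [set: R] (fun t => expR (- (kap * Num.sqrt t))).
  by apply: measurableT_comp => //; apply: measurableT_comp => //; apply: measurable_funM.
apply: measurable_funM.
  apply: measurable_funD; apply: measurable_funM => //; apply: measurable_funM => //.
    by apply: measurableT_comp; [apply: continuous_measurable_fun; exact: continuous_cos|apply: measurable_funM].
  by apply: measurableT_comp; [apply: continuous_measurable_fun; exact: continuous_sin|apply: measurable_funM].
by apply: (measurableT_comp measurable_invr); exact: measurable_funX.
Qed.

Lemma measurable_wave_shift (c d : R) n : measurable_fun [set: R] (fun s => wave kap sig c d n (s + e ^+ 2)).
Proof. by apply: (measurableT_comp (measurable_wave c d n)); apply: measurable_funD. Qed.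

Lemma measurable_radw0 : measurable_fun [set: R] radw0.
Proof. exact: measurable_wave_shift. Qed.

Lemma measurable_radw1 : measurable_fun [set: R] radw1.
Proof. by apply: measurable_funD; exact: measurable_wave_shift. Qed.

Lemma measurable_radw2 : measurable_fun [set: R] radw2.
Proof. by do !apply: measurable_funD; exact: measurable_wave_shift. Qed.

Lemma measurable_psi0 N : measurable_fun [set: R] (psi0 N).
Proof.
apply: measurable_funM; last exact: measurable_radw0.
by apply: measurable_funM => //; exact: measurable_cut_arg.
Qed.

Lemma measurable_cut1 N : measurable_fun [set: R] (cut1 N).
Proof. by apply: measurableT_comp => //; apply: measurable_funM => //; exact: measurable_cut_arg. Qed.

Lemma measurable_psi1 N : measurable_fun [set: R] (psi1 N).
Proof.
apply: measurable_funD; apply: measurable_funM; [exact: measurable_cut1|exact: measurable_radw0| |exact: measurable_radw1].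
by apply: measurable_funM => //; exact: measurable_cut_arg.
Qed.

Lemma measurable_psi2 N : measurable_fun [set: R] (psi2 N).
Proof.
apply: measurable_funD; first apply: measurable_funD.
- apply: measurable_funM; last exact: measurable_radw0.
  apply: measurable_funM => //; apply: measurable_funB; first exact: measurable_cut_arg.
  by apply: measurable_funM => //; exact: measurable_cut_arg.
- by apply: measurable_funM => //; apply: measurable_funM; [exact: measurable_cut1|exact: measurable_radw1].
- apply: measurable_funM; last exact: measurable_radw2.
  by apply: measurable_funM => //; exact: measurable_cut_arg.
Qed.

(** The Laplacian of psi(|x|^2) is 4 s psi'' + 2 n psi' in dimension n, here with n = 3 and s =
    |x|^2. *)
Lemma laplacian_test_fun N y : \sum_(i < 3) partial [:: i; i] (test_fun N) y =
  4 * (dist2 y * psi2 N (dist2 y)) + 6 * psi1 N (dist2 y).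
Proof.
rewrite (eq_bigr _ (fun i _ => partial_test_fun N i y)) big_split /= sumr_const card_ord.
rewrite -mulr_sumr -mulr_suml -sqn3_coord -/(dist2 y); congr (_ + _).
by rewrite -mulr_natr; ring.
Qed.

Lemma measurable_partial_test_fun N i : measurable_fun [set: T3] (partial [:: i; i] (test_fun N) : T3 -> R).
Proof.
rewrite (funext (partial_test_fun N i)).
have md := measurable_sqdist.
have mc : measurable_fun [set: T3] ((fun y : space3 R => coord3 i (x0 - y)) : T3 -> R).
  rewrite /coord3; case: i => -[|[|[|//]]] ? /=; apply: measurable_funB => //; apply: measurableT_comp => //.
apply: measurable_funD; apply: measurable_funM => //; last exact: (measurableT_comp (measurable_psi1 N) md).
apply: measurable_funM; first exact: measurable_funX.
exact: (measurableT_comp (measurable_psi2 N) md).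
Qed.

Section Limit.
Variables (p : R) (u : cfun3 R) (d : 'I_3 -> cfun3 R) (v : space3 R -> R) (h : 'I_3 -> space3 R -> R).
Hypotheses (p1 : 1 < p) (uL : in_Lp p u) (dL : forall i, in_Lp p (d i)).
Hypotheses (mv : measurable_fun [set: T3] (v : T3 -> R)) (mh : forall i, measurable_fun [set: T3] (h i : T3 -> R)).
Hypotheses (vu : forall y, `|v y| <= cabs (u y)) (hd : forall i y, `|h i y| <= cabs (d i y)).
Hypothesis weak : forall i phi, test_function phi ->
  \int[lebesgue3]_y (v y * partial [:: i; i] phi y) = \int[lebesgue3]_y (h i y * phi y).

Lemma decays_integrable (w : cfun3 R) (f : space3 R -> R) (k : nat -> space3 R -> R) n :
  in_Lp p w -> measurable_fun [set: T3] (f : T3 -> R) -> measurable_fun [set: T3] (k n : T3 -> R) ->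
  (forall y, `|f y| <= cabs (w y)) -> decays k ->
  lebesgue3.-integrable setT (EFin \o (fun y => f y * k n y)).
Proof.
move=> wL mf mk fw [K H].
exact: (Lp_dominated p1 kap0 wL mf mk fw (H n)).
Qed.

Lemma decays_cvg (w : cfun3 R) (f : space3 R -> R) (k : nat -> space3 R -> R) (l : space3 R -> R) :
  in_Lp p w -> measurable_fun [set: T3] (f : T3 -> R) -> (forall n, measurable_fun [set: T3] (k n : T3 -> R)) ->
  measurable_fun [set: T3] (l : T3 -> R) ->
  (forall y, `|f y| <= cabs (w y)) -> decays k -> (forall y, k n y @[n --> \oo] --> l y) ->
  (\int[lebesgue3]_y (f y * k n y)) @[n --> \oo] --> \int[lebesgue3]_y (f y * l y).
Proof.
move=> wL mf mk ml fw [K H] kl.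
have fw' y : `|cabs (w y)| <= cabs (w y) by rewrite ger0_norm ?cabs_ge0.
have me := measurable_expw kap x0.
have mE : measurable_fun [set: T3] ((fun y : space3 R => K * expR (- (kap * norm3 (x0 - y)))) : T3 -> R).
  exact: measurable_funM.
have bE y : `|K * expR (- (kap * norm3 (x0 - y)))| <= `|K| * expR (- (kap * norm3 (x0 - y))).
  by rewrite normrM (ger0_norm (expR_ge0 _)).
have ig := Lp_dominated p1 kap0 wL (measurable_cabs wL.1) mE fw' bE.
apply: (Rintegral_dominated _ _ ig).
- by move=> n; exact: measurable_funM.
- exact: measurable_funM.
- by move=> n y; rewrite normrM; apply: ler_pM.
- by move=> y; apply: cvgM; [exact: cvg_cst|exact: kl].
Qed.

Lemma decaysS n (k : 'I_n -> nat -> space3 R -> R) :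
  (forall i, decays (k i)) -> decays (fun m y => \sum_(i < n) k i m y).
Proof.
move=> dk; elim: n k dk => [|n ih] k dk.
  by exists 0 => m y; rewrite big_ord0 normr0 mul0r.
apply: (eq_decays (fun m y => esym (big_ord_recr _ _))).
by apply: decaysD => //; exact: ih.
Qed.

(** Removal of the cut-off: the regularised kernel decays exponentially together with the
    derivatives involved, so both sides of the weak equation pass to the limit by dominated
    convergence. The real functions v and h are meant to be components of the complex functions that
    dominate them. *)
Lemma weak_laplacian_wave :
  \int[lebesgue3]_y (v y * (4 * (dist2 y * radw2 (dist2 y)) + 6 * radw1 (dist2 y))) =
  \int[lebesgue3]_y ((\sum_(i < 3) h i y) * radw0 (dist2 y)).
Proof.
have md := measurable_sqdist.
have h1 : (\sum_(i < 3) \int[lebesgue3]_y (v y * partial [:: i; i] (test_fun n.+1%:R) y)) @[n --> \oo] -->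
    \int[lebesgue3]_y (v y * (4 * (dist2 y * radw2 (dist2 y)) + 6 * radw1 (dist2 y))).
  have -> : (fun n : nat => \sum_(i < 3) \int[lebesgue3]_y (v y * partial [:: i; i] (test_fun n.+1%:R) y)) =
     (fun n : nat => \int[lebesgue3]_y (v y * \sum_(i < 3) partial [:: i; i] (test_fun n.+1%:R) y)).
    apply/funext => n; rewrite -Rintegral_sum//.
      by apply: eq_Rintegral => y _; rewrite mulr_sumr.
    move=> i; apply: (@decays_integrable u v (fun n => partial [:: i; i] (test_fun n.+1%:R)) n) => //.
      exact: measurable_partial_test_fun.
    exact: decays_partial_test_fun.
  apply: (@decays_cvg u) => //.
  - move=> n; rewrite (funext (laplacian_test_fun _)).
    apply: measurable_funD; apply: measurable_funM => //; last exact: (measurableT_comp (measurable_psi1 _) md).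
    by apply: measurable_funM => //; exact: (measurableT_comp (measurable_psi2 _) md).
  - apply: measurable_funD; apply: measurable_funM => //; last exact: (measurableT_comp measurable_radw1 md).
    by apply: measurable_funM => //; exact: (measurableT_comp measurable_radw2 md).
  - by apply: decaysS => i; exact: decays_partial_test_fun.
  - move=> y; rewrite (funext (fun n => laplacian_test_fun n.+1%:R y)).
    apply: cvgD; apply: cvgM; [exact: cvg_cst| |exact: cvg_cst|exact: cvg_psi1].
    by apply: cvgM; [exact: cvg_cst|exact: cvg_psi2].
have h2 : (\sum_(i < 3) \int[lebesgue3]_y (h i y * test_fun n.+1%:R y)) @[n --> \oo] -->
    \sum_(i < 3) \int[lebesgue3]_y (h i y * radw0 (dist2 y)).
  have ci i : \int[lebesgue3]_y (h i y * test_fun n.+1%:R y) @[n --> \oo] --> \int[lebesgue3]_y (h i y * radw0 (dist2 y)).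
    apply: (@decays_cvg (d i)) => //.
    - by move=> n; exact: (measurableT_comp (measurable_psi0 _) md).
    - exact: (measurableT_comp measurable_radw0 md).
    - exact: decays_test_fun.
    - by move=> y; exact: cvg_psi0.
  rewrite !big_ord_recr big_ord0 /=.
  rewrite (funext (fun n : nat => @big_ord_recr _ _ _ _ _)).
  by under eq_fun do rewrite !big_ord_recr big_ord0 /=; do !apply: cvgD => //; exact: cvg_cst.
have E n : \sum_(i < 3) \int[lebesgue3]_y (v y * partial [:: i; i] (test_fun n.+1%:R) y) =
    \sum_(i < 3) \int[lebesgue3]_y (h i y * test_fun n.+1%:R y).
  by apply: eq_bigr => i _; apply: weak; exact: test_function_test_fun.
rewrite (funext E) in h1.
rewrite (cvg_unique (@Rhausdorff R) h1 h2) -Rintegral_sum//.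
  by apply: eq_Rintegral => y _; rewrite mulr_suml.
move=> i; apply: (@decays_integrable (d i) (h i) (fun _ y => radw0 (dist2 y)) 0) => //.
  exact: (measurableT_comp measurable_radw0 md).
exact: decays_radw0.
Qed.

End Limit.

End Cutoff.

Section Generic.
Context d (T : measurableType d) (R : realType) (m : {measure set T -> \bar R}).

Lemma aeS (P Q : T -> Prop) : (forall x, P x -> Q x) ->
  {ae m, forall x, P x} -> {ae m, forall x, Q x}.
Proof. by move=> PQ; apply: filterS. Qed.

Lemma aeS2 (P Q S : T -> Prop) : (forall x, P x -> Q x -> S x) ->
  {ae m, forall x, P x} -> {ae m, forall x, Q x} -> {ae m, forall x, S x}.
Proof. by move=> PQ; apply: filterS2. Qed.

Lemma RintegralN (f : T -> R) : \int[m]_x (- f x) = - \int[m]_x f x.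
Proof.
rewrite /Rintegral integralE [in RHS]integralE.
have -> : (fun x => (- f x)%:E) = (\- (EFin \o f))%E by [].
rewrite funeposN funenegN.
by case: (integral _ _ _) => [a||]; case: (integral _ _ _) => [b||] //=; rewrite ?oppr0// opprB.
Qed.

Lemma integrableZl_real (c : R) (g : T -> R) : m.-integrable setT (EFin \o g) ->
  m.-integrable setT (EFin \o (fun y => c * g y)).
Proof. by move=> ig; have := integrableZl measurableT c ig; apply: eq_integrable. Qed.

Lemma integrableD_real (g h : T -> R) : m.-integrable setT (EFin \o g) -> m.-integrable setT (EFin \o h) ->
  m.-integrable setT (EFin \o (fun y => g y + h y)).
Proof. by move=> ig ih; have := integrableD measurableT ig ih; apply: eq_integrable. Qed.

End Generic.

Section RealLp.
Context {R : realType}.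
Notation T3 := (measurableTypeR R * measurableTypeR R * measurableTypeR R)%type.

Definition Lp_real (p : R) (v : space3 R -> R) : Prop := in_Lp p (fun y => (v y)%:C).

Lemma Lp_real_measurable p v : Lp_real p v -> measurable_fun [set: T3] (v : T3 -> R).
Proof. by move=> [[]]. Qed.

Lemma cabs_real (x : R) : cabs x%:C = `|x|.
Proof. by rewrite cabsE /= expr0n /= addr0 sqrtr_sqr. Qed.

Lemma Lp_real_le p (w : cfun3 R) v : 1 < p -> in_Lp p w -> measurable_fun [set: T3] (v : T3 -> R) ->
  (forall y, `|v y| <= cabs (w y)) -> Lp_real p v.
Proof.
move=> p1 [mw fw] mv vw; have p0 : 0 < p by lra.
split; first by split => //=; exact: measurable_cst.
apply: le_lt_trans fw; rewrite !Lp_normE//; apply: gt0_ler_poweR.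
- by rewrite invr_ge0 ltW.
- by rewrite in_itv /= leey andbT; apply: integral_ge0 => y _; rewrite lee_fin powR_ge0.
- by rewrite in_itv /= leey andbT; apply: integral_ge0 => y _; rewrite lee_fin powR_ge0.
apply: ge0_le_integral => //.
- by move=> y _; rewrite lee_fin powR_ge0.
- apply/measurable_EFinP; apply: (@measurableT_comp _ _ _ _ _ _ (fun y : R => y `^ _)) => //.
  by rewrite (funext (fun y => cabs_real (v y))); exact: measurableT_comp.
- apply/measurable_EFinP; apply: (@measurableT_comp _ _ _ _ _ _ (fun y : R => y `^ _)) => //.
  exact: measurable_cabs.
- move=> y _; rewrite lee_fin ge0_ler_powR ?nnegrE ?cabs_ge0 ?(ltW p0)//.
  by rewrite cabs_real.
Qed.

Lemma Lp_real_Re p (w : cfun3 R) : 1 < p -> in_Lp p w -> Lp_real p (fun y => complex.Re (w y)).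
Proof. by move=> p1 wL; apply: (Lp_real_le p1 wL) => //; [exact: wL.1.1|move=> y; exact: abs_Re_le]. Qed.

Lemma Lp_real_Im p (w : cfun3 R) : 1 < p -> in_Lp p w -> Lp_real p (fun y => complex.Im (w y)).
Proof. by move=> p1 wL; apply: (Lp_real_le p1 wL) => //; [exact: wL.1.2|move=> y; exact: abs_Im_le]. Qed.

Lemma Lp_realN p v : 1 < p -> Lp_real p v -> Lp_real p (fun y => - v y).
Proof.
move=> p1 vL; apply: (Lp_real_le p1 vL) => //.
  by apply: measurableT_comp => //; exact: Lp_real_measurable vL.
by move=> y; rewrite cabs_real normrN.
Qed.

Lemma Lp_real_integrable p c K (x0 : space3 R) v k : 1 < p -> 0 < c -> Lp_real p v ->
  measurable_fun [set: T3] (k : T3 -> R) ->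
  (forall y, `|k y| <= K * expR (- (c * norm3 (x0 - y)))) ->
  lebesgue3.-integrable setT (EFin \o (fun y => v y * k y)).
Proof.
move=> p1 c0 vL mk kK; apply: (Lp_dominated p1 c0 vL (Lp_real_measurable vL) mk _ kK) => y.
by rewrite cabs_real.
Qed.

End RealLp.

(** * The Helmholtz equation tested with the regularised kernel *)

Section Helmholtz.
Context {R : realType}.
Notation T3 := (measurableTypeR R * measurableTypeR R * measurableTypeR R)%type.
Variables (kap sig : R).
Hypothesis kap0 : 0 < kap.
Let z1 := sig ^+ 2 - kap ^+ 2.
Let z2 := 2 * sig * kap.

(* [kerC + i kerS] is the kernel e^(i (sig + i kap) rho) / rho, [rho^2 = s + e^2], and
   [defect1 + i defect2] is (- Delta - (z1 + i z2)) applied to it. *)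
Definition kerC (e s : R) : R := radw0 e kap sig 1 0 s.
Definition kerS (e s : R) : R := radw0 e kap sig 0 1 s.
Definition defect1 (e s : R) : R := e ^+ 2 * (wave kap sig 3 0 5 (s + e ^+ 2) +
  wave kap sig (3 * kap) (3 * sig) 4 (s + e ^+ 2) - wave kap sig z1 (- z2) 3 (s + e ^+ 2)).
Definition defect2 (e s : R) : R := e ^+ 2 * (wave kap sig 0 3 5 (s + e ^+ 2) +
  wave kap sig (- (3 * sig)) (3 * kap) 4 (s + e ^+ 2) - wave kap sig z2 z1 3 (s + e ^+ 2)).

(** For a function g of s, 4 s g'' + 6 g' is the Laplacian of g(|x|^2). With s = rho^2 - e^2, the
    part in rho^2 is the exact radial Helmholtz equation for e^(i (sig + i kap) rho) / rho and
    cancels; what is left is 4 e^2 g''. *)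
Lemma kerC_ode e s : 0 < e -> 0 <= s ->
  - (4 * (s * radw2 e kap sig 1 0 s) + 6 * radw1 e kap sig 1 0 s) - z1 * kerC e s + z2 * kerS e s = defect1 e s.
Proof.
move=> e0 s0; have t0 : 0 < s + e ^+ 2 by rewrite ltr_wpDl// exprn_gt0.
rewrite /kerC /kerS /defect1 /radw2 /radw1 /radw0 /wave -/z1 -/z2.
have E : s = Num.sqrt (s + e ^+ 2) ^+ 2 - e ^+ 2 by rewrite sqr_sqrtr ?ltW// addrK.
rewrite [X in X * (_ + _)]E /z1 /z2.
have := t0; rewrite -sqrtr_gt0; move: (wave1 _ _ _) (wave2 _ _ _) (Num.sqrt (s + e ^+ 2)) => A B w w0.
by field; rewrite gt_eqF.
Qed.

Lemma kerS_ode e s : 0 < e -> 0 <= s ->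
  - (4 * (s * radw2 e kap sig 0 1 s) + 6 * radw1 e kap sig 0 1 s) - z1 * kerS e s - z2 * kerC e s = defect2 e s.
Proof.
move=> e0 s0; have t0 : 0 < s + e ^+ 2 by rewrite ltr_wpDl// exprn_gt0.
rewrite /kerC /kerS /defect2 /radw2 /radw1 /radw0 /wave -/z1 -/z2.
have E : s = Num.sqrt (s + e ^+ 2) ^+ 2 - e ^+ 2 by rewrite sqr_sqrtr ?ltW// addrK.
rewrite [X in X * (_ + _)]E /z1 /z2.
have := t0; rewrite -sqrtr_gt0; move: (wave1 _ _ _) (wave2 _ _ _) (Num.sqrt (s + e ^+ 2)) => A B w w0.
by field; rewrite gt_eqF.
Qed.

Variable p : R.
Hypothesis p1 : 1 < p.

Definition weak_laplacian (v : space3 R -> R) (h : 'I_3 -> space3 R -> R) : Prop :=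
  forall i phi, test_function phi ->
  \int[lebesgue3]_y (v y * partial [:: i; i] phi y) = \int[lebesgue3]_y (h i y * phi y).

(* The weak equation (- Delta - (z1 + i z2)) (u1 + i u2) = f1 + i f2. *)
Definition helmholtz_pair (u1 u2 f1 f2 : space3 R -> R) : Prop :=
  [/\ Lp_real p u1, Lp_real p u2, Lp_real p f1, Lp_real p f2 &
  exists h1 h2 : 'I_3 -> space3 R -> R,
  [/\ forall i, Lp_real p (h1 i) /\ Lp_real p (h2 i), weak_laplacian u1 h1, weak_laplacian u2 h2,
   {ae lebesgue3, forall y, - (\sum_(i < 3) h1 i y) = f1 y + z1 * u1 y - z2 * u2 y} &
   {ae lebesgue3, forall y, - (\sum_(i < 3) h2 i y) = f2 y + z1 * u2 y + z2 * u1 y}]].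

(* Multiplication by - i; it yields the second component of a statement from the first. *)
Lemma helmholtz_pair_rot u1 u2 f1 f2 : helmholtz_pair u1 u2 f1 f2 ->
  helmholtz_pair u2 (fun y => - u1 y) f2 (fun y => - f1 y).
Proof.
move=> [u1L u2L f1L f2L [h1 [h2 [hL w1 w2 a1 a2]]]].
split=> //; try exact: Lp_realN.
exists h2, (fun i y => - h1 i y); split => //.
- by move=> i; split; [exact: (hL i).2|apply: Lp_realN => //; exact: (hL i).1].
- move=> i phi tphi; have := w1 i phi tphi.
  have NE (g1 g2 : space3 R -> R) : \int[lebesgue3]_y (- g1 y * g2 y) = - \int[lebesgue3]_y (g1 y * g2 y).
    by rewrite -RintegralN; apply: eq_Rintegral => y _; rewrite mulNr.
  by rewrite !NE => ->.
- by apply: aeS a2 => y ->; rewrite mulrN opprK.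
- by apply: aeS a1 => y; rewrite sumrN => E; rewrite E; ring.
Qed.

Variables (x0 : space3 R) (e : R).
Hypothesis e0 : 0 < e.
Notation dist2 := (sqdist x0).

Lemma decays_integrable1 v (k : R -> R) : Lp_real p v -> measurable_fun [set: R] k ->
  decays x0 kap (fun _ y => k (dist2 y)) -> lebesgue3.-integrable setT (EFin \o (fun y => v y * k (dist2 y))).
Proof.
move=> vL mk [K H]; apply: (Lp_real_integrable (K := K) (x0 := x0) p1 kap0 vL).
  exact: (measurableT_comp mk (measurable_sqdist x0)).
by move=> y; exact: (H 0%N).
Qed.

Lemma measurable_defect1 : measurable_fun [set: R] (defect1 e).
Proof.
by apply: measurable_funM => //; apply: measurable_funB; first apply: measurable_funD; exact: measurable_wave_shift.
Qed.

Lemma measurable_defect2 : measurable_fun [set: R] (defect2 e).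
Proof.
by apply: measurable_funM => //; apply: measurable_funB; first apply: measurable_funD; exact: measurable_wave_shift.
Qed.

Lemma decays_defect1 : decays x0 kap (fun _ y => defect1 e (dist2 y)).
Proof.
have w (a b : R) n : decays x0 kap (fun _ y => wave kap sig a b n (sqrad x0 e y)) by exact: decays_wave.
apply: (@eq_decays _ _ _ (fun _ y => e ^+ 2 * ((wave kap sig 3 0 5 (sqrad x0 e y) +
  wave kap sig (3 * kap) (3 * sig) 4 (sqrad x0 e y)) + (- 1) * wave kap sig z1 (- z2) 3 (sqrad x0 e y)))).
  by move=> n y; rewrite mulN1r.
by apply/decaysZ/decaysD; [exact: decaysD|exact: decaysZ].
Qed.

Lemma decays_defect2 : decays x0 kap (fun _ y => defect2 e (dist2 y)).
Proof.
have w (a b : R) n : decays x0 kap (fun _ y => wave kap sig a b n (sqrad x0 e y)) by exact: decays_wave.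
apply: (@eq_decays _ _ _ (fun _ y => e ^+ 2 * ((wave kap sig 0 3 5 (sqrad x0 e y) +
  wave kap sig (- (3 * sig)) (3 * kap) 4 (sqrad x0 e y)) + (- 1) * wave kap sig z2 z1 3 (sqrad x0 e y)))).
  by move=> n y; rewrite mulN1r.
by apply/decaysZ/decaysD; [exact: decaysD|exact: decaysZ].
Qed.

Lemma measurable_kerC : measurable_fun [set: R] (kerC e).
Proof. exact: measurable_radw0. Qed.

Lemma measurable_kerS : measurable_fun [set: R] (kerS e).
Proof. exact: measurable_radw0. Qed.

Lemma decays_kerC : decays x0 kap (fun _ y => kerC e (dist2 y)).
Proof. exact: decays_radw0. Qed.

Lemma decays_kerS : decays x0 kap (fun _ y => kerS e (dist2 y)).
Proof. exact: decays_radw0. Qed.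

Lemma ae_eq_Rintegral (f g : space3 R -> R) :
  measurable_fun [set: T3] (f : T3 -> R) -> measurable_fun [set: T3] (g : T3 -> R) ->
  {ae lebesgue3, forall y, f y = g y} -> \int[lebesgue3]_y f y = \int[lebesgue3]_y g y.
Proof.
move=> mf mg fg; congr fine; apply: ae_eq_integral => //; try exact/measurable_EFinP.
by apply: aeS fg => y /= -> _.
Qed.

(** The real part of (integral of u times the defect) = (integral of f times the kernel). [A1] and
    [A2] put the Laplacian on the kernel, [B1] and [B2] replace the Laplacian of u by means of the
    equation, and the terms in z1 and z2 cancel. *)
Lemma helmholtz_wave u1 u2 f1 f2 : helmholtz_pair u1 u2 f1 f2 ->
  \int[lebesgue3]_y (u1 y * defect1 e (dist2 y) - u2 y * defect2 e (dist2 y)) =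
  \int[lebesgue3]_y (f1 y * kerC e (dist2 y) - f2 y * kerS e (dist2 y)).
Proof.
move=> [u1L u2L f1L f2L [h1 [h2 [hL w1 w2 a1 a2]]]].
have iC v : Lp_real p v -> lebesgue3.-integrable setT (EFin \o (fun y => v y * kerC e (dist2 y))).
  by move=> vL; apply: decays_integrable1 => //; [exact: measurable_kerC|exact: decays_kerC].
have iS v : Lp_real p v -> lebesgue3.-integrable setT (EFin \o (fun y => v y * kerS e (dist2 y))).
  by move=> vL; apply: decays_integrable1 => //; [exact: measurable_kerS|exact: decays_kerS].
have i1 v : Lp_real p v -> lebesgue3.-integrable setT (EFin \o (fun y => v y * defect1 e (dist2 y))).
  by move=> vL; apply: decays_integrable1 => //; [exact: measurable_defect1|exact: decays_defect1].
have i2 v : Lp_real p v -> lebesgue3.-integrable setT (EFin \o (fun y => v y * defect2 e (dist2 y))).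
  by move=> vL; apply: decays_integrable1 => //; [exact: measurable_defect2|exact: decays_defect2].
have self v : Lp_real p v -> forall y, `|v y| <= cabs (v y)%:C by move=> _ y; rewrite cabs_real.
have A1 := weak_laplacian_wave x0 sig 1 0 e0 kap0 p1 u1L (fun i => (hL i).1) (Lp_real_measurable u1L)
  (fun i => Lp_real_measurable (hL i).1) (self _ u1L) (fun i => self _ (hL i).1) w1.
have A2 := weak_laplacian_wave x0 sig 0 1 e0 kap0 p1 u2L (fun i => (hL i).2) (Lp_real_measurable u2L)
  (fun i => Lp_real_measurable (hL i).2) (self _ u2L) (fun i => self _ (hL i).2) w2.
have mL v k : Lp_real p v -> measurable_fun [set: R] k -> measurable_fun [set: T3] ((fun y : space3 R => v y * k (dist2 y)) : T3 -> R).
  move=> vL mk; apply: measurable_funM; first exact: Lp_real_measurable vL.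
  exact: (measurableT_comp mk (measurable_sqdist x0)).
have mS (h : 'I_3 -> space3 R -> R) k : (forall i, Lp_real p (h i)) -> measurable_fun [set: R] k ->
    measurable_fun [set: T3] ((fun y : space3 R => (\sum_(i < 3) h i y) * k (dist2 y)) : T3 -> R).
  move=> hi mk; apply: measurable_funM; last exact: (measurableT_comp mk (measurable_sqdist x0)).
  by apply: measurable_sum => i; exact: Lp_real_measurable (hi i).
have m1 := Lp_real_measurable u1L; have m2 := Lp_real_measurable u2L.
have m3 := Lp_real_measurable f1L; have m4 := Lp_real_measurable f2L.
pose G1 y := f1 y + z1 * u1 y - z2 * u2 y.
pose G2 y := f2 y + z1 * u2 y + z2 * u1 y.
have mG1 : measurable_fun [set: T3] (G1 : T3 -> R).
  by apply: measurable_funB; first apply: measurable_funD; try apply: measurable_funM => //; assumption.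
have mG2 : measurable_fun [set: T3] (G2 : T3 -> R).
  by apply: measurable_funD; first apply: measurable_funD; try apply: measurable_funM => //; assumption.
have mk k : measurable_fun [set: R] k -> measurable_fun [set: T3] ((fun y : space3 R => k (dist2 y)) : T3 -> R).
  by move=> mk; exact: (measurableT_comp mk (measurable_sqdist x0)).
pose L1 s := 4 * (s * radw2 e kap sig 1 0 s) + 6 * radw1 e kap sig 1 0 s.
pose L2 s := 4 * (s * radw2 e kap sig 0 1 s) + 6 * radw1 e kap sig 0 1 s.
have L1E y : L1 (dist2 y) = - defect1 e (dist2 y) - z1 * kerC e (dist2 y) + z2 * kerS e (dist2 y).
  by rewrite -(kerC_ode e0 (sqdist_ge0 x0 y)) /L1; ring.
have L2E y : L2 (dist2 y) = - defect2 e (dist2 y) - z1 * kerS e (dist2 y) - z2 * kerC e (dist2 y).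
  by rewrite -(kerS_ode e0 (sqdist_ge0 x0 y)) /L2; ring.
have B1 : \int[lebesgue3]_y ((\sum_(i < 3) h1 i y) * kerC e (dist2 y)) = - \int[lebesgue3]_y (G1 y * kerC e (dist2 y)).
  rewrite -RintegralN; apply: ae_eq_Rintegral.
  - by apply: mS => [i|]; [exact: (hL i).1|exact: measurable_kerC].
  - by apply: measurableT_comp => //; apply: measurable_funM => //; exact: mk measurable_kerC.
  - by apply: aeS a1 => y; rewrite /G1 => <-; rewrite mulNr opprK.
have B2 : \int[lebesgue3]_y ((\sum_(i < 3) h2 i y) * kerS e (dist2 y)) = - \int[lebesgue3]_y (G2 y * kerS e (dist2 y)).
  rewrite -RintegralN; apply: ae_eq_Rintegral.
  - by apply: mS => [i|]; [exact: (hL i).2|exact: measurable_kerS].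
  - by apply: measurableT_comp => //; apply: measurable_funM => //; exact: mk measurable_kerS.
  - by apply: aeS a2 => y; rewrite /G2 => <-; rewrite mulNr opprK.
have iZ (c : R) (g : space3 R -> R) : lebesgue3.-integrable setT (EFin \o g) ->
    lebesgue3.-integrable setT (EFin \o (fun y => c * g y)) by exact: integrableZl_real.
have iD (g h : space3 R -> R) : lebesgue3.-integrable setT (EFin \o g) -> lebesgue3.-integrable setT (EFin \o h) ->
    lebesgue3.-integrable setT (EFin \o (fun y => g y + h y)) by exact: integrableD_real.
have eqi (g h : space3 R -> R) : (forall y, g y = h y) -> lebesgue3.-integrable setT (EFin \o g) ->
    lebesgue3.-integrable setT (EFin \o h) by move=> gh; rewrite (funext gh).
have iL1 : lebesgue3.-integrable setT (EFin \o (fun y => u1 y * L1 (dist2 y))).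
  apply: (eqi _ _ _ (iD _ _ (iD _ _ (iZ (- 1) _ (i1 _ u1L)) (iZ (- z1) _ (iC _ u1L))) (iZ z2 _ (iS _ u1L)))).
  by move=> y; rewrite L1E; ring.
have iL2 : lebesgue3.-integrable setT (EFin \o (fun y => u2 y * L2 (dist2 y))).
  apply: (eqi _ _ _ (iD _ _ (iD _ _ (iZ (- 1) _ (i2 _ u2L)) (iZ (- z1) _ (iS _ u2L))) (iZ (- z2) _ (iC _ u2L)))).
  by move=> y; rewrite L2E; ring.
have iG1 : lebesgue3.-integrable setT (EFin \o (fun y => G1 y * kerC e (dist2 y))).
  apply: (eqi _ _ _ (iD _ _ (iD _ _ (iC _ f1L) (iZ z1 _ (iC _ u1L))) (iZ (- z2) _ (iC _ u2L)))).
  by move=> y; rewrite /G1; ring.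
have iG2 : lebesgue3.-integrable setT (EFin \o (fun y => G2 y * kerS e (dist2 y))).
  apply: (eqi _ _ _ (iD _ _ (iD _ _ (iS _ f2L) (iZ z1 _ (iS _ u2L))) (iZ z2 _ (iS _ u1L)))).
  by move=> y; rewrite /G2; ring.
apply/eqP; rewrite -subr_eq0 -RintegralB//; first last.
- by apply: (eqi _ _ _ (iD _ _ (iC _ f1L) (iZ (- 1) _ (iS _ f2L)))) => y; ring.
- by apply: (eqi _ _ _ (iD _ _ (i1 _ u1L) (iZ (- 1) _ (i2 _ u2L)))) => y; ring.
have -> : \int[lebesgue3]_y (u1 y * defect1 e (dist2 y) - u2 y * defect2 e (dist2 y) - (f1 y * kerC e (dist2 y) - f2 y * kerS e (dist2 y))) =
  \int[lebesgue3]_y ((u2 y * L2 (dist2 y) + G2 y * kerS e (dist2 y)) - (u1 y * L1 (dist2 y) + G1 y * kerC e (dist2 y))).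
  by apply: eq_Rintegral => y _; rewrite L1E L2E /G1 /G2; ring.
rewrite RintegralB//; [|exact: iD|exact: iD].
rewrite !RintegralD//.
by rewrite A1 A2 -/(kerC e) -/(kerS e) B1 B2 !addNr subrr.
Qed.

End Helmholtz.

(** * The Helmholtz defect as an approximate identity *)

Section KernelBounds.
Context {R : realType}.
Variables (kap sig : R).
Hypothesis kap0 : 0 < kap.
Notation z1 := (sig ^+ 2 - kap ^+ 2).
Notation z2 := (2 * sig * kap).

Lemma lipschitz_ge0 (f df : R -> R) (L : R) : (forall x : R, is_derive x 1 f (df x)) ->
  (forall x, 0 <= x -> `|df x| <= L) -> forall x, 0 <= x -> `|f x - f 0| <= L * x.
Proof.
move=> fdf dfL x x0.
have cf : {within `[0, x], continuous f}.
  apply: continuous_subspaceT => y; apply/differentiable_continuous/derivable1_diffP.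
  by have [] := fdf y.
have [c cab ->] := MVT_segment x0 (fun y _ => fdf y) cf.
rewrite subr0 normrM (ger0_norm x0) ler_wpM2r// dfL//.
by move: cab; rewrite in_itv /= => /andP[].
Qed.

Lemma norm_cos_le1 (x : R) : `|cos x| <= 1.
Proof. by rewrite ler_norml cos_geN1 cos_le1. Qed.

Lemma norm_sin_le1 (x : R) : `|sin x| <= 1.
Proof. by rewrite ler_norml sin_geN1 sin_le1. Qed.

Lemma expRN_le1 (x : R) : 0 <= x -> expR (- (kap * x)) <= 1.
Proof. by move=> x0; rewrite -expR0 ler_expR oppr_le0 mulr_ge0// ltW. Qed.

Lemma is_derive_damp (x : R) : is_derive x 1 (fun x : R => expR (- (kap * x))) (expR (- (kap * x)) * - kap).
Proof.
have h : is_derive x 1 (fun x : R => - (kap * x)) (- (kap * 1)).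
  by apply: is_deriveN; have := is_deriveZ kap (is_derive_id x (1 : R)).
by have := @is_derive1_comp _ expR (fun x => - (kap * x)) x _ _ (is_derive_expR _) h; rewrite mulr1.
Qed.

Lemma is_derive_sigl (x : R) : is_derive x 1 (fun x : R => sig * x) sig.
Proof. by have := is_deriveZ sig (is_derive_id x (1 : R)); rewrite [sig%:A]mulr1. Qed.

Lemma damped_deriv_le x (u v : R) : 0 <= x -> `|u| <= 1 -> `|v| <= 1 ->
  `|expR (- (kap * x)) * (kap * u + sig * v)| <= kap + `|sig|.
Proof.
move=> x0 u1 v1; rewrite normrM (ger0_norm (expR_ge0 _)).
have h : `|kap * u + sig * v| <= kap + `|sig|.
  rewrite (le_trans (ler_normD _ _))// !normrM (gtr0_norm kap0); apply: lerD.
    by rewrite ler_piMr// ltW.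
  by rewrite ler_piMr.
apply: le_trans h; rewrite ler_piMl//; exact: expRN_le1.
Qed.

(** The mean value inequality for the real part of e^(i (sig + i kap) x). The gained factor x, taken
    at x = rho, lowers e^2 / rho^5 to e^2 / rho^4. *)
Lemma damped_cos x : 0 <= x -> `|expR (- (kap * x)) * cos (sig * x) - 1| <= (kap + `|sig|) * x.
Proof.
move=> x0.
have d (y : R) : is_derive y 1 (fun y => expR (- (kap * y)) * cos (sig * y)) (expR (- (kap * y)) * (kap * - cos (sig * y) + sig * - sin (sig * y))).
  have h := @is_derive1_comp _ cos (fun x => sig * x) y _ _ (is_derive_cos _) (is_derive_sigl y).
  have := is_deriveM (is_derive_damp y) h; move/is_derive_eq; apply.
  by rewrite /GRing.scale /=; ring.
have := lipschitz_ge0 d; rewrite !mulr0 oppr0 expR0 cos0 mulr1; apply => // y y0.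
by apply: damped_deriv_le => //; rewrite normrN; [exact: norm_cos_le1|exact: norm_sin_le1].
Qed.

Lemma damped_sin x : 0 <= x -> `|expR (- (kap * x)) * sin (sig * x)| <= (kap + `|sig|) * x.
Proof.
move=> x0.
have d (y : R) : is_derive y 1 (fun y => expR (- (kap * y)) * sin (sig * y)) (expR (- (kap * y)) * (kap * - sin (sig * y) + sig * cos (sig * y))).
  have h := @is_derive1_comp _ sin (fun x => sig * x) y _ _ (is_derive_sin _) (is_derive_sigl y).
  have := is_deriveM (is_derive_damp y) h; move/is_derive_eq; apply.
  by rewrite /GRing.scale /=; ring.
have := lipschitz_ge0 d; rewrite !mulr0 oppr0 expR0 sin0 mulr0; move=> /(_ (kap + `|sig|)) h.
rewrite -[X in `|X|]subr0; apply: h => // y y0.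
by apply: damped_deriv_le => //; rewrite ?normrN; [exact: norm_sin_le1|exact: norm_cos_le1].
Qed.

(** With rho^2 = s + e^2 these are e^2 / rho^5 and, for [tail], e^2 / rho^4. The first has a fixed
    mass 4 pi / 3, the second a mass O(e). *)
Definition core (e s : R) : R := e ^+ 2 * (e ^+ 2 + s) ^- 2 / Num.sqrt (e ^+ 2 + s).
Definition tail (e s : R) : R := e ^+ 2 * (e ^+ 2 + s) ^- 2.

Lemma coreE e s : 0 < e -> 0 <= s -> core e s = e ^+ 2 * (Num.sqrt (s + e ^+ 2)) ^- 5.
Proof.
move=> e0 s0; rewrite /core addrC; have t0 : 0 < s + e ^+ 2 by rewrite ltr_wpDl// exprn_gt0.
have E : s + e ^+ 2 = Num.sqrt (s + e ^+ 2) ^+ 2 by rewrite sqr_sqrtr// ltW.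
rewrite [X in X ^- 2]E; have := t0; rewrite -sqrtr_gt0; move: (Num.sqrt _) => w w0.
by field; rewrite gt_eqF.
Qed.

Lemma tailE e s : 0 < e -> 0 <= s -> tail e s = e ^+ 2 * (Num.sqrt (s + e ^+ 2)) ^- 4.
Proof.
move=> e0 s0; rewrite /tail addrC; have t0 : 0 < s + e ^+ 2 by rewrite ltr_wpDl// exprn_gt0.
have E : s + e ^+ 2 = Num.sqrt (s + e ^+ 2) ^+ 2 by rewrite sqr_sqrtr// ltW.
rewrite [X in X ^- 2]E; have := t0; rewrite -sqrtr_gt0; move: (Num.sqrt _) => w w0.
by field; rewrite gt_eqF.
Qed.

Lemma core_ge0 e s : 0 <= core e s.
Proof. by rewrite /core; nneg. Qed.

Lemma tail_ge0 e s : 0 <= tail e s.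
Proof. by rewrite /tail; nneg. Qed.

(* [k e] is [3 c e^2 / rho^5], [rho^2 = s + e^2], up to an error whose mass is O(e),
   with an exponential decay uniform in [e]; thus it approximates [4 pi c] times
   the Dirac measure. *)
Definition mollifying (c : R) (k : R -> R -> R) : Prop :=
  exists K : R, exists2 K' : R, 0 < K' & forall e s, 0 < e -> 0 <= s ->
    `|k e s| <= expR (- (K' * Num.sqrt s)) * (3 * core e s + K * tail e s) /\
    `|k e s - 3 * c * core e s| <= K * tail e s.

Let M := kap + `|sig|.

(** The power rho^(-3) alone is not integrable at infinity. Half of the exponential is spent on rho
    e^(-kap rho / 2) <= 2 / kap, which raises the power to rho^(-4); the other half remains as
    decay. *)
Lemma wave3_le (a b e s : R) : 0 < e -> 0 <= s ->
  `|e ^+ 2 * wave kap sig a b 3 (s + e ^+ 2)| <=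
   (`|a| + `|b|) * (2 / kap) * tail e s * expR (- (kap / 2 * Num.sqrt (s + e ^+ 2))).
Proof.
move=> e0 s0; rewrite tailE// normrM (ger0_norm (sqr_ge0 _)).
have t0 : 0 < s + e ^+ 2 by rewrite ltr_wpDl// exprn_gt0.
have := wave_bound kap sig a b 3 (s + e ^+ 2); have := t0; rewrite -sqrtr_gt0.
move: (wave _ _ _ _ _ _) (Num.sqrt (s + e ^+ 2)) => v w w0 vw.
apply: (@le_trans _ _ (e ^+ 2 * ((`|a| + `|b|) * w ^- 3 * expR (- (kap * w))))).
  by rewrite ler_wpM2l ?sqr_ge0.
have -> : kap * w = kap / 2 * w + kap / 2 * w by rewrite -mulrDl -splitr.
rewrite opprD expRD.
have h : w * expR (- (kap / 2 * w)) <= 2 / kap.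
  rewrite expRN ler_pdivrMr ?expR_gt0// mulrC -ler_pdivrMr ?divr_gt0// invf_div.
  by rewrite mulrC (le_trans _ (expR_ge1Dx _))// lerDr.
rewrite [leLHS](_ : _ = e ^+ 2 * (`|a| + `|b|) * w ^- 4 * expR (- (kap / 2 * w)) * (w * expR (- (kap / 2 * w)))); last first.
  by move: (expR _) (`|a| + `|b|) => E A; field; rewrite gt_eqF.
rewrite [leRHS](_ : _ = e ^+ 2 * (`|a| + `|b|) * w ^- 4 * expR (- (kap / 2 * w)) * (2 / kap)); last first.
  by move: (expR _) (`|a| + `|b|) (2 / kap) => E A B; field; rewrite gt_eqF.
by apply: ler_wpM2l => //; nneg; rewrite exprn_ge0// ltW.
Qed.

Lemma wave4_le (a b e s : R) : 0 < e -> 0 <= s ->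
  `|e ^+ 2 * wave kap sig a b 4 (s + e ^+ 2)| <=
   (`|a| + `|b|) * tail e s * expR (- (kap / 2 * Num.sqrt (s + e ^+ 2))).
Proof.
move=> e0 s0; rewrite tailE// normrM (ger0_norm (sqr_ge0 _)).
have t0 : 0 < s + e ^+ 2 by rewrite ltr_wpDl// exprn_gt0.
have := wave_bound kap sig a b 4 (s + e ^+ 2); have := t0; rewrite -sqrtr_gt0.
move: (wave _ _ _ _ _ _) (Num.sqrt (s + e ^+ 2)) => v w w0 vw.
rewrite [leRHS](_ : _ = e ^+ 2 * ((`|a| + `|b|) * w ^- 4 * expR (- (kap / 2 * w)))); last first.
  by move: (expR _) (`|a| + `|b|) => E A; ring.
rewrite ler_wpM2l ?sqr_ge0//; apply: le_trans vw _; apply: ler_wpM2l; first by nneg; rewrite exprn_ge0// ltW.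
by rewrite ler_expR lerN2; apply: ler_wpM2r; [exact: ltW|rewrite ler_pdivrMr// mulr_natr mulr2n lerDl ltW].
Qed.

Lemma wave5_le (a b e s : R) : 0 < e -> 0 <= s -> `|a| + `|b| <= 3 ->
  `|e ^+ 2 * wave kap sig a b 5 (s + e ^+ 2)| <=
   3 * core e s * expR (- (kap / 2 * Num.sqrt (s + e ^+ 2))).
Proof.
move=> e0 s0 ab; rewrite coreE// normrM (ger0_norm (sqr_ge0 _)).
have t0 : 0 < s + e ^+ 2 by rewrite ltr_wpDl// exprn_gt0.
have := wave_bound kap sig a b 5 (s + e ^+ 2); have := t0; rewrite -sqrtr_gt0.
move: (wave _ _ _ _ _ _) (Num.sqrt (s + e ^+ 2)) => v w w0 vw.
rewrite [leRHS](_ : _ = e ^+ 2 * (3 * w ^- 5 * expR (- (kap / 2 * w)))); last first.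
  by move: (expR _) => E; ring.
rewrite ler_wpM2l ?sqr_ge0//; apply: le_trans vw _.
apply: ler_pM; rewrite ?expR_ge0//; first by nneg; rewrite exprn_ge0// ltW.
  by rewrite ler_wpM2r// invr_ge0 exprn_ge0// ltW.
by rewrite ler_expR lerN2; apply: ler_wpM2r; [exact: ltW|rewrite ler_pdivrMr// mulr_natr mulr2n lerDl ltW].
Qed.

Lemma decay_sqrt e s : expR (- (kap / 2 * Num.sqrt (s + e ^+ 2))) <= expR (- (kap / 2 * Num.sqrt s)).
Proof.
by rewrite ler_expR lerN2 ler_wpM2l ?divr_ge0 ?(ltW kap0)// ler_wsqrtr// lerDl sqr_ge0.
Qed.

Lemma decay_le1 (e s : R) : expR (- (kap / 2 * Num.sqrt (s + e ^+ 2))) <= 1.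
Proof. by rewrite -expR0 ler_expR oppr_le0 mulr_ge0 ?divr_ge0 ?sqrtr_ge0 ?(ltW kap0). Qed.

Lemma core_tail e s : 0 < e -> 0 <= s -> core e s * Num.sqrt (s + e ^+ 2) = tail e s.
Proof.
move=> e0 s0; rewrite coreE// tailE//.
have t0 : 0 < s + e ^+ 2 by rewrite ltr_wpDl// exprn_gt0.
by have := t0; rewrite -sqrtr_gt0; move: (Num.sqrt _) => w w0; field; rewrite gt_eqF.
Qed.

(** Only the wave with the fifth power has mass of order one, hence the hypothesis on it alone; the
    fourth and third powers are absorbed in [tail]. *)
Lemma mollifying_defect (c a b a4 b4 a3 b3 : R) :
  (forall e s, 0 < e -> 0 <= s -> `|e ^+ 2 * wave kap sig a b 5 (s + e ^+ 2) - 3 * c * core e s| <= 3 * M * tail e s) ->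
  `|a| + `|b| <= 3 ->
  mollifying c (fun e s => e ^+ 2 * (wave kap sig a b 5 (s + e ^+ 2) +
    wave kap sig a4 b4 4 (s + e ^+ 2) - wave kap sig a3 b3 3 (s + e ^+ 2))).
Proof.
move=> h ab; pose K := (`|a4| + `|b4|) + (`|a3| + `|b3|) * (2 / kap).
exists (3 * M + K); exists (kap / 2); first by rewrite divr_gt0.
move=> e s e0 s0.
have w5 := wave5_le e0 s0 ab.
have w4 := wave4_le a4 b4 e0 s0.
have w3 := wave3_le a3 b3 e0 s0.
have hh := h _ _ e0 s0.
have M0 : 0 <= M by rewrite addr_ge0// ltW.
have t0 := tail_ge0 e s; have c0 := core_ge0 e s.
have E0 := expR_ge0 (- (kap / 2 * Num.sqrt (s + e ^+ 2))).
rewrite mulrBr mulrDr.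
move: {h} w5 w4 w3 hh; rewrite /K; set X5 := e ^+ 2 * _; set X4 := e ^+ 2 * _; set X3 := e ^+ 2 * _ => w5 w4 w3 hh.
have n4 : 0 <= `|a4| + `|b4| by rewrite addr_ge0.
have n3 : 0 <= (`|a3| + `|b3|) * (2 / kap) by rewrite mulr_ge0 ?addr_ge0// divr_ge0// ltW.
move: (`|a4| + `|b4|) ((`|a3| + `|b3|) * (2 / kap)) n4 n3 w4 w3 => k4 k3 n4 n3 w4 w3.
split.
  apply: (@le_trans _ _ (expR (- (kap / 2 * Num.sqrt (s + e ^+ 2))) * (3 * core e s + (3 * M + (k4 + k3)) * tail e s))).
    apply: (@le_trans _ _ (`|X5| + `|X4| + `|X3|)).
      by rewrite (le_trans (ler_normB _ _))// lerD2r ler_normD.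
    apply: (le_trans (lerD (lerD w5 w4) w3)); rewrite -!mulrDl [leRHS]mulrC -subr_ge0 -mulrBl.
    apply: mulr_ge0 => //; rewrite [leRHS](_ : _ = 3 * M * tail e s); last by ring.
    by nneg.
  by apply: ler_wpM2r; [nneg; rewrite ?addr_ge0//; nneg|exact: decay_sqrt].
have E1 := decay_le1 e s.
have w4' : `|X4| <= k4 * tail e s by apply: (le_trans w4); rewrite ler_piMr// mulr_ge0.
have w3' : `|X3| <= k3 * tail e s by apply: (le_trans w3); rewrite ler_piMr// mulr_ge0.
rewrite (_ : X5 + X4 - X3 - 3 * c * core e s = (X5 - 3 * c * core e s) + X4 - X3); last by ring.
apply: (@le_trans _ _ (`|X5 - 3 * c * core e s| + `|X4| + `|X3|)).
  by rewrite (le_trans (ler_normB _ _))// lerD2r ler_normD.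
by apply: (le_trans (lerD (lerD hh w4') w3')); rewrite -!mulrDl addrA.
Qed.

Lemma mollifying_defect1 : mollifying 1 (defect1 kap sig).
Proof.
apply: mollifying_defect; last by rewrite normr0 addr0 ger0_norm.
move=> e s e0 s0; rewrite mulr1 -core_tail// coreE// /wave mul0r addr0.
rewrite [X in `|X|](_ : _ = 3 * (e ^+ 2 * Num.sqrt (s + e ^+ 2) ^- 5) * (wave1 kap sig (s + e ^+ 2) - 1)); last by ring.
rewrite normrM ger0_norm; last by nneg.
rewrite [leRHS](_ : _ = 3 * (e ^+ 2 * Num.sqrt (s + e ^+ 2) ^- 5) * (M * Num.sqrt (s + e ^+ 2))); last by ring.
apply: ler_wpM2l; first by nneg.
exact: damped_cos (sqrtr_ge0 _).
Qed.

(** The mass is 0 because the imaginary part of e^(i (sig + i kap) rho) vanishes to first order at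
    rho = 0, which pushes even the leading term into [tail]. *)
Lemma mollifying_defect2 : mollifying 0 (defect2 kap sig).
Proof.
apply: mollifying_defect; last by rewrite normr0 add0r ger0_norm.
move=> e s e0 s0; rewrite mulr0 mul0r subr0 -core_tail// coreE// /wave mul0r add0r.
rewrite [X in `|X|](_ : _ = 3 * (e ^+ 2 * Num.sqrt (s + e ^+ 2) ^- 5) * wave2 kap sig (s + e ^+ 2)); last by ring.
rewrite normrM ger0_norm; last by nneg.
rewrite [leRHS](_ : _ = 3 * (e ^+ 2 * Num.sqrt (s + e ^+ 2) ^- 5) * (M * Num.sqrt (s + e ^+ 2))); last by ring.
apply: ler_wpM2l; first by nneg.
exact: damped_sin (sqrtr_ge0 _).
Qed.

End KernelBounds.

Section RealFubini.
Context d1 d2 (T1 : measurableType d1) (T2 : measurableType d2) (R : realType).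
Variables (m1 : {sigma_finite_measure set T1 -> \bar R}) (m2 : {sigma_finite_measure set T2 -> \bar R}).
Variable F : T1 * T2 -> R.
Hypothesis mF : measurable_fun setT F.

Let mFE : measurable_fun setT (EFin \o F).
Proof. exact/measurable_EFinP. Qed.

(** Tonelli's theorem is applied to the positive and negative parts separately, so no integrability
    of F is involved here. *)
Lemma measurable_Rintegral1 : measurable_fun setT (fun x => \int[m2]_y F (x, y)).
Proof.
apply: (measurableT_comp (fine_measurable measurableT)).
rewrite (_ : (fun x => _) = (fun x => fubini_F m2 ((EFin \o F)^\+)%E x - fubini_F m2 ((EFin \o F)^\-)%E x)%E).
  by apply: emeasurable_funB; apply: measurable_fun_fubini_tonelli_F => //;
    [exact: measurable_funepos|exact: measurable_funeneg].
apply/funext => x; rewrite [LHS]integralE.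
by congr (_ - _)%E; apply: eq_integral => y _; rewrite ?funeposE ?funenegE.
Qed.

Let measurable_G : measurable_fun setT (fun y => \int[m1]_x (F (x, y))%:E)%E.
Proof.
rewrite (_ : (fun x => _) = (fun x => fubini_G m1 ((EFin \o F)^\+)%E x - fubini_G m1 ((EFin \o F)^\-)%E x)%E).
  by apply: emeasurable_funB; apply: measurable_fun_fubini_tonelli_G => //;
    [exact: measurable_funepos|exact: measurable_funeneg].
apply/funext => x; rewrite [LHS]integralE.
by congr (_ - _)%E; apply: eq_integral => y _; rewrite ?funeposE ?funenegE.
Qed.

Lemma measurable_Rintegral2 : measurable_fun setT (fun y => \int[m1]_x F (x, y)).
Proof. exact: (measurableT_comp (fine_measurable measurableT) measurable_G). Qed.

Hypothesis iF : (\int[m1]_x \int[m2]_y `|F (x, y)|%:E < +oo)%E.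

Let imF : (m1 \x m2)%E.-integrable setT (EFin \o F).
Proof. exact/integrable12ltyP. Qed.

(** Almost every section of an integrable function is integrable, and there the passage from
    extended to real integrals loses nothing. *)
Lemma ae_fine_Rintegral1 : {ae m1, forall x, (\int[m2]_y F (x, y))%:E = (\int[m2]_y (F (x, y))%:E)%E}.
Proof.
have := ae_integrable1 imF.
by apply: aeS => x h; rewrite /Rintegral fineK//; exact: integral_fune_fin_num.
Qed.

Lemma ae_fine_Rintegral2 : {ae m2, forall y, (\int[m1]_x F (x, y))%:E = (\int[m1]_x (F (x, y))%:E)%E}.
Proof.
have := ae_integrable2 imF.
by apply: aeS => x h; rewrite /Rintegral fineK//; exact: integral_fune_fin_num.
Qed.

Lemma integrable_Rintegral1 : m1.-integrable setT (EFin \o (fun x => \int[m2]_y F (x, y))).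
Proof.
have mR : measurable_fun setT (EFin \o (fun x => \int[m2]_y F (x, y))).
  by apply/measurable_EFinP; exact: measurable_Rintegral1.
have iI := integrable_fubini_F imF; have /integrableP[mI fI] := iI.
apply/integrableP; split => //; apply: le_lt_trans fI; rewrite le_eqVlt; apply/orP; left; apply/eqP.
apply: ae_eq_integral => //; try exact: measurableT_comp.
by apply: aeS ae_fine_Rintegral1 => x E _; congr (`|_|)%E.
Qed.

Lemma Rintegral_Fubini : \int[m1]_x \int[m2]_y F (x, y) = \int[m2]_y \int[m1]_x F (x, y).
Proof.
rewrite /Rintegral; congr fine.
transitivity (\int[m1]_x \int[m2]_y (F (x, y))%:E)%E.
  apply: ae_eq_integral => //.
  - by apply/measurable_EFinP; exact: measurable_Rintegral1.
  - exact: measurable_fubini_F imF.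
  - by apply: aeS ae_fine_Rintegral1 => x /= E _; rewrite -E.
rewrite (Fubini imF); apply/esym/ae_eq_integral => //.
- by apply/measurable_EFinP; exact: measurable_Rintegral2.
- by apply: aeS ae_fine_Rintegral2 => x E _.
Qed.

End RealFubini.

Section KernelMass.
Context {R : realType}.
Notation T3 := (measurableTypeR R * measurableTypeR R * measurableTypeR R)%type.
Implicit Types (e : R) (x y : space3 R).

Lemma sqn3N x : sqn3 (- x) = sqn3 x.
Proof. by rewrite /sqn3 /= !sqrrN. Qed.

Lemma sqn3B x y : sqn3 (x - y) = sqn3 (y - x).
Proof. by rewrite -sqn3N opprB. Qed.

Lemma measurable_core e : measurable_fun [set: R] (core e).
Proof.
apply: measurable_funM; last first.
  by apply: (measurableT_comp measurable_invr); apply: (measurableT_comp measurable_sqrt); exact: measurable_funD.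
apply: measurable_funM => //; apply: (measurableT_comp measurable_invr).
by apply: measurable_funX; exact: measurable_funD.
Qed.

Lemma measurable_tail e : measurable_fun [set: R] (tail e).
Proof.
apply: measurable_funM => //; apply: (measurableT_comp measurable_invr).
by apply: measurable_funX; exact: measurable_funD.
Qed.

Lemma measurable_sqn3_subl x : measurable_fun [set: T3] ((fun y : space3 R => sqn3 (x - y)) : T3 -> R).
Proof. exact: measurable_sqdist. Qed.

Lemma measurable_sqn3_subr y : measurable_fun [set: T3] ((fun x : space3 R => sqn3 (x - y)) : T3 -> R).
Proof. by rewrite (funext (fun x => sqn3B x y)); exact: measurable_sqdist. Qed.

Lemma ge0_integral_radial (k : R -> R) y : measurable_fun [set: R] k -> (forall s, 0 <= k s) ->
  (\int[lebesgue3]_x (k (sqn3 (x - y)))%:E = \int[lebesgue3]_x (k (sqn3 x))%:E)%E.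
Proof.
move=> mk k0.
have mf : measurable_fun [set: T3] ((fun x : space3 R => (k (sqn3 x))%:E) : T3 -> \bar R).
  by apply/measurable_EFinP; exact: (measurableT_comp mk measurable_sqn3).
rewrite -(ge0_integral_sub3 y mf); last by move=> x; rewrite lee_fin.
by apply: eq_integral => x _; rewrite sqn3B.
Qed.

Lemma ge0_le_integral3 (f g : T3 -> \bar R) : measurable_fun [set: T3] f -> measurable_fun [set: T3] g ->
  (forall x, 0 <= f x)%E -> (forall x, f x <= g x)%E ->
  (\int[lebesgue3]_x f x <= \int[lebesgue3]_x g x)%E.
Proof. by move=> mf mg f0 fg; apply: ge0_le_integral => // x _. Qed.

Lemma integral_core e y : 0 < e ->
  (\int[lebesgue3]_x (core e (sqn3 (x - y)))%:E = (4 / 3 * pi)%:E)%E.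
Proof.
move=> e0; rewrite (ge0_integral_radial _ (measurable_core e) (core_ge0 e)).
have mf : measurable_fun [set: T3] ((fun x : space3 R => core e (sqn3 x)) : T3 -> R).
  exact: (measurableT_comp (measurable_core e) measurable_sqn3).
have := integral_core_density e0.
have c0 : (0 : R) <= 3 / (4 * pi) by rewrite divr_ge0// mulr_ge0// pi_ge0.
have := ge0_integralRZl lebesgue3 c0 mf (fun x => core_ge0 e _); rewrite /core => -> h.
have pi0 := @pi_gt0 R.
have -> : (4 / 3 * pi = (4 / 3 * pi) * 1 :> R) by rewrite mulr1.
rewrite EFinM -h muleA -EFinM (_ : _ * (3 / _) = 1) ?mul1e//.
by have := pi0; move: pi => P P0; field; rewrite gt_eqF.
Qed.

Lemma integral_tail e y : 0 < e ->
  (\int[lebesgue3]_x (tail e (sqn3 (x - y)))%:E <= (4 * pi * e)%:E)%E.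
Proof.
by move=> e0; rewrite (ge0_integral_radial _ (measurable_tail e) (tail_ge0 e)); exact: integral_tail_profile.
Qed.

Lemma ge0_integrable (f : space3 R -> R) : measurable_fun [set: T3] (f : T3 -> R) -> (forall x, 0 <= f x) ->
  (\int[lebesgue3]_x (f x)%:E < +oo)%E -> lebesgue3.-integrable setT (EFin \o f).
Proof.
move=> mf f0 fi; apply/integrableP; split; first exact/measurable_EFinP.
by under eq_integral do rewrite /= ger0_norm//.
Qed.

Lemma core_integrable e y : 0 < e -> lebesgue3.-integrable setT (EFin \o (fun x : space3 R => core e (sqn3 (x - y)))).
Proof.
move=> e0; apply: ge0_integrable => [|x|]; last by rewrite integral_core// ltry.
  exact: (measurableT_comp (measurable_core e) (measurable_sqn3_subr y)).
exact: core_ge0.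
Qed.

Lemma tail_integrable e y : 0 < e -> lebesgue3.-integrable setT (EFin \o (fun x : space3 R => tail e (sqn3 (x - y)))).
Proof.
move=> e0; apply: ge0_integrable => [|x|]; last by apply: le_lt_trans (integral_tail y e0) _; exact: ltry.
  exact: (measurableT_comp (measurable_tail e) (measurable_sqn3_subr y)).
exact: tail_ge0.
Qed.

Lemma Rintegral_core e y : 0 < e -> \int[lebesgue3]_x (core e (sqn3 (x - y))) = 4 / 3 * pi.
Proof. by move=> e0; rewrite /Rintegral integral_core. Qed.

Lemma Rintegral_tail e y : 0 < e -> \int[lebesgue3]_x (tail e (sqn3 (x - y))) <= 4 * pi * e.
Proof.
move=> e0; rewrite /Rintegral -lee_fin fineK; first exact: integral_tail.
exact: integral_fune_fin_num (tail_integrable y e0).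
Qed.

Lemma Rintegral_le (f g : space3 R -> R) : measurable_fun [set: T3] (f : T3 -> R) ->
  lebesgue3.-integrable setT (EFin \o g) -> (forall x, `|f x| <= g x) ->
  `|\int[lebesgue3]_x f x| <= \int[lebesgue3]_x g x.
Proof.
move=> mf ig fg.
have if' : lebesgue3.-integrable setT (EFin \o f).
  apply: (le_integrable measurableT _ _ ig); first exact/measurable_EFinP.
  by move=> x _ /=; rewrite lee_fin (le_trans (fg x))// ler_norm.
apply: (le_trans (le_normr_Rintegral measurableT if')); apply: le_Rintegral => //.
exact: integrable_norm.
Qed.

End KernelMass.

Section Mollify.
Context {R : realType}.
Notation T3 := (measurableTypeR R * measurableTypeR R * measurableTypeR R)%type.

Definition cutoff (r L : R) (eta : space3 R -> R) : Prop :=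
  [/\ measurable_fun [set: T3] (eta : T3 -> R), forall x, 0 <= eta x, forall x, eta x <= 1,
      forall x, r < norm3 x -> eta x = 0 & forall x y, eta x <= eta y + L * norm3 (x - y)].

Lemma measurable_sub33 : measurable_fun [set: T3 * T3] ((fun z : space3 R * space3 R => z.1 - z.2) : T3 * T3 -> T3).
Proof.
apply/measurable_fun_pairP; split => /=; first apply/measurable_fun_pairP; first split => /=.
- apply: measurable_funB; apply: (measurableT_comp measurable_fst); apply: (measurableT_comp measurable_fst) => //.
- apply: measurable_funB; apply: (measurableT_comp measurable_snd); apply: (measurableT_comp measurable_fst) => //.
- apply: measurable_funB; apply: (measurableT_comp measurable_snd) => //.
Qed.

Lemma measurable_sqn3_sub33 : measurable_fun [set: T3 * T3] ((fun z : space3 R * space3 R => sqn3 (z.1 - z.2)) : T3 * T3 -> R).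
Proof. exact: (measurableT_comp measurable_sqn3 measurable_sub33). Qed.

Lemma core_tail_ge0 (K e s : R) : 0 <= K -> 0 <= 3 * core e s + K * tail e s.
Proof. by move=> K0; rewrite addr_ge0// mulr_ge0// ?core_ge0 ?tail_ge0. Qed.

Section Weighted.
Variables (r L : R) (eta : space3 R -> R).
Hypotheses (etaP : cutoff r L eta).

(** On the support |x| <= r, so the triangle inequality turns decay in |x - y| into decay in |y|. *)
Lemma cutoff_decay (c : R) x y : 0 < c ->
  eta x * expR (- (c * norm3 (x - y))) <= expR (c * r) * expR (- (c * norm3 y)).
Proof.
case: etaP => _ e0 e1 er _ c0; have [h|h] := leP (norm3 x) r; last first.
  by rewrite er// mul0r mulr_ge0 ?expR_ge0.
apply: (@le_trans _ _ (expR (- (c * norm3 (x - y))))); first by rewrite ler_piMl ?expR_ge0.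
rewrite -expRD ler_expR; have h1 := ler_norm3_dist x y.
have : 0 <= c * (r + norm3 (x - y) - norm3 y) by rewrite mulr_ge0 ?(ltW c0)//; lra.
by rewrite mulrBr mulrDr; lra.
Qed.

Variables (c : R) (k : R -> R -> R).
Hypotheses (mk : forall e, measurable_fun [set: R] (k e)) (kP : mollifying c k).

(** The bound does not depend on e: it justifies Fubini's theorem and gives the majorant for the
    limit e -> 0. *)
Lemma cutoff_kernel_decay : exists C, exists2 a : R, 0 < a & forall e y, 0 < e -> e <= 1 ->
  (\int[lebesgue3]_x (eta x * `|k e (sqn3 (x - y))|)%:E <= (C * expR (- (a * norm3 (0 - y))))%:E)%E.
Proof.
have [K [a a0 kK]] := kP; have [me e0 e1 er _] := etaP.
have K0 : 0 <= K.
  have := le_trans (normr_ge0 _) (kK 1 0 ltr01 (lexx _)).2.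
  by rewrite /tail pmulr_lge0// addr0 expr1n mul1r invr_gt0 exprn_gt0.
(* The first 4 pi is 3 times the mass 4 pi / 3 of [core]; the second bounds the mass 4 pi e of
   [tail], as e <= 1. *)
exists (expR (a * r) * (4 * pi + K * (4 * pi))); exists a => // e y e0' e1'.
rewrite sub0r norm3N.
pose A := expR (a * r) * expR (- (a * norm3 y)).
have A0 : 0 <= A by rewrite mulr_ge0 ?expR_ge0.
have mc : measurable_fun [set: T3] ((fun x : space3 R => core e (sqn3 (x - y))) : T3 -> R).
  exact: (measurableT_comp (measurable_core e) (measurable_sqn3_subr y)).
have mt : measurable_fun [set: T3] ((fun x : space3 R => tail e (sqn3 (x - y))) : T3 -> R).
  exact: (measurableT_comp (measurable_tail e) (measurable_sqn3_subr y)).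
apply: (@le_trans _ _ (\int[lebesgue3]_x (A * (3 * core e (sqn3 (x - y)) + K * tail e (sqn3 (x - y))))%:E)%E).
  apply: ge0_le_integral => //.
  - by move=> x _; rewrite lee_fin mulr_ge0.
  - apply/measurable_EFinP; apply: measurable_funM => //; apply: measurableT_comp => //.
    exact: (measurableT_comp (mk e) (measurable_sqn3_subr y)).
  - apply/measurable_EFinP; apply: measurable_funM => //.
    by apply: measurable_funD; apply: measurable_funM.
  - move=> x _; rewrite lee_fin.
    apply: (@le_trans _ _ (eta x * expR (- (a * norm3 (x - y))) * (3 * core e (sqn3 (x - y)) + K * tail e (sqn3 (x - y))))).
      by rewrite -mulrA ler_wpM2l//; exact: (kK e _ e0' (sqn3_ge0 _)).1.
    apply: ler_wpM2r; last exact: cutoff_decay.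
    exact: core_tail_ge0.
rewrite ge0_integralRZl//; last 2 first.
- by apply: measurable_funD; apply: measurable_funM.
- by move=> x; exact: core_tail_ge0.
rewrite (_ : _ * _ * expR _ = A * (4 * pi + K * (4 * pi))); last by rewrite /A; ring.
rewrite [leRHS]EFinM; apply: lee_wpmul2l; first by rewrite lee_fin.
under eq_integral do rewrite EFinD.
rewrite ge0_integralD//; first last.
- by apply/measurable_EFinP; apply: measurable_funM.
- by move=> x _; rewrite lee_fin mulr_ge0 ?tail_ge0.
- by apply/measurable_EFinP; apply: measurable_funM.
- by move=> x _; rewrite lee_fin mulr_ge0 ?core_ge0.
have t3 : (0 : R) <= 3 by [].
rewrite (ge0_integralRZl lebesgue3 t3 mc (fun x => core_ge0 _ _)) (ge0_integralRZl lebesgue3 K0 mt (fun x => tail_ge0 _ _)).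
rewrite integral_core// [leRHS]EFinD; apply: leeD.
  by rewrite -EFinM lee_fin le_eqVlt; apply/orP; left; apply/eqP; field.
rewrite [leRHS]EFinM; apply: lee_wpmul2l; first by rewrite lee_fin.
apply: (le_trans (integral_tail y e0')).
by rewrite lee_fin ler_piMr// mulr_ge0// pi_ge0.
Qed.

Lemma measurable_cutoff_kernel e y : measurable_fun [set: T3] ((fun x : space3 R => eta x * k e (sqn3 (x - y))) : T3 -> R).
Proof.
have [me _ _ _ _] := etaP; apply: measurable_funM => //.
exact: (measurableT_comp (mk e) (measurable_sqn3_subr y)).
Qed.

(** Two errors, both a multiple of the mass of [tail]: the kernel against 3 c [core], and eta x
    against eta y, by the Lipschitz bound. *)
Lemma cutoff_kernel_cvg : exists C : R, forall e y, 0 < e -> e <= 1 ->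
  `|\int[lebesgue3]_x (eta x * k e (sqn3 (x - y))) - 4 * pi * c * eta y| <= C * e.
Proof.
have [K [a a0 kK]] := kP; have [me e0 e1 er eL] := etaP.
exists ((K + 3 * `|c| * L) * (4 * pi)) => e y e0' e1'.
have K0 : 0 <= K.
  have := le_trans (normr_ge0 _) (kK 1 0 ltr01 (lexx _)).2.
  by rewrite /tail pmulr_lge0// addr0 expr1n mul1r invr_gt0 exprn_gt0.
(* The Lipschitz inequality between (1, 0, 0) and 0, read in both directions, gives 2 L >= 0. *)
have L0 : 0 <= L.
  have := eL (1, 0, 0) (0 : space3 R); have := eL (0 : space3 R) (1, 0, 0).
  rewrite norm3B; have -> : norm3 ((1, 0, 0) - 0 : space3 R) = 1; last by lra.
  by rewrite subr0 /norm3 /= expr0n /= expr1n !addr0 sqrtr1.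
have ic := core_integrable y e0'; have it := tail_integrable y e0'.
have mc : measurable_fun [set: T3] ((fun x : space3 R => core e (sqn3 (x - y))) : T3 -> R).
  exact: (measurableT_comp (measurable_core e) (measurable_sqn3_subr y)).
have i1 : lebesgue3.-integrable setT (EFin \o (fun x : space3 R => eta x * k e (sqn3 (x - y)))).
  apply: (le_integrable measurableT _ _ (integrableD_real (integrableZl_real 3 ic) (integrableZl_real K it))).
    by apply/measurable_EFinP; exact: measurable_cutoff_kernel.
  move=> x _ /=; rewrite lee_fin normrM (ger0_norm (e0 x)).
  have [h _] := kK e _ e0' (sqn3_ge0 (x - y)).
  apply: (le_trans _ (ler_norm _)); apply: (le_trans (ler_piMl (normr_ge0 _) (e1 x))).
  apply: (le_trans h); apply: ler_piMl; first exact: core_tail_ge0.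
  by rewrite expR_le1 oppr_le0 mulr_ge0 ?sqrtr_ge0 ?(ltW a0).
have i2 := integrableZl_real (3 * c * eta y) ic.
have E : 4 * pi * c * eta y = \int[lebesgue3]_x (3 * c * eta y * core e (sqn3 (x - y))).
  by rewrite RintegralZl// Rintegral_core//; field.
rewrite {}E -RintegralB//.
apply: (@le_trans _ _ (\int[lebesgue3]_x ((K + 3 * `|c| * L) * tail e (sqn3 (x - y))))); last first.
  rewrite RintegralZl// -[leRHS]mulrA; apply: ler_wpM2l; last exact: Rintegral_tail.
  by rewrite addr_ge0// mulr_ge0// mulr_ge0.
apply: Rintegral_le.
- apply: measurable_funB; first exact: measurable_cutoff_kernel.
  exact: measurable_funM.
- exact: integrableZl_real.
move=> x; have [_ h] := kK e _ e0' (sqn3_ge0 (x - y)).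
rewrite (_ : _ - _ = eta x * (k e (sqn3 (x - y)) - 3 * c * core e (sqn3 (x - y))) + 3 * c * ((eta x - eta y) * core e (sqn3 (x - y)))); last by ring.
apply: (le_trans (ler_normD _ _)); rewrite [leRHS]mulrDl; apply: lerD.
  rewrite normrM (ger0_norm (e0 x)); apply: le_trans h.
  by rewrite ler_piMl.
rewrite normrM normrM (ger0_norm (_ : 0 <= 3))// -mulrA -[leRHS]mulrA -[leRHS]mulrA.
apply: ler_wpM2l => //; apply: ler_wpM2l => //.
rewrite normrM (ger0_norm (core_ge0 _ _)) -core_tail ?sqn3_ge0//.
apply: (@le_trans _ _ (L * norm3 (x - y) * core e (sqn3 (x - y)))).
  apply: ler_wpM2r; first exact: core_ge0.
  rewrite ler_norml; apply/andP; split.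
    by rewrite lerNl opprB lerBlDl (le_trans (eL y x))// norm3B.
  by rewrite lerBlDl.
rewrite -mulrA ler_wpM2l// mulrC ler_wpM2l ?core_ge0//.
by rewrite norm3E ler_wsqrtr// lerDl sqr_ge0.
Qed.

Lemma cutoff_kernel_integrable e y : 0 < e -> e <= 1 ->
  lebesgue3.-integrable setT (EFin \o (fun x : space3 R => eta x * k e (sqn3 (x - y)))).
Proof.
move=> e0 e1; have [C [a a0 CE]] := cutoff_kernel_decay; have [_ h0 _ _ _] := etaP.
apply/integrableP; split; first by apply/measurable_EFinP; exact: measurable_cutoff_kernel.
apply: (@le_lt_trans _ _ (C * expR (- (a * norm3 (0 - y))))%:E); last exact: ltry.
apply: le_trans (CE e y e0 e1); rewrite le_eqVlt; apply/orP; left; apply/eqP.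
by apply: eq_integral => x _; rewrite /= normrM (ger0_norm (h0 x)).
Qed.

Variables (p : R) (v : space3 R -> R).
Hypotheses (p1 : 1 < p) (vL : Lp_real p v).

Let F e (z : space3 R * space3 R) : R := eta z.1 * (v z.2 * k e (sqn3 (z.1 - z.2))).

Lemma measurable_mollify_integrand e : measurable_fun [set: T3 * T3] (F e : T3 * T3 -> R).
Proof.
have [me _ _ _ _] := etaP; apply: measurable_funM; first exact: (measurableT_comp me measurable_fst).
apply: measurable_funM; first exact: (measurableT_comp (Lp_real_measurable vL) measurable_snd).
exact: (measurableT_comp (mk e) measurable_sqn3_sub33).
Qed.

Lemma mollify_integrable e : 0 < e -> e <= 1 ->
  (\int[lebesgue3]_x \int[lebesgue3]_y `|F e (x, y)|%:E < +oo)%E.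
Proof.
move=> e0 e1; have [C [a a0 CE]] := cutoff_kernel_decay; have [me h0 _ _ _] := etaP.
have mF : measurable_fun [set: T3 * T3] ((fun z : T3 * T3 => `|F e z|%:E) : T3 * T3 -> \bar R).
  by apply/measurable_EFinP; apply: measurableT_comp => //; exact: measurable_mollify_integrand.
have T := @fubini_tonelli _ _ T3 T3 R leb3 leb3 _ mF (fun z => normr_ge0 _).
rewrite [X in (X < _)%E]T.
apply: (@le_lt_trans _ _ (\int[lebesgue3]_y (C * (expR (- (a * norm3 (0 - y))) * cabs (v y)%:C))%:E)%E).
  have mvw : measurable_fun [set: T3] ((fun y : space3 R => C * (expR (- (a * norm3 (0 - y))) * cabs (v y)%:C)) : T3 -> R).
    apply: measurable_funM; first exact: measurable_cst.
    apply: measurable_funM; first exact: measurable_expw.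
    exact: measurable_cabs vL.1.
  apply: ge0_le_integral3.
  - exact: (measurable_fun_fubini_tonelli_G _ mF).
  - exact/measurable_EFinP.
  - by move=> y; apply: integral_ge0 => x _; rewrite lee_fin.
  - move=> y; rewrite cabs_real.
    have -> : (\int[leb3]_x `|F e (x, y)|%:E = `|v y|%:E * \int[lebesgue3]_x (eta x * `|k e (sqn3 (x - y))|)%:E)%E.
      have mek : measurable_fun [set: T3] ((fun x : space3 R => eta x * `|k e (sqn3 (x - y))|) : T3 -> R).
        apply: (measurable_funM me); apply: (measurableT_comp (@normr_measurable R setT)).
        exact: (measurableT_comp (mk e) (measurable_sqn3_subr y)).
      rewrite -(ge0_integralRZl lebesgue3 (normr_ge0 (v y)) mek (fun x => mulr_ge0 (h0 x) (normr_ge0 _))).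
      by apply: eq_integral => x _; rewrite /F /= normrM normrM (ger0_norm (h0 x)); congr EFin; ring.
    apply: (@le_trans _ _ (`|v y|%:E * (C * expR (- (a * norm3 (0 - y))))%:E)%E).
      by apply: lee_wpmul2l; [rewrite lee_fin|exact: CE].
    by rewrite -EFinM lee_fin mulrC mulrA.
have C0 : 0 <= C.
  have h := CE e 0 e0 e1.
  have : (0 <= (C * expR (- (a * norm3 (0 - (0 : space3 R)))))%:E)%E.
    by apply: le_trans h; apply: integral_ge0 => x _; rewrite lee_fin mulr_ge0.
  by rewrite lee_fin (pmulr_lge0 _ (expR_gt0 _)).
have mE : measurable_fun [set: T3] ((fun y : space3 R => expR (- (a * norm3 (0 - y))) * cabs (v y)%:C) : T3 -> R).
  by apply: measurable_funM; [exact: measurable_expw|exact: measurable_cabs vL.1].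
rewrite (ge0_integralRZl lebesgue3 C0 mE (fun y => mulr_ge0 (expR_ge0 _) (cabs_ge0 _))).
by apply: lte_mul_pinfty; [rewrite lee_fin|by []|exact: (Lp_weight_lty 0 p1 a0 vL)].
Qed.

(** As v is merely in L_p, Fubini's theorem moves the approximate identity onto the Lipschitz
    function eta, where convergence is pointwise and dominated. *)
Lemma mollify_cvg (e_ : nat -> R) : (forall n, 0 < e_ n) -> (forall n, e_ n <= 1) ->
  e_ n @[n --> \oo] --> 0 ->
  \int[lebesgue3]_x \int[lebesgue3]_y (eta x * (v y * k (e_ n) (sqn3 (x - y)))) @[n --> \oo] -->
  4 * pi * c * \int[lebesgue3]_y (v y * eta y).
Proof.
move=> e0 e1 ecvg; have [C [a a0 CE]] := cutoff_kernel_decay; have [me h0 h1 _ _] := etaP.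
have [C' C'E] := cutoff_kernel_cvg.
pose J n (y : space3 R) := \int[lebesgue3]_x (eta x * k (e_ n) (sqn3 (x - y))).
have JE n : \int[lebesgue3]_x \int[lebesgue3]_y (eta x * (v y * k (e_ n) (sqn3 (x - y)))) = \int[lebesgue3]_y (v y * J n y).
  have := @Rintegral_Fubini _ _ T3 T3 R leb3 leb3 (F (e_ n)) (measurable_mollify_integrand (e_ n)) (mollify_integrable (e0 n) (e1 n)).
  rewrite /F /= => h; rewrite [LHS]h; apply: eq_Rintegral => y _.
  have ik := cutoff_kernel_integrable y (e0 n) (e1 n).
  rewrite -(RintegralZl (v y) measurableT ik); apply: eq_Rintegral => x _; ring.
rewrite (funext JE).
have mJ n : measurable_fun [set: T3] (J n : T3 -> R).
  have mG : measurable_fun [set: T3 * T3] ((fun z : space3 R * space3 R => eta z.1 * k (e_ n) (sqn3 (z.1 - z.2))) : T3 * T3 -> R).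
    apply: measurable_funM; first exact: (measurableT_comp me measurable_fst).
    exact: (measurableT_comp (mk (e_ n)) measurable_sqn3_sub33).
  exact: (@measurable_Rintegral2 _ _ T3 T3 R leb3 _ mG).
have JC n y : `|J n y| <= C * expR (- (a * norm3 (0 - y))).
  have ik := cutoff_kernel_integrable y (e0 n) (e1 n).
  apply: (le_trans (le_normr_Rintegral measurableT ik)).
  rewrite -lee_fin /Rintegral fineK; last exact: integral_fune_fin_num (integrable_norm ik).
  apply: le_trans (CE _ y (e0 n) (e1 n)); rewrite le_eqVlt; apply/orP; left; apply/eqP.
  by apply: eq_integral => x _; rewrite normrM (ger0_norm (h0 x)).
have mv := Lp_real_measurable vL.
have mE : measurable_fun [set: T3] ((fun y : space3 R => C * expR (- (a * norm3 (0 - y)))) : T3 -> R).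
  by apply: measurable_funM; [exact: measurable_cst|exact: measurable_expw].
have bE y : `|C * expR (- (a * norm3 (0 - y)))| <= `|C| * expR (- (a * norm3 (0 - y))).
  by rewrite normrM (ger0_norm (expR_ge0 _)).
have vn : Lp_real p (fun y => `|v y|).
  apply: (Lp_real_le p1 vL); first exact: measurableT_comp.
  by move=> y; rewrite cabs_real normr_id.
have ig := Lp_real_integrable p1 a0 vn mE bE.
have -> : 4 * pi * c * \int[lebesgue3]_y (v y * eta y) = \int[lebesgue3]_y (v y * (4 * pi * c * eta y)).
  have ive : lebesgue3.-integrable setT (EFin \o (fun y => v y * eta y)).
    apply: (Lp_real_integrable (c := 1) (K := expR (1 * r)) (x0 := 0) p1 ltr01 vL me) => y.
    have := cutoff_decay y y ltr01; rewrite subrr sub0r norm3N.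
    have -> : norm3 (0 : space3 R) = 0 by rewrite /norm3 /= expr0n /= !addr0 sqrtr0.
    by rewrite mulr0 oppr0 expR0 mulr1 ger0_norm.
  by rewrite -RintegralZl//; apply: eq_Rintegral => y _; ring.
apply: (Rintegral_dominated _ _ ig).
- by move=> n; exact: measurable_funM.
- by apply: measurable_funM => //; apply: measurable_funM.
- by move=> n y; rewrite normrM ler_wpM2l.
move=> y; apply: cvgM; first exact: cvg_cst.
apply/cvgrPdist_le => d d0.
have /cvgrPdist_le /(_ (d / (`|C'| + 1))) : e_ n @[n --> \oo] --> (0 : R) by [].
have C1 : 0 < `|C'| + 1 by rewrite ltr_wpDl.
move=> /(_ (divr_gt0 d0 C1)) [N _ HN]; exists N => // n /HN /=.
rewrite sub0r normrN ger0_norm ?(ltW (e0 n))// ler_pdivlMr// => hn.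
rewrite distrC; apply: (le_trans (C'E _ y (e0 n) (e1 n))).
apply: le_trans hn; rewrite mulrC ler_wpM2l ?(ltW (e0 n))//.
by rewrite (le_trans (ler_norm _))// lerDl.
Qed.

End Weighted.
End Mollify.

Section DominatedAe.
Context d (T : measurableType d) (R : realType) (m : {measure set T -> \bar R}).

Lemma Rintegral_dominated_ae (f_ : nat -> T -> R) (f g : T -> R) :
  (forall n, measurable_fun setT (f_ n)) -> measurable_fun setT f ->
  m.-integrable setT (EFin \o g) ->
  {ae m, forall x, forall n, `|f_ n x| <= g x} -> {ae m, forall x, f_ n x @[n --> \oo] --> f x} ->
  m.-integrable setT (EFin \o f) /\ (\int[m]_x f_ n x) @[n --> \oo] --> \int[m]_x f x.
Proof.
move=> mf_ mf ig fg cf.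
have [iff _ h] : [/\ m.-integrable setT (EFin \o f),
    (\int[m]_x `|(f_ n x)%:E - (f x)%:E|)%E @[n --> \oo] --> (0 : \bar R) &
    (\int[m]_x (f_ n x)%:E)%E @[n --> \oo] --> (\int[m]_x (f x)%:E)%E].
  apply: (dominated_convergence _ _ _ _ ig) => //.
  - by move=> n; apply/measurable_EFinP.
  - exact/measurable_EFinP.
  - by apply: aeS cf => x cx _; apply: cvg_EFin; [exact: nearW|exact: cx].
  - by apply: aeS fg => x fx n _; rewrite lee_fin.
split => //; apply: fine_cvg.
by rewrite fineK//; exact: integral_fune_fin_num.
Qed.

End DominatedAe.

(** * The Green representation *)

Section Yukawa.
Context {R : realType}.
Notation T3 := (measurableTypeR R * measurableTypeR R * measurableTypeR R)%type.
Implicit Types (x y : space3 R).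

Lemma lebesgue3_set1 (x : space3 R) : lebesgue3 [set x] = 0%E.
Proof.
have -> : [set x] = [set x.1] `*` [set x.2].
  by apply/seteqP; split=> -[a b] /=; [move=> <-|case: x => x1 x2 /= [-> ->]].
have m1 : measurable ([set x.1] : set (measurableTypeR R * measurableTypeR R)).
  have -> : [set x.1] = [set x.1.1] `*` [set x.1.2].
    by apply/seteqP; split=> -[a b] /=; [move=> <-|case: (x.1) => x1 x2 /= [-> ->]].
  by apply: measurableX.
have m2 : measurable ([set x.2] : set (measurableTypeR R)) by exact: measurable_set1.
have := product_measure1E leb2 (@lebesgue_measure R) m1 m2.
rewrite [X in _ = (_ * X)%E -> _](@lebesgue_measure_set1 R x.2) mule0; exact.
Qed.

(** Needed because the kernel bounds below are claimed off the diagonal only. *)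
Lemma ae_neq (x : space3 R) : {ae lebesgue3, forall y, y <> x}.
Proof.
exists [set x]; split.
- have -> : [set x] = [set x.1.1] `*` [set x.1.2] `*` [set x.2].
    by apply/seteqP; split=> -[[a b] c] /=; [move=> <-|case: x => -[x1 x2] x3 /= [[-> ->] ->]].
  by apply: measurableX => //; exact: measurableX.
- exact: lebesgue3_set1.
- by move=> y /=; apply: contra_notP.
Qed.

(** The argument s is a squared distance. Division by zero gives [yuk c 0 = 0], so this function
    dominates the regularised kernels only for s > 0. *)
Definition yuk (c s : R) : R := expR (- (c * Num.sqrt s)) / Num.sqrt s.

Lemma yuk_ge0 c s : 0 <= yuk c s.
Proof. by rewrite /yuk divr_ge0 ?expR_ge0 ?sqrtr_ge0. Qed.

Lemma measurable_yuk c : measurable_fun [set: R] (yuk c).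
Proof.
apply: measurable_funM; last exact: (measurableT_comp measurable_invr measurable_sqrt).
apply: (measurableT_comp (@measurable_expR R)); apply: measurableT_comp => //.
by apply: measurable_funM => //; exact: measurable_sqrt.
Qed.

Lemma integral_yuk_lty c y : 0 < c -> (\int[lebesgue3]_x (yuk c (sqn3 (x - y)))%:E < +oo)%E.
Proof.
move=> c0; rewrite (ge0_integral_radial _ (measurable_yuk c) (yuk_ge0 c)).
have pi0 := @pi_gt0 R.
have pi4 : (0 : R) <= 4 * pi by rewrite mulr_ge0 ?ltW.
have mf : measurable_fun [set: T3] ((fun x : space3 R => (expR (- (c * norm3 x)) / (4 * pi * norm3 x)) `^ 1) : T3 -> R).
  apply: (@measurableT_comp _ _ _ _ _ _ (fun y : R => y `^ 1)) => //.
  apply: measurable_funM.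
    apply: (measurableT_comp (@measurable_expR R)); apply: measurableT_comp => //.
    by apply: measurable_funM => //; exact: measurable_norm3.
  apply: (measurableT_comp measurable_invr); apply: measurable_funM => //; exact: measurable_norm3.
have := yukawa_integral c0 (@ltr01 R) (_ : 1 < 3); rewrite ltr1n => /(_ isT) h.
have -> : (\int[lebesgue3]_x (yuk c (sqn3 x))%:E = (4 * pi)%:E *
   \int[lebesgue3]_x ((expR (- (c * norm3 x)) / (4 * pi * norm3 x)) `^ 1)%:E)%E.
  rewrite -(ge0_integralRZl lebesgue3 pi4 mf (fun x => powR_ge0 _ _)).
  apply: eq_integral => x _; rewrite powRr1; last first.
    by rewrite divr_ge0 ?expR_ge0// mulr_ge0 ?norm3_ge0.
  congr EFin; rewrite /yuk -norm3E invfM; move: (norm3 x)^-1 => N.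
  by have := pi0; move: pi => P P0; field; rewrite gt_eqF.
by rewrite h -EFinM ltry.
Qed.

Definition potential (c : R) (w : space3 R -> R) (x : space3 R) : \bar R :=
  (\int[lebesgue3]_y (yuk c (sqn3 (x - y)) * w y)%:E)%E.

Lemma measurable_potential c (w : space3 R -> R) : measurable_fun [set: T3] (w : T3 -> R) ->
  (forall y, 0 <= w y) -> measurable_fun [set: T3] (potential c w : T3 -> \bar R).
Proof.
move=> mw w0.
have mF : measurable_fun [set: T3 * T3] ((fun z : space3 R * space3 R => (yuk c (sqn3 (z.1 - z.2)) * w z.2)%:E) : T3 * T3 -> \bar R).
  apply/measurable_EFinP; apply: measurable_funM; last exact: (measurableT_comp mw measurable_snd).
  exact: (measurableT_comp (measurable_yuk c) measurable_sqn3_sub33).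
apply: (@measurable_fun_fubini_tonelli_F _ _ T3 T3 R leb3 _ mF) => z.
by rewrite lee_fin mulr_ge0 ?yuk_ge0.
Qed.

Lemma potential_ge0 c w x : (forall y, 0 <= w y) -> (0 <= potential c w x)%E.
Proof. by move=> w0; apply: integral_ge0 => y _; rewrite lee_fin mulr_ge0 ?yuk_ge0. Qed.

(** Half of the rate c is turned into decay in |y| by means of the bounded support of eta, which
    makes w integrable; the other half keeps the kernel integrable in x. *)
Lemma cutoff_potential_lty (p r L c : R) (eta w : space3 R -> R) : 1 < p -> 0 < c ->
  cutoff r L eta -> Lp_real p w -> (forall y, 0 <= w y) ->
  (\int[lebesgue3]_x ((eta x)%:E * potential c w x) < +oo)%E.
Proof.
move=> p1 c0 etaP wL w0; have [me h0 _ _ _] := etaP.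
have mw := Lp_real_measurable wL.
have mF : measurable_fun [set: T3 * T3] ((fun z : space3 R * space3 R => (eta z.1 * (yuk c (sqn3 (z.1 - z.2)) * w z.2))%:E) : T3 * T3 -> \bar R).
  apply/measurable_EFinP; apply: measurable_funM; first exact: (measurableT_comp me measurable_fst).
  apply: measurable_funM; last exact: (measurableT_comp mw measurable_snd).
  exact: (measurableT_comp (measurable_yuk c) measurable_sqn3_sub33).
have F0 (z : space3 R * space3 R) : (0 <= (eta z.1 * (yuk c (sqn3 (z.1 - z.2)) * w z.2))%:E)%E.
  by rewrite lee_fin mulr_ge0// mulr_ge0 ?yuk_ge0.
have T := @fubini_tonelli _ _ T3 T3 R leb3 leb3 _ mF F0.
have mYw x : measurable_fun [set: T3] ((fun y : space3 R => yuk c (sqn3 (x - y)) * w y) : T3 -> R).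
  apply: (measurable_funM _ mw); exact: (measurableT_comp (measurable_yuk c) (measurable_sqn3_subl x)).
have -> : (\int[lebesgue3]_x ((eta x)%:E * potential c w x) =
   \int[lebesgue3]_x \int[lebesgue3]_y (eta x * (yuk c (sqn3 (x - y)) * w y))%:E)%E.
  apply: eq_integral => x _.
  exact: (esym (ge0_integralRZl lebesgue3 (h0 x) (mYw x) (fun y => mulr_ge0 (yuk_ge0 _ _) (w0 y)))).
rewrite [X in (X < _)%E]T.
have c2 : 0 < c / 2 by rewrite divr_gt0.
pose I := (\int[lebesgue3]_x (yuk (c / 2) (sqn3 x))%:E)%E.
have IE y : (\int[lebesgue3]_x (yuk (c / 2) (sqn3 (x - y)))%:E = I)%E.
  exact: (ge0_integral_radial _ (measurable_yuk _) (yuk_ge0 _)).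
have If : I \is a fin_num.
  rewrite ge0_fin_numE; last by apply: integral_ge0 => x _; rewrite lee_fin yuk_ge0.
  by rewrite -(IE 0); exact: integral_yuk_lty.
have I0 : 0 <= fine I by apply: fine_ge0; apply: integral_ge0 => x _; rewrite lee_fin yuk_ge0.
have mE : measurable_fun [set: T3] ((fun y : space3 R => expR (- (c / 2 * norm3 (0 - y))) * cabs (w y)%:C) : T3 -> R).
  by apply: measurable_funM; [exact: measurable_expw|exact: measurable_cabs wL.1].
have K0 : 0 <= expR (c / 2 * r) * fine I by rewrite mulr_ge0 ?expR_ge0.
apply: (@le_lt_trans _ _ (\int[lebesgue3]_y (expR (c / 2 * r) * fine I * (expR (- (c / 2 * norm3 (0 - y))) * cabs (w y)%:C))%:E)%E).
  apply: ge0_le_integral3.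
  - exact: (measurable_fun_fubini_tonelli_G _ mF).
  - by apply/measurable_EFinP; apply: measurable_funM.
  - by move=> y; apply: integral_ge0 => x _; exact: F0.
  move=> y; rewrite cabs_real (ger0_norm (w0 y)) sub0r norm3N.
  pose A := expR (c / 2 * r) * expR (- (c / 2 * norm3 y)) * w y.
  have A0 : 0 <= A by rewrite mulr_ge0// mulr_ge0 ?expR_ge0.
  have my : measurable_fun [set: T3] ((fun x : space3 R => yuk (c / 2) (sqn3 (x - y))) : T3 -> R).
    exact: (measurableT_comp (measurable_yuk _) (measurable_sqn3_subr y)).
  apply: (@le_trans _ _ (\int[lebesgue3]_x (A * yuk (c / 2) (sqn3 (x - y)))%:E)%E).
    apply: ge0_le_integral3.
    - exact: (measurableT_comp mF (measurable_pair2 _)).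
    - by apply/measurable_EFinP; apply: measurable_funM.
    - by move=> x; exact: F0.
    move=> x /=; rewrite lee_fin /yuk -norm3E.
    have h := cutoff_decay etaP x y c2.
    rewrite [leLHS](_ : _ = (eta x * expR (- (c / 2 * norm3 (x - y)))) * (expR (- (c / 2 * norm3 (x - y))) / norm3 (x - y) * w y)).
      rewrite [leRHS](_ : _ = (expR (c / 2 * r) * expR (- (c / 2 * norm3 y))) * (expR (- (c / 2 * norm3 (x - y))) / norm3 (x - y) * w y)); last by rewrite /A; ring.
      by apply: ler_wpM2r; [rewrite mulr_ge0 ?divr_ge0 ?expR_ge0 ?norm3_ge0|exact: h].
    have -> : expR (- (c * norm3 (x - y))) = expR (- (c / 2 * norm3 (x - y))) * expR (- (c / 2 * norm3 (x - y))).
      by rewrite -expRD; congr expR; field.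
    by ring.
  rewrite (ge0_integralRZl lebesgue3 A0 my (fun x => yuk_ge0 _ _)) IE -(fineK If) -EFinM lee_fin.
  by rewrite le_eqVlt; apply/orP; left; apply/eqP; rewrite /A; ring.
rewrite (ge0_integralRZl lebesgue3 K0 mE (fun y => mulr_ge0 (expR_ge0 _) (cabs_ge0 _))).
by apply: lte_mul_pinfty; [rewrite lee_fin|by []|exact: (Lp_weight_lty 0 p1 c2 wL)].
Qed.

Lemma sqn3_sub_gt0 x y : y <> x -> 0 < sqn3 (x - y).
Proof.
move=> yx; rewrite lt_neqAle sqn3_ge0 andbT eq_sym; apply/eqP => /eqP.
rewrite /sqn3 !paddr_eq0 ?addr_ge0 ?sqr_ge0// !sqrf_eq0 !subr_eq0.
by move: x y yx => [[a b] c] [[a' b'] c'] yx /= /andP[/andP[/eqP E1 /eqP E2] /eqP E3]; apply: yx; rewrite E1 E2 E3.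
Qed.

End Yukawa.

Section Representation.
Context {R : realType}.
Notation T3 := (measurableTypeR R * measurableTypeR R * measurableTypeR R)%type.
Variables (kap sig p : R).
Hypotheses (kap0 : 0 < kap) (p1 : 1 < p).
Variables (u1 u2 f1 f2 : space3 R -> R).
Hypothesis uf : helmholtz_pair kap sig p u1 u2 f1 f2.

Lemma Lnorm_normr d (T : measurableType d) (m : {measure set T -> \bar R}) (f : T -> R) :
  Lnorm m p%:E (EFin \o (fun x => `|f x|)) = Lnorm m p%:E (EFin \o f).
Proof. by rewrite !Lnorm_realE; under eq_integral do rewrite normr_id. Qed.

Lemma Lp_norm_real (v : space3 R -> R) : Lp_norm p (fun y => (v y)%:C) = Lnorm lebesgue3 p%:E (EFin \o (v : T3 -> R)).
Proof.
rewrite -(Lnorm_normr lebesgue3 (v : T3 -> R)) /Lp_norm.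
by rewrite (_ : (fun y => (cabs (v y)%:C)%:E) = EFin \o (fun y => `|v y|))//; apply/funext => y; rewrite cabs_real.
Qed.

Lemma Lp_realD (v w : space3 R -> R) : Lp_real p v -> Lp_real p w -> Lp_real p (fun y => v y + w y).
Proof.
move=> vL wL; have mv := Lp_real_measurable vL; have mw := Lp_real_measurable wL.
split; first by split => /=; [exact: measurable_funD mv mw|exact: measurable_cst].
rewrite Lp_norm_real.
apply: (le_lt_trans (minkowski_EFin lebesgue3 mv mw (ltW p1))).
by rewrite -!Lp_norm_real; apply: lte_add_pinfty; [exact: vL.2|exact: wL.2].
Qed.

Lemma Lp_real_norm (v : space3 R -> R) : Lp_real p v -> Lp_real p (fun y => `|v y|).
Proof.
move=> vL; apply: (Lp_real_le p1 vL); first by apply: measurableT_comp => //; exact: Lp_real_measurable vL.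
by move=> y; rewrite cabs_real normr_id.
Qed.

Let u1L : Lp_real p u1. Proof. by have [] := uf. Qed.
Let u2L : Lp_real p u2. Proof. by have [] := uf. Qed.
Let f1L : Lp_real p f1. Proof. by have [] := uf. Qed.
Let f2L : Lp_real p f2. Proof. by have [] := uf. Qed.

Definition green (e : R) (x y : space3 R) : R :=
  f1 y * kerC kap sig e (sqn3 (x - y)) - f2 y * kerS kap sig e (sqn3 (x - y)).

Definition green_rep (e : R) (x : space3 R) : R := \int[lebesgue3]_y green e x y.

Let w y : R := `|f1 y| + `|f2 y|.

Let mw : measurable_fun [set: T3] (w : T3 -> R).
Proof.
by apply: measurable_funD; apply: measurableT_comp => //; [exact: Lp_real_measurable f1L|exact: Lp_real_measurable f2L].
Qed.

Let w0 y : 0 <= w y. Proof. by rewrite addr_ge0. Qed.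

(** Regularisation only enlarges rho, so the unregularised kernel is a majorant uniform in e. *)
Lemma ker_le_yuk (a b e s : R) : `|a| + `|b| <= 1 -> 0 < s -> `|radw0 e kap sig a b s| <= yuk kap s.
Proof.
move=> ab s0; apply: (le_trans (wave_bound _ _ _ _ _ _)); rewrite /yuk mulrC.
have le : Num.sqrt s <= Num.sqrt (s + e ^+ 2) by rewrite ler_wsqrtr// lerDl sqr_ge0.
have q0 : 0 < Num.sqrt s by rewrite sqrtr_gt0.
have q1 : 0 < Num.sqrt (s + e ^+ 2) by exact: lt_le_trans le.
apply: ler_pM; rewrite ?expR_ge0//.
  by rewrite ler_expR lerN2 ler_wpM2l// ltW.
rewrite expr1; apply: (@le_trans _ _ (1 / Num.sqrt (s + e ^+ 2))).
  by rewrite ler_wpM2r// invr_ge0 ltW.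
by rewrite mul1r lef_pV2 ?posrE.
Qed.

Lemma green_le e x y : y <> x -> `|green e x y| <= yuk kap (sqn3 (x - y)) * w y.
Proof.
move=> yx; have s0 := sqn3_sub_gt0 yx.
rewrite /green /w mulrDr; apply: (le_trans (ler_normB _ _)).
apply: lerD; rewrite normrM mulrC; apply: ler_wpM2r => //; apply: ker_le_yuk => //.
  by rewrite normr0 addr0 normr1.
by rewrite normr0 add0r normr1.
Qed.

Lemma measurable_green2 e : measurable_fun [set: T3 * T3] ((fun z : space3 R * space3 R => green e z.1 z.2) : T3 * T3 -> R).
Proof.
apply: measurable_funB; apply: measurable_funM.
- exact: (measurableT_comp (Lp_real_measurable f1L) measurable_snd).
- exact: (measurableT_comp (measurable_radw0 _ _ _ _ _) measurable_sqn3_sub33).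
- exact: (measurableT_comp (Lp_real_measurable f2L) measurable_snd).
- exact: (measurableT_comp (measurable_radw0 _ _ _ _ _) measurable_sqn3_sub33).
Qed.

Lemma measurable_green e x : measurable_fun [set: T3] (green e x : T3 -> R).
Proof. exact: (measurableT_comp (measurable_green2 e) (measurable_pair1 _)). Qed.

Lemma measurable_green_rep e : measurable_fun [set: T3] (green_rep e : T3 -> R).
Proof. exact: (@measurable_Rintegral1 _ _ T3 T3 R leb3 _ (measurable_green2 e)). Qed.

Lemma measurable_potential_integrand x : measurable_fun [set: T3] ((fun y : space3 R => yuk kap (sqn3 (x - y)) * w y) : T3 -> R).
Proof.
by apply: (measurable_funM _ mw); exact: (measurableT_comp (measurable_yuk kap) (measurable_sqn3_subl x)).
Qed.

Lemma potential_integrable x : (potential kap w x < +oo)%E ->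
  lebesgue3.-integrable setT (EFin \o (fun y => yuk kap (sqn3 (x - y)) * w y)).
Proof.
move=> h; apply: ge0_integrable => //; first exact: measurable_potential_integrand.
by move=> y; rewrite mulr_ge0 ?yuk_ge0.
Qed.

Lemma ae_green_le e x : {ae lebesgue3, forall y, `|green e x y| <= yuk kap (sqn3 (x - y)) * w y}.
Proof. by apply: aeS (ae_neq x) => y; exact: green_le. Qed.

Lemma green_rep_le e x : (potential kap w x < +oo)%E -> `|green_rep e x| <= fine (potential kap w x).
Proof.
move=> hx; have ip := potential_integrable hx.
have mg := measurable_green e x; have mp := measurable_potential_integrand x.
have mge : measurable_fun [set: T3] ((fun y : space3 R => (`|green e x y|)%:E) : T3 -> \bar R).
  by apply/measurable_EFinP; exact: measurableT_comp.
have le1 : (\int[lebesgue3]_y (`|green e x y|)%:E <= potential kap w x)%E.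
  have mpe : measurable_fun [set: T3] ((fun y : space3 R => (yuk kap (sqn3 (x - y)) * w y)%:E) : T3 -> \bar R).
    exact/measurable_EFinP.
  apply: (@ae_ge0_le_integral _ _ _ lebesgue3 _ measurableT _ _ _ mge _ mpe).
  - by move=> y _; rewrite lee_fin.
  - by move=> y _; rewrite lee_fin mulr_ge0 ?yuk_ge0.
  - by apply: aeS (ae_green_le e x) => y h _; rewrite lee_fin.
have ig : lebesgue3.-integrable setT (EFin \o green e x).
  apply/integrableP; split; first exact/measurable_EFinP.
  exact: le_lt_trans hx.
apply: (le_trans (le_normr_Rintegral measurableT ig)); rewrite /Rintegral.
apply: fine_le => //; first exact: integral_fune_fin_num (integrable_norm ig).
by rewrite ge0_fin_numE//; exact: potential_ge0.
Qed.

Lemma cvg_green x y (e_ : nat -> R) : e_ n @[n --> \oo] --> 0 -> y <> x ->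
  green (e_ n) x y @[n --> \oo] --> green 0 x y.
Proof.
move=> ce yx; have s0 := sqn3_sub_gt0 yx.
have cw a b : radw0 (e_ n) kap sig a b (sqn3 (x - y)) @[n --> \oo] --> radw0 0 kap sig a b (sqn3 (x - y)).
  rewrite /radw0; apply: continuous_cvg.
    apply/differentiable_continuous/derivable1_diffP.
    by have [] : is_derive _ _ _ _ := is_derive_wave kap sig a b 1 (_ : 0 < sqn3 (x - y) + 0 ^+ 2) => //; rewrite expr0n /= addr0.
  apply: cvgD; first exact: cvg_cst.
  by rewrite expr2; under eq_fun do rewrite expr2; apply: cvgM.
by apply: cvgB; apply: cvgM; [exact: cvg_cst|exact: cw|exact: cvg_cst|exact: cw].
Qed.

Lemma cvg_green_rep x (e_ : nat -> R) : e_ n @[n --> \oo] --> 0 -> (potential kap w x < +oo)%E ->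
  green_rep (e_ n) x @[n --> \oo] --> green_rep 0 x.
Proof.
move=> ce hx.
have ip := potential_integrable hx.
have mg e := measurable_green e x.
have [] // := @Rintegral_dominated_ae _ T3 R lebesgue3 (fun n => green (e_ n) x) (green 0 x) _ (fun n => mg (e_ n)) (mg 0) ip.
- by apply: aeS (ae_neq x) => y yx n; exact: green_le.
- by apply: aeS (ae_neq x) => y yx; exact: cvg_green.
Qed.

Lemma cvg_harmonic_inv : (n.+1%:R^-1 : R) @[n --> \oo] --> 0.
Proof. exact: cvg_harmonic. Qed.

(** [helmholtz_wave] at every centre x, integrated against eta, with e = 1 / (n+1) -> 0. The left
    side concentrates; the right side is dominated by eta times the Yukawa potential of |f1| + |f2|,
    which is integrable. *)
Lemma green_rep_cutoff r L eta : cutoff r L eta ->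
  lebesgue3.-integrable setT (EFin \o (fun x => eta x * green_rep 0 x)) /\
  4 * pi * \int[lebesgue3]_y (u1 y * eta y) = \int[lebesgue3]_x (eta x * green_rep 0 x).
Proof.
move=> etaP; have [me h0 h1 _ _] := etaP.
have wL : Lp_real p w.
  by apply: Lp_realD; exact: Lp_real_norm.
pose e_ n : R := n.+1%:R^-1.
have e0 n : 0 < e_ n by rewrite invr_gt0.
have e1 n : e_ n <= 1 by rewrite invf_le1// ler1n.
have ec := cvg_harmonic_inv.
have pot0 x : (0 <= (eta x)%:E * potential kap w x)%E by rewrite mule_ge0 ?lee_fin//; exact: potential_ge0.
have mpot : measurable_fun [set: T3] ((fun x : space3 R => (eta x)%:E * potential kap w x)%E : T3 -> \bar R).
  by apply: emeasurable_funM; [exact/measurable_EFinP|exact: measurable_potential].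
have potI := cutoff_potential_lty p1 kap0 etaP wL w0.
pose g (x : space3 R) : R := fine ((eta x)%:E * potential kap w x).
have ae_pot : {ae lebesgue3, forall x, ((eta x)%:E * potential kap w x < +oo)%E}.
  have ip : lebesgue3.-integrable setT ((fun x : space3 R => (eta x)%:E * potential kap w x)%E : T3 -> \bar R).
    by apply/integrableP; split => //; under eq_integral do rewrite gee0_abs//.
  by apply: aeS (integrable_ae measurableT ip) => x /(_ I) h; rewrite ltey_eq h.
have mg : measurable_fun [set: T3] (g : T3 -> R).
  exact: (measurableT_comp (fine_measurable measurableT) mpot).
have ig : lebesgue3.-integrable setT (EFin \o g).
  apply: ge0_integrable => //; first by move=> x; rewrite fine_ge0.
  apply: le_lt_trans potI; apply: ge0_le_integral3 => //.
  - exact/measurable_EFinP.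
  - by move=> x; rewrite lee_fin fine_ge0.
  - by move=> x; rewrite /g; case: (_ * _)%E (pot0 x) => // _; rewrite leey.
have [i0 c0] : lebesgue3.-integrable setT (EFin \o (fun x => eta x * green_rep 0 x)) /\
    \int[lebesgue3]_x (eta x * green_rep (e_ n) x) @[n --> \oo] --> \int[lebesgue3]_x (eta x * green_rep 0 x).
  apply: (@Rintegral_dominated_ae _ T3 R lebesgue3 (fun n (x : space3 R) => eta x * green_rep (e_ n) x) (fun x => eta x * green_rep 0 x) g _ _ ig).
  - by move=> n; apply: measurable_funM => //; exact: measurable_green_rep.
  - by apply: measurable_funM => //; exact: measurable_green_rep.
  - apply: aeS ae_pot => x hx n; rewrite normrM (ger0_norm (h0 x)) /g.
    (* Where eta vanishes, finiteness of the product says nothing about the potential, since 0 times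
       infinity is 0; but both sides are then 0. *)
    have [->|nz] := eqVneq (eta x) 0; first by rewrite mul0r mul0e.
    have px : (potential kap w x < +oo)%E.
      by rewrite ltNge leye_eq; apply/eqP => E; move: hx; rewrite E mulry gtr0_sg ?mul1e// lt_neqAle eq_sym nz h0.
    rewrite fineM//=; last by rewrite ge0_fin_numE//; exact: potential_ge0.
    by apply: ler_wpM2l => //; exact: green_rep_le.
  - apply: aeS ae_pot => x hx.
    have [->|nz] := eqVneq (eta x) 0.
      by rewrite mul0r; under eq_fun do rewrite mul0r; exact: cvg_cst.
    have px : (potential kap w x < +oo)%E.
      by rewrite ltNge leye_eq; apply/eqP => E; move: hx; rewrite E mulry gtr0_sg ?mul1e// lt_neqAle eq_sym nz h0.
    by apply: cvgM; [exact: cvg_cst|exact: cvg_green_rep].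
split => //.
(* The two defects have masses 4 pi and 0, so only u1 survives in the limit. *)
have c1 := mollify_cvg etaP (measurable_defect1 kap sig) (mollifying_defect1 sig kap0) p1 u1L e0 e1 ec.
have c2 := mollify_cvg etaP (measurable_defect2 kap sig) (mollifying_defect2 sig kap0) p1 u2L e0 e1 ec.
pose A n := \int[lebesgue3]_x \int[lebesgue3]_y (eta x * (u1 y * defect1 kap sig (e_ n) (sqn3 (x - y)))).
pose B n := \int[lebesgue3]_x \int[lebesgue3]_y (eta x * (u2 y * defect2 kap sig (e_ n) (sqn3 (x - y)))).
have c3 : (fun n => A n - B n) @ \oo --> 4 * pi * 1 * \int[lebesgue3]_y (u1 y * eta y) - 4 * pi * 0 * \int[lebesgue3]_y (u2 y * eta y).
  by apply: cvgB; [exact: c1|exact: c2].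
rewrite mulr0 mul0r subr0 mulr1 in c3.
suff E : (fun n => A n - B n) = (fun n => \int[lebesgue3]_x (eta x * green_rep (e_ n) x)).
  by rewrite E in c3; exact: (cvg_unique (@Rhausdorff R) c3 c0).
apply/funext => n.
have I1 := @integrable_Rintegral1 _ _ T3 T3 R leb3 leb3 _ (measurable_mollify_integrand etaP (measurable_defect1 kap sig) u1L (e_ n))
  (mollify_integrable etaP (measurable_defect1 kap sig) (mollifying_defect1 sig kap0) p1 u1L (e0 n) (e1 n)).
have I2 := @integrable_Rintegral1 _ _ T3 T3 R leb3 leb3 _ (measurable_mollify_integrand etaP (measurable_defect2 kap sig) u2L (e_ n))
  (mollify_integrable etaP (measurable_defect2 kap sig) (mollifying_defect2 sig kap0) p1 u2L (e0 n) (e1 n)).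
have BB := RintegralB (mu := lebesgue3) measurableT I1 I2.
rewrite /= in BB; rewrite -[LHS]BB; apply: eq_Rintegral => x _.
have i1 := decays_integrable1 kap0 p1 u1L (measurable_defect1 kap sig (e_ n)) (decays_defect1 sig kap0 x (e0 n)).
have i2 := decays_integrable1 kap0 p1 u2L (measurable_defect2 kap sig (e_ n)) (decays_defect2 sig kap0 x (e0 n)).
rewrite (RintegralZl (mu := lebesgue3) (eta x) measurableT i1) (RintegralZl (mu := lebesgue3) (eta x) measurableT i2).
rewrite -mulrBr; congr (_ * _).
by rewrite -(RintegralB (mu := lebesgue3) measurableT i1 i2) /= (helmholtz_wave kap0 p1 x (e0 n) uf).
Qed.

End Representation.

(** * Functions with vanishing integrals against cut-offs *)

Section ProductGenerator.
Context d1 d2 (T1 : measurableType d1) (T2 : measurableType d2).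
Variables (G1 : set (set T1)) (G2 : set (set T2)) (g1 : nat -> set T1) (g2 : nat -> set T2).
Hypotheses (E1 : @measurable _ T1 = <<s G1 >>) (E2 : @measurable _ T2 = <<s G2 >>).
Hypotheses (Gg1 : forall k, G1 (g1 k)) (Gg2 : forall k, G2 (g2 k)).
Hypotheses (c1 : \bigcup_k g1 k = setT) (c2 : \bigcup_k g2 k = setT).

Definition rectangles : set (set (T1 * T2)) := [set A `*` B | A in G1 & B in G2].

(** A cylinder over A is a countable union of rectangles A x [g2 k]; this is what the exhausting
    sequences inside the generators are for. *)
Lemma measurable_prod_rectangles : @measurable _ (T1 * T2)%type = <<s rectangles >>.
Proof.
rewrite eqEsubset; split.
  apply: smallest_sub; first exact: smallest_sigma_algebra.
  rewrite subUset; split.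
    rewrite E1 -g_sigma_preimageE; apply: smallest_sub; first exact: smallest_sigma_algebra.
    move=> _ [A GA <-]; rewrite setTI.
    have -> : fst @^-1` A = \bigcup_k (A `*` g2 k).
      by rewrite -setX_bigcupr c2 setXT.
    apply: sigma_algebra_bigcup => k; apply: sub_sigma_algebra.
    by exists A => //; exists (g2 k).
  rewrite E2 -g_sigma_preimageE; apply: smallest_sub; first exact: smallest_sigma_algebra.
  move=> _ [B GB <-]; rewrite setTI.
  have -> : snd @^-1` B = \bigcup_k (g1 k `*` B).
    by rewrite -setX_bigcupl c1 setTX.
  apply: sigma_algebra_bigcup => k; apply: sub_sigma_algebra.
  by exists (g1 k) => //; exists B.
apply: smallest_sub; first exact: smallest_sigma_algebra.
move=> _ [A GA] [B GB] <-; apply: measurableX.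
  by rewrite E1; exact: sub_sigma_algebra.
by rewrite E2; exact: sub_sigma_algebra.
Qed.

Lemma setI_closed_rectangles : setI_closed G1 -> setI_closed G2 -> setI_closed rectangles.
Proof.
move=> I1 I2 _ _ [A GA] [B GB] <- [A' GA'] [B' GB'] <-; rewrite -setXI.
by exists (A `&` A'); [exact: I1|exists (B `&` B'); [exact: I2|]].
Qed.

Lemma bigcup_rectangles : {homo g1 : m n / (m <= n)%N >-> m `<=` n} -> {homo g2 : m n / (m <= n)%N >-> m `<=` n} ->
  \bigcup_k (g1 k `*` g2 k) = setT.
Proof.
move=> h1 h2; apply/seteqP; split=> // -[x y] _.
have [m _ gx] : (\bigcup_k g1 k) x by rewrite c1.
have [n _ gy] : (\bigcup_k g2 k) y by rewrite c2.
exists (maxn m n) => //; split => /=; [apply: (h1 m)|apply: (h2 n)] => //; [exact: leq_maxl|exact: leq_maxr].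
Qed.

End ProductGenerator.

Section Boxes.
Context {R : realType}.
Notation T1 := (measurableTypeR R).
Notation T2 := (measurableTypeR R * measurableTypeR R)%type.
Notation T3 := (measurableTypeR R * measurableTypeR R * measurableTypeR R)%type.

Definition box (a b : space3 R) : set T3 :=
  (`]a.1.1, b.1.1[ `*` `]a.1.2, b.1.2[) `*` `]a.2, b.2[.

Let G1 : set (set T1) := @RGenOpens.G R.
Let g1 (k : nat) : set T1 := `]- k%:R, k%:R[%classic.

Let E1 : @measurable _ T1 = <<s G1 >>.
Proof. exact: RGenOpens.measurableE. Qed.

Let Gg1 k : G1 (g1 k).
Proof. by exists (- k%:R), k%:R. Qed.

Let c1 : \bigcup_k g1 k = setT.
Proof.
apply/seteqP; split=> x // _; exists (Num.trunc `|x|).+1 => //=.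
by rewrite /g1 /= in_itv /= -ltr_norml truncnS_gt.
Qed.

Let h1 : {homo g1 : m n / (m <= n)%N >-> m `<=` n}.
Proof.
move=> m n mn x; rewrite /g1 /= !in_itv /= => /andP[x1 x2].
have mn' : (m%:R : R) <= n%:R by rewrite ler_nat.
by apply/andP; split; lra.
Qed.

Let I1 : setI_closed G1.
Proof.
move=> _ _ [a [b ->]] [c [d ->]]; exists (Num.max a c), (Num.min b d).
apply/seteqP; split=> x /=; rewrite !in_itv /= gt_max lt_min.
  by move=> [/andP[-> ->] /andP[-> ->]].
by move=> /andP[/andP[-> ->] /andP[-> ->]].
Qed.

Let G2 := rectangles G1 G1.
Let E2 : @measurable _ T2 = <<s G2 >> := measurable_prod_rectangles E1 E1 Gg1 Gg1 c1 c1.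
Let g2 k := g1 k `*` g1 k.
Let c2 : \bigcup_k g2 k = setT := bigcup_rectangles c1 c1 h1 h1.
Let Gg2 k : G2 (g2 k). Proof. by exists (g1 k) => //; exists (g1 k). Qed.
Let h2 : {homo g2 : m n / (m <= n)%N >-> m `<=` n}.
Proof. by move=> m n mn [x y] [/= gx gy]; split; exact: (h1 mn). Qed.

Lemma measurable_box a b : measurable (box a b).
Proof. by apply: measurableX => //; exact: measurableX. Qed.

Lemma box_measure_unique (m1 m2 : {measure set T3 -> \bar R}) :
  (forall a b, m1 (box a b) = m2 (box a b)) -> (forall a b, (m1 (box a b) < +oo)%E) ->
  forall A, measurable A -> m1 A = m2 A.
Proof.
move=> mE mf.
have bE : forall A, rectangles G2 G1 A -> exists a b, A = box a b.
  move=> _ [_ [_ [a1 [b1 ->]] [_ [a2 [b2 ->]] <-]]] [_ [a3 [b3 ->]] <-].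
  by exists (a1, a2, a3), (b1, b2, b3).
apply: (measure_unique (rectangles G2 G1) (fun k => g2 k `*` g1 k)).
- exact: measurable_prod_rectangles E2 E1 Gg2 Gg1 c2 c1.
- by apply: setI_closed_rectangles => //; exact: setI_closed_rectangles.
- by move=> k; exists (g2 k) => //; exists (g1 k).
- exact: bigcup_rectangles c2 c1 h2 h1.
- by move=> A /bE[a [b ->]].
- move=> k; have [a [b ->]] : exists a b, g2 k `*` g1 k = box a b; last exact: mf.
  by apply: bE; exists (g2 k) => //; exists (g1 k).
Qed.

(** The positive and negative parts of h are densities of two measures that agree on boxes, hence on
    all measurable sets. On the set where h > 0 the second one is zero, so the first is too;
    symmetrically where h < 0. *)
Lemma box_null (h : T3 -> R) : measurable_fun setT h ->
  (forall a b, lebesgue3.-integrable (box a b) (EFin \o h) /\ (\int[lebesgue3]_(x in box a b) (h x)%:E = 0)%E) ->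
  {ae lebesgue3, forall x, h x = 0}.
Proof.
move=> mh hB.
have mhE : measurable_fun setT (EFin \o h) by exact/measurable_EFinP.
pose hp : T3 -> \bar R := ((EFin \o h)^\+)%E; pose hn : T3 -> \bar R := ((EFin \o h)^\-)%E.
have mp : measurable_fun setT hp by exact: measurable_funepos.
have mn : measurable_fun setT hn by exact: measurable_funeneg.
have p0 x : (0 <= hp x)%E by exact: funepos_ge0.
have n0 x : (0 <= hn x)%E by exact: funeneg_ge0.
have fin a b : (\int[lebesgue3]_(x in box a b) hp x \is a fin_num)%E.
  have ip := integrable_funepos (measurable_box a b) (hB a b).1.
  exact: (@integrable_fin_num _ _ _ _ _ (measurable_box a b) _ ip).
have fin' a b : (\int[lebesgue3]_(x in box a b) hn x \is a fin_num)%E.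
  have ip := integrable_funeneg (measurable_box a b) (hB a b).1.
  exact: (@integrable_fin_num _ _ _ _ _ (measurable_box a b) _ ip).
have eqb a b : (\int[lebesgue3]_(x in box a b) hp x = \int[lebesgue3]_(x in box a b) hn x)%E.
  have := (hB a b).2; rewrite integralE -/hp -/hn => /eqP.
  by rewrite sube_eq ?fin_num_adde_defr// add0e => /eqP.
have U := box_measure_unique (m1 := density lebesgue3 mp p0) (m2 := density lebesgue3 mn n0) eqb.
have UA A : measurable A -> (\int[lebesgue3]_(x in A) hp x = \int[lebesgue3]_(x in A) hn x)%E.
  by apply: U => a b; rewrite ltey_eq; apply/orP; left; exact: fin.
pose P := [set x : T3 | 0 < h x].
pose N := [set x : T3 | h x < 0].
have mP : measurable P.
  have -> : P = setT `&` h @^-1` `]0, +oo[.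
    by apply/seteqP; split=> x /=; rewrite in_itv /= andbT => // -[].
  by apply: mh => //; exact: measurable_itv.
have mN : measurable N.
  have -> : N = setT `&` h @^-1` `]-oo, 0[.
    by apply/seteqP; split=> x /=; rewrite in_itv /= => // -[].
  by apply: mh => //; exact: measurable_itv.
have aeP : {ae lebesgue3, forall x, P x -> hp x = 0%E}.
  have m' : measurable_fun P hp by exact: measurable_funTS.
  apply: (ae_eq_integral_abs lebesgue3 mP m').1; under eq_integral do rewrite gee0_abs//.
  rewrite UA//; apply: integral0_eq => x Px.
  by rewrite /hn funenegE; apply/max_idPr; rewrite /= leNgt lte_fin -leNgt oppr_le0 ltW.
have aeN : {ae lebesgue3, forall x, N x -> hn x = 0%E}.
  have m' : measurable_fun N hn by exact: measurable_funTS.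
  apply: (ae_eq_integral_abs lebesgue3 mN m').1; under eq_integral do rewrite gee0_abs//.
  rewrite -UA//; apply: integral0_eq => x Nx.
  by rewrite /hp funeposE; apply/max_idPr; rewrite /= lee_fin ltW.
apply: aeS2 aeP aeN => x hP hN; apply/eqP; rewrite eq_le !leNgt; apply/andP; split; apply/negP => hx.
  have := hP hx; rewrite /hp funeposE /= => /eqP; rewrite eq_le => /andP[+ _].
  by rewrite max_l ?lee_fin ?(ltW hx)// leNgt hx.
have := hN hx; rewrite /hn funenegE /= => /eqP; rewrite eq_le => /andP[+ _].
by rewrite max_l ?lee_fin ?oppr_ge0 ?(ltW hx)// oppr_le0 leNgt hx.
Qed.

End Boxes.

Section Tents.
Context {R : realType}.
Notation T3 := (measurableTypeR R * measurableTypeR R * measurableTypeR R)%type.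
Implicit Types (a b x y : space3 R).

(** Inside the box this is the distance to the boundary, outside it is not positive; being
    1-Lipschitz, it gives [tent n] the Lipschitz constant n. *)
Definition box_depth a b x : R :=
  Num.min (Num.min (Num.min (x.1.1 - a.1.1) (b.1.1 - x.1.1)) (Num.min (x.1.2 - a.1.2) (b.1.2 - x.1.2)))
    (Num.min (x.2 - a.2) (b.2 - x.2)).

Definition tent (n : nat) a b x : R := Num.min 1 (Num.max 0 (n%:R * box_depth a b x)).

Lemma boxP a b x : box a b x <-> 0 < box_depth a b x.
Proof.
rewrite /box /box_depth !lt_min !subr_gt0; case: x => -[x y] z /=; rewrite /= !in_itv /=.
by split => [[[-> ->] ->]//|/andP[/andP[-> ->] ->]].
Qed.

Lemma coord_le_norm3 x : [/\ `|x.1.1| <= norm3 x, `|x.1.2| <= norm3 x & `|x.2| <= norm3 x].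
Proof.
by rewrite /norm3; split; rewrite -sqrtr_sqr ler_wsqrtr//; [rewrite -addrA lerDl|rewrite -addrA addrCA lerDl|rewrite lerDr];
  rewrite addr_ge0 ?sqr_ge0.
Qed.

Lemma norm3_le_sum x : norm3 x <= `|x.1.1| + `|x.1.2| + `|x.2|.
Proof.
have h0 : 0 <= `|x.1.1| + `|x.1.2| + `|x.2| by rewrite !addr_ge0.
rewrite -(ler_pXn2r (n := 2))// ?nnegrE ?norm3_ge0// sqr_norm3 /sqn3.
have e (t : R) : t ^+ 2 = `|t| ^+ 2 by rewrite real_normK ?num_real.
rewrite (e x.1.1) (e x.1.2) (e x.2).
move: (normr_ge0 x.1.1) (normr_ge0 x.1.2) (normr_ge0 x.2).
move: `|x.1.1| `|x.1.2| `|x.2| => p q s p0 q0 s0.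
rewrite -subr_ge0 [leRHS](_ : _ = 2 * (p * q + p * s + q * s)); last by ring.
by rewrite mulr_ge0// !addr_ge0// mulr_ge0.
Qed.

Lemma box_depth_lip a b x y : box_depth a b x <= box_depth a b y + norm3 (x - y).
Proof.
have [h1 h2 h3] := coord_le_norm3 (x - y); move: h1 h2 h3; rewrite /= !ler_norml => /andP[h1 h1'] /andP[h2 h2'] /andP[h3 h3'].
rewrite -lerBlDr /box_depth !le_min; do ?(apply/andP; split); rewrite lerBlDr !ge_min.
- by apply/orP; left; apply/orP; left; apply/orP; left; lra.
- by apply/orP; left; apply/orP; left; apply/orP; right; lra.
- by apply/orP; left; apply/orP; right; apply/orP; left; lra.
- by apply/orP; left; apply/orP; right; apply/orP; right; lra.
- by apply/orP; right; apply/orP; left; lra.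
- by apply/orP; right; apply/orP; right; lra.
Qed.

Lemma measurable_box_depth a b : measurable_fun [set: T3] (box_depth a b : T3 -> R).
Proof.
have m1 : measurable_fun [set: T3] ((fun x : space3 R => x.1.1) : T3 -> R).
  exact: (measurableT_comp measurable_fst measurable_fst).
have m2 : measurable_fun [set: T3] ((fun x : space3 R => x.1.2) : T3 -> R).
  exact: (measurableT_comp measurable_snd measurable_fst).
have m3 : measurable_fun [set: T3] ((fun x : space3 R => x.2) : T3 -> R) by exact: measurable_snd.
by apply: measurable_minr; [apply: measurable_minr|]; apply: measurable_minr; apply: measurable_funB.
Qed.

Lemma tent_ge0 n a b x : 0 <= tent n a b x.
Proof. by rewrite /tent le_min ler01 le_max lexx. Qed.

Lemma tent_le1 n a b x : tent n a b x <= 1.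
Proof. by rewrite /tent ge_min lexx. Qed.

Lemma tent_out n a b x : box_depth a b x <= 0 -> tent n a b x = 0.
Proof.
move=> h; rewrite /tent max_l; last by rewrite mulr_ge0_le0.
by rewrite min_r.
Qed.

Lemma cutoff_tent n a b : exists r, cutoff r n%:R (tent n a b).
Proof.
exists (`|a.1.1| + `|b.1.1| + (`|a.1.2| + `|b.1.2|) + (`|a.2| + `|b.2|)); split.
- apply: measurable_minr => //; apply: measurable_maxr => //; apply: measurable_funM => //.
  exact: measurable_box_depth.
- exact: tent_ge0.
- exact: tent_le1.
- move=> x hx; apply: tent_out; rewrite leNgt; apply/negP => /boxP.
  move: hx; rewrite ltNge => /negP hx [[/= h1 h2] h3]; apply: hx; apply: (le_trans (norm3_le_sum x)).
  have h (s t v : R) : v \in `]s, t[ -> `|v| <= `|s| + `|t|.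
    rewrite in_itv /= => /andP[v1 v2]; have := ler_norm t; have := ler_normr (- s) s; rewrite lexx orbT => h'.
    have := ler_norm (- s); rewrite normrN => h4 h5; have := normr_ge0 s; have := normr_ge0 t.
    by move=> h6 h7; rewrite ler_norml; apply/andP; split; lra.
  by apply: lerD; [apply: lerD|]; exact: h.
move=> x y; rewrite /tent.
have hl : n%:R * box_depth a b x <= n%:R * box_depth a b y + n%:R * norm3 (x - y).
  by rewrite -mulrDr ler_wpM2l// box_depth_lip.
have hn : 0 <= n%:R * norm3 (x - y) by rewrite mulr_ge0// norm3_ge0.
move: hl hn; move: (n%:R * box_depth a b x) (n%:R * box_depth a b y) (n%:R * norm3 (x - y)) => p q s hl hn.
rewrite -lerBlDr le_min; apply/andP; split; rewrite lerBlDr ge_min.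
  by apply/orP; left; lra.
have [p1|p1] := leP 1 (Num.max 0 p); last first.
  apply/orP; right; rewrite ge_max; apply/andP; split.
    by rewrite addr_ge0// le_max lexx.
  by apply: (le_trans hl); rewrite lerD2r le_max lexx orbT.
apply/orP; right; rewrite ge_max; apply/andP; split.
  by rewrite addr_ge0// le_max lexx.
by apply: (le_trans hl); rewrite lerD2r le_max lexx orbT.
Qed.

Lemma cvg_tent a b x : tent n a b x @[n --> \oo] --> ((0 < box_depth a b x)%R%:R : R).
Proof.
have [h|h] := ltP 0 (box_depth a b x); last first.
  by under eq_fun do rewrite (tent_out _ h); exact: cvg_cst.
apply: (@cvg_trans _ ((fun=> 1) @ \oo)); last exact: cvg_cst.
apply: near_eq_cvg; exists (Num.trunc (box_depth a b x)^-1).+1 => //= n /= hn.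
rewrite /tent min_l// le_max; apply/orP; right.
rewrite -ler_pdivrMr// mul1r; apply: le_trans (ltW (truncnS_gt _)) _.
by rewrite ler_nat.
Qed.

(** Grown by 1 on each side, so that the tent of slope 1 over the larger box equals 1 on the
    original one and dominates all tents over it. *)
Definition enlarge a b : space3 R * space3 R :=
  ((a.1.1 - 1, a.1.2 - 1, a.2 - 1), (b.1.1 + 1, b.1.2 + 1, b.2 + 1)).

Lemma tent_enlarge a b x : 0 < box_depth a b x -> tent 1 (enlarge a b).1 (enlarge a b).2 x = 1.
Proof.
rewrite /box_depth !lt_min => /andP[/andP[/andP[h1 h2] /andP[h3 h4]] /andP[h5 h6]].
rewrite /tent min_l// le_max mul1r; apply/orP; right.
by rewrite /box_depth /enlarge !le_min /=; do ?(apply/andP; split); lra.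
Qed.

(** The tents over a box converge to its indicator; the tent over the enlarged box shows that h is
    integrable on the box and supplies the majorant. *)
Lemma cutoff_null (h : T3 -> R) : measurable_fun setT h ->
  (forall r L eta, cutoff r L eta -> lebesgue3.-integrable setT (EFin \o (fun x => eta x * h x)) /\
     \int[lebesgue3]_x (eta x * h x) = 0) ->
  {ae lebesgue3, forall x, h x = 0}.
Proof.
move=> mh H; apply: box_null => // a b.
have [r' etaP'] := cutoff_tent 1 (enlarge a b).1 (enlarge a b).2.
have [ib _] := H _ _ _ etaP'.
have mb := measurable_box a b.
have iB : lebesgue3.-integrable (box a b) (EFin \o h).
  have := integrableS measurableT mb (@subsetT _ _) ib; apply: eq_integrable => // x.
  by rewrite inE => /boxP hx /=; rewrite tent_enlarge// mul1r.
split => //.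
have mf : measurable_fun [set: T3] ((fun x => (0 < box_depth a b x)%R%:R * h x) : T3 -> R).
  apply: measurable_funM => //; apply: (measurableT_comp (f := fun b : bool => b%:R : R)) => //.
  by apply: measurable_fun_ltr => //; exact: measurable_box_depth.
have mt n : measurable_fun [set: T3] ((fun x => tent n a b x * h x) : T3 -> R).
  by have [r [m1 _ _ _ _]] := cutoff_tent n a b; exact: measurable_funM.
have c : \int[lebesgue3]_x (tent n a b x * h x) @[n --> \oo] --> \int[lebesgue3]_x ((0 < box_depth a b x)%R%:R * h x).
  apply: (@Rintegral_dominated _ T3 R lebesgue3 (fun n x => tent n a b x * h x) _ _ mt mf (integrable_norm ib)).
  - move=> n x /=; rewrite 2!normrM; apply: ler_wpM2r => //.
    rewrite !ger0_norm ?tent_ge0//; have [hx|hx] := ltP 0 (box_depth a b x).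
      by rewrite tent_enlarge// tent_le1.
    by rewrite tent_out// tent_ge0.
  - by move=> x; apply: cvgM; [exact: cvg_tent|exact: cvg_cst].
have z n : \int[lebesgue3]_x (tent n a b x * h x) = 0.
  by have [r eP] := cutoff_tent n a b; exact: (H _ _ _ eP).2.
have E0 : \int[lebesgue3]_x ((0 < box_depth a b x)%R%:R * h x) = 0.
  rewrite (funext z) in c; exact: (cvg_unique (@Rhausdorff R) c (@cvg_cst _ _ _ _ _)).
have E1 : \int[lebesgue3]_(x in box a b) h x = 0.
  rewrite -[RHS]E0 Rintegral_mkcond; apply: eq_Rintegral => x _.
  rewrite /patch; case: ifPn => [|]; rewrite ?inE ?notin_setE => hx.
    by move/boxP : hx => ->; rewrite mul1r.
  by have [/boxP//|] := ltP 0 (box_depth a b x); rewrite mul0r.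
have fi := @integrable_fin_num _ _ _ _ _ mb _ iB.
by rewrite -[LHS](fineK fi); congr EFin.
Qed.

End Tents.

Section GreenRepresentation.
Context {R : realType}.
Notation T3 := (measurableTypeR R * measurableTypeR R * measurableTypeR R)%type.
Variables (kap sig p : R).
Hypotheses (kap0 : 0 < kap) (p1 : 1 < p).

(** The identity is known after integration against every cut-off, and cut-offs separate functions
    up to null sets. *)
Lemma green_representation (u1 u2 f1 f2 : space3 R -> R) : helmholtz_pair kap sig p u1 u2 f1 f2 ->
  {ae lebesgue3, forall x, 4 * pi * u1 x = green_rep kap sig f1 f2 0 x}.
Proof.
move=> uf; have [u1L _ _ _ _] := uf.
have mu := Lp_real_measurable u1L.
have mh : measurable_fun [set: T3] ((fun x : space3 R => 4 * pi * u1 x - green_rep kap sig f1 f2 0 x) : T3 -> R).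
  by apply: measurable_funB; [exact: measurable_funM|exact: (measurable_green_rep uf)].
have := cutoff_null mh; move=> H.
have {H} : {ae lebesgue3, forall x, 4 * pi * u1 x - green_rep kap sig f1 f2 0 x = 0}.
  apply: H => r L eta etaP.
  have [ig E] := green_rep_cutoff kap0 p1 uf etaP.
  have [me h0 h1 _ _] := etaP.
  have iu : lebesgue3.-integrable setT (EFin \o (fun y => u1 y * eta y)).
    apply: (Lp_real_integrable (c := 1) (K := expR (1 * r)) (x0 := 0) p1 ltr01 u1L me) => y.
    have := cutoff_decay etaP y y ltr01; rewrite subrr sub0r norm3N.
    have -> : norm3 (0 : space3 R) = 0 by rewrite /norm3 /= expr0n /= !addr0 sqrtr0.
    by rewrite mulr0 oppr0 expR0 mulr1 ger0_norm.
  have i1 := integrableZl_real (4 * pi) iu.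
  have EE : (fun x => eta x * (4 * pi * u1 x - green_rep kap sig f1 f2 0 x)) =
    (fun x => 4 * pi * (u1 x * eta x) + (- 1) * (eta x * green_rep kap sig f1 f2 0 x)).
    by apply/funext => x; ring.
  have i2 := integrableZl_real (- 1) ig.
  rewrite EE; split; first exact: integrableD_real.
  by rewrite RintegralD// RintegralZl// RintegralZl// E mulN1r subrr.
by apply: aeS => x /eqP; rewrite subr_eq0 => /eqP.
Qed.

End GreenRepresentation.

(** * The pointwise bound on the resolvent *)

Section AeBound.
Context d (T : measurableType d) (R : realType) (m : {measure set T -> \bar R}).

Lemma ae_le_integrable (f g : T -> R) : measurable_fun setT f -> m.-integrable setT (EFin \o g) ->
  {ae m, forall x, `|f x| <= g x} -> m.-integrable setT (EFin \o f).
Proof.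
move=> mf ig fg; have mg : measurable_fun setT g by exact/measurable_EFinP/(measurable_int _ ig).
apply/integrableP; split; first exact/measurable_EFinP.
have /integrableP[_ fin] := ig; apply: le_lt_trans fin.
apply: ae_ge0_le_integral => //.
- by apply: measurableT_comp => //; exact/measurable_EFinP.
- by apply: measurableT_comp => //; exact/measurable_EFinP.
- by apply: aeS fg => x h _ /=; rewrite lee_fin (le_trans h)// ler_norm.
Qed.

Lemma Rintegral_le_ae (f g : T -> R) : measurable_fun setT f -> m.-integrable setT (EFin \o g) ->
  {ae m, forall x, `|f x| <= g x} -> `|\int[m]_x f x| <= \int[m]_x g x.
Proof.
move=> mf ig fg; have if' := ae_le_integrable mf ig fg.
have mg : measurable_fun setT g by exact/measurable_EFinP/(measurable_int _ ig).
apply: (le_trans (le_normr_Rintegral measurableT if')).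
(* The function g may be negative on a null set, while the comparison below requires nonnegative
   functions everywhere. *)
have -> : \int[m]_x g x = \int[m]_x Num.max (g x) 0.
  congr fine; apply: ae_eq_integral => //; try exact/measurable_EFinP.
    by apply/measurable_EFinP; exact: measurable_maxr.
  by apply: aeS fg => x h _ /=; rewrite max_l// (le_trans _ h).
have im : m.-integrable setT (EFin \o (fun x => Num.max (g x) 0)).
  apply: (le_integrable measurableT _ _ ig); first by apply/measurable_EFinP; exact: measurable_maxr.
  by move=> x _ /=; rewrite lee_fin ger0_norm ?le_max ?lexx ?orbT// ge_max ler_norm normr_ge0.
rewrite -lee_fin /Rintegral !fineK; [|exact: integral_fune_fin_num im|exact: integral_fune_fin_num (integrable_norm if')].
apply: ae_ge0_le_integral => //.
- by apply/measurable_EFinP; exact: measurableT_comp.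
- by move=> x _; rewrite lee_fin le_max lexx orbT.
- by apply/measurable_EFinP; exact: measurable_maxr.
- by apply: aeS fg => x h _; rewrite lee_fin le_max h.
Qed.

End AeBound.

Section ResolventBound.
Context {R : realType}.
Notation T3 := (measurableTypeR R * measurableTypeR R * measurableTypeR R)%type.
Variables (kap sig p : R).
Hypotheses (kap0 : 0 < kap) (p1 : 1 < p).

Lemma Re_mul_real (z : R[i]) (c : R) : complex.Re (z * c%:C) = complex.Re z * c.
Proof. by case: z => a b /=; rewrite mulr0 subr0. Qed.

Lemma Im_mul_real (z : R[i]) (c : R) : complex.Im (z * c%:C) = complex.Im z * c.
Proof. by case: z => a b /=; rewrite mulr0 add0r. Qed.

(** The derivative has order two, so the sign (-1)^2 disappears; test functions are real, so real
    and imaginary parts separate. *)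
Lemma weak_derivative_real (i : 'I_3) (u d : cfun3 R) : weak_derivative [:: i; i] u d ->
  (forall phi, test_function phi -> \int[lebesgue3]_y (complex.Re (u y) * partial [:: i; i] phi y) =
     \int[lebesgue3]_y (complex.Re (d y) * phi y)) /\
  (forall phi, test_function phi -> \int[lebesgue3]_y (complex.Im (u y) * partial [:: i; i] phi y) =
     \int[lebesgue3]_y (complex.Im (d y) * phi y)).
Proof.
move=> w; split => phi tphi; have := w phi tphi; rewrite sqrrN expr1n mul1r /cintegral => -[E1 E2].
  under eq_Rintegral do rewrite -Re_mul_real.
  by rewrite E1; apply: eq_Rintegral => y _; rewrite Re_mul_real.
under eq_Rintegral do rewrite -Im_mul_real.
by rewrite E2; apply: eq_Rintegral => y _; rewrite Im_mul_real.
Qed.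

(** The two hypotheses on z say that z = (sig + i kap)^2. *)
Lemma resolvent_helmholtz_pair (z : R[i]) (u f : cfun3 R) :
  complex.Re z = sig ^+ 2 - kap ^+ 2 -> complex.Im z = 2 * sig * kap ->
  op_shift p (free_hamiltonian p) z u f ->
  helmholtz_pair kap sig p (fun y => complex.Re (u y)) (fun y => complex.Im (u y)) (fun y => complex.Re (f y)) (fun y => complex.Im (f y)).
Proof.
move=> z1 z2 [fL [g [[uL _] gL [d [dP gE]]] fE]].
split; [exact: Lp_real_Re|exact: Lp_real_Im|exact: Lp_real_Re|exact: Lp_real_Im|].
exists (fun i y => complex.Re (d i y)), (fun i y => complex.Im (d i y)); split.
- by move=> i; split; [apply: Lp_real_Re => //|apply: Lp_real_Im => //]; exact: (dP i).1.
- by move=> i phi tphi; exact: (weak_derivative_real (dP i).2).1.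
- by move=> i phi tphi; exact: (weak_derivative_real (dP i).2).2.
- apply: aeS2 gE fE => y /= /(_ I) E1 /(_ I) E2; rewrite E2 E1 -z1 -z2.
  rewrite !big_ord_recr !big_ord0 /=.
  by case: (d _ y) => a1 b1; case: (d _ y) => a2 b2; case: (d _ y) => a3 b3; case: (u y) => a b; case: (z) => a' b' /=; ring.
- apply: aeS2 gE fE => y /= /(_ I) E1 /(_ I) E2; rewrite E2 E1 -z1 -z2.
  rewrite !big_ord_recr !big_ord0 /=.
  by case: (d _ y) => a1 b1; case: (d _ y) => a2 b2; case: (d _ y) => a3 b3; case: (u y) => a b; case: (z) => a' b' /=; ring.
Qed.

Lemma cauchy2 (a b c d : R) : a * c + b * d <= Num.sqrt (a ^+ 2 + b ^+ 2) * Num.sqrt (c ^+ 2 + d ^+ 2).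
Proof.
rewrite -sqrtrM ?addr_ge0 ?sqr_ge0//; apply: (le_trans (ler_norm _)).
rewrite -sqrtr_sqr ler_wsqrtr// -subr_ge0.
rewrite [leRHS](_ : _ = (a * d - b * c) ^+ 2); last by ring.
exact: sqr_ge0.
Qed.

Lemma ker_sqr s : 0 < s -> kerC kap sig 0 s ^+ 2 + kerS kap sig 0 s ^+ 2 = yuk kap s ^+ 2.
Proof.
move=> s0; rewrite /kerC /kerS /radw0 /wave expr0n /= addr0 !mul1r !mul0r addr0 add0r expr1 /wave1 /wave2 /yuk.
have := cos2Dsin2 (sig * Num.sqrt s).
move: (cos _) (sin _) (expR _) (Num.sqrt s)^-1 => c t E q h.
have -> : (E * c * q) ^+ 2 + (E * t * q) ^+ 2 = (E * q) ^+ 2 * (c ^+ 2 + t ^+ 2) by ring.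
by rewrite h mulr1.
Qed.

(** The two [green] functions are the real and imaginary parts of f times the kernel at e = 0, whose
    modulus is [yuk]. *)
Lemma norm_green (x : space3 R) (f : cfun3 R) y : y <> x ->
  Num.sqrt (green kap sig (fun y => complex.Re (f y)) (fun y => complex.Im (f y)) 0 x y ^+ 2 +
            green kap sig (fun y => complex.Im (f y)) (fun y => - complex.Re (f y)) 0 x y ^+ 2) =
  yuk kap (sqn3 (x - y)) * cabs (f y).
Proof.
move=> /sqn3_sub_gt0 s0; rewrite /green /= cabsE.
rewrite -(ger0_norm (yuk_ge0 kap (sqn3 (x - y)))) -sqrtr_sqr -sqrtrM ?sqr_ge0// -ker_sqr//.
by congr Num.sqrt; ring.
Qed.

Lemma sqrt_sqrD_fst (a b : R) : `|a| <= Num.sqrt (a ^+ 2 + b ^+ 2).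
Proof. by rewrite -sqrtr_sqr ler_wsqrtr// lerDl sqr_ge0. Qed.

Lemma sqrt_sqrD_snd (a b : R) : `|b| <= Num.sqrt (a ^+ 2 + b ^+ 2).
Proof. by rewrite -sqrtr_sqr ler_wsqrtr// lerDr sqr_ge0. Qed.

(** The representation applied to the equation and to its rotation by -i gives both components of 4
    pi u(x) as integrals A and B. The claim is then the inequality between the modulus of a complex
    integral and the integral of the modulus; it is trivial if the potential is infinite. *)
Lemma resolvent_pointwise (z : R[i]) (u f : cfun3 R) :
  complex.Re z = sig ^+ 2 - kap ^+ 2 -> complex.Im z = 2 * sig * kap ->
  op_shift p (free_hamiltonian p) z u f ->
  {ae lebesgue3, forall x, ((4 * pi * cabs (u x))%:E <= potential kap (cabs \o f) x)%E}.
Proof.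
move=> z1 z2 uf; have hp := resolvent_helmholtz_pair z1 z2 uf.
have hp' := helmholtz_pair_rot p1 hp.
apply: aeS2 (green_representation kap0 p1 hp) (green_representation kap0 p1 hp') => x.
have mg1 := measurable_green hp 0 x.
have mg2 := measurable_green hp' 0 x.
rewrite /green_rep /=.
set g1 : space3 R -> R := green _ _ _ _ _ _ in mg1 *; set g2 : space3 R -> R := green _ _ _ _ _ _ in mg2 *.
move=> E1 E2.
have fL : in_Lp p f by case: uf.
have mf := measurable_cabs fL.1.
have mY : measurable_fun [set: T3] ((fun y : space3 R => yuk kap (sqn3 (x - y)) * cabs (f y)) : T3 -> R).
  by apply: (measurable_funM _ mf); exact: (measurableT_comp (measurable_yuk kap) (measurable_sqn3_subl x)).
have [V|] := ltP (potential kap (cabs \o f) x) +oo%E; last by rewrite leye_eq => /eqP ->; rewrite leey.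
have iY : lebesgue3.-integrable setT (EFin \o (fun y : space3 R => yuk kap (sqn3 (x - y)) * cabs (f y))).
  by apply: ge0_integrable => // y; rewrite mulr_ge0 ?yuk_ge0 ?cabs_ge0.
have i1 : lebesgue3.-integrable setT (EFin \o g1).
  by apply: (ae_le_integrable _ iY) => //; apply: aeS (ae_neq x) => y yx; rewrite -(norm_green _ yx); exact: sqrt_sqrD_fst.
have i2 : lebesgue3.-integrable setT (EFin \o g2).
  by apply: (ae_le_integrable _ iY) => //; apply: aeS (ae_neq x) => y yx; rewrite -(norm_green _ yx); exact: sqrt_sqrD_snd.
set A := \int[lebesgue3]_y g1 y in E1; set B := \int[lebesgue3]_y g2 y in E2.
have VE : potential kap (cabs \o f) x = (\int[lebesgue3]_y (yuk kap (sqn3 (x - y)) * cabs (f y)))%:E.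
  by rewrite /Rintegral fineK//; exact: integral_fune_fin_num iY.
rewrite VE lee_fin; set Y := \int[lebesgue3]_y _.
have pi0 := @pi_gt0 R.
have -> : 4 * pi * cabs (u x) = Num.sqrt (A ^+ 2 + B ^+ 2).
  rewrite -E1 -E2 cabsE !exprMn -mulrDr sqrtrM; last by rewrite -exprMn sqr_ge0.
  by rewrite -exprMn sqrtr_sqr ger0_norm// mulr_ge0// ltW.
have [N0|Nn] := eqVneq (Num.sqrt (A ^+ 2 + B ^+ 2)) 0.
  by rewrite N0; apply: Rintegral_ge0 => y _; rewrite mulr_ge0 ?yuk_ge0 ?cabs_ge0.
have Np : 0 < Num.sqrt (A ^+ 2 + B ^+ 2) by rewrite lt_neqAle eq_sym Nn sqrtr_ge0.
(* Multiplied by the modulus, the left side is A^2 + B^2, the integral of A g1 + B g2, which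
   Cauchy-Schwarz bounds pointwise. *)
rewrite -(ler_pM2l Np) -expr2 sqr_sqrtr ?addr_ge0 ?sqr_ge0//.
have iA := integrableZl_real A i1; have iB := integrableZl_real B i2.
rewrite [leLHS](_ : _ = \int[lebesgue3]_y (A * g1 y + B * g2 y)); last first.
  by rewrite RintegralD// !RintegralZl// !expr2.
rewrite -RintegralZl//; apply: (le_trans (ler_norm _)); apply: Rintegral_le_ae.
- by apply: measurable_funD; exact: measurable_funM.
- exact: integrableZl_real.
- apply: aeS (ae_neq x) => y yx; rewrite -(norm_green _ yx) ler_norml; apply/andP; split; last exact: cauchy2.
  by have := cauchy2 (- A) (- B) (g1 y) (g2 y); rewrite !sqrrN !mulNr -opprD lerNl.
Qed.

End ResolventBound.

Section WeightedPotential.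
Context {R : realType}.
Notation T3 := (measurableTypeR R * measurableTypeR R * measurableTypeR R)%type.
Implicit Types (x y : space3 R).

Lemma ge0_measurable_potential_pair (c : R) (m v : space3 R -> R) :
  measurable_fun [set: T3] (m : T3 -> R) -> measurable_fun [set: T3] (v : T3 -> R) ->
  measurable_fun [set: T3 * T3] ((fun z : space3 R * space3 R => (m z.1 * (yuk c (sqn3 (z.1 - z.2)) * v z.2))%:E) : T3 * T3 -> \bar R).
Proof.
move=> mm mv; apply/measurable_EFinP; apply: measurable_funM; first exact: (measurableT_comp mm measurable_fst).
apply: measurable_funM; last exact: (measurableT_comp mv measurable_snd).
exact: (measurableT_comp (measurable_yuk c) measurable_sqn3_sub33).
Qed.

Lemma potential_swap (c : R) (m v : space3 R -> R) :
  measurable_fun [set: T3] (m : T3 -> R) -> measurable_fun [set: T3] (v : T3 -> R) ->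
  (forall x, 0 <= m x) -> (forall x, 0 <= v x) ->
  (\int[lebesgue3]_x ((m x)%:E * potential c v x) =
   \int[lebesgue3]_y ((v y)%:E * \int[lebesgue3]_x (m x * yuk c (sqn3 (x - y)))%:E))%E.
Proof.
move=> mm mv m0 v0.
have mF := ge0_measurable_potential_pair c mm mv.
have F0 (z : T3 * T3) : (0 <= (m z.1 * (yuk c (sqn3 ((z.1 : space3 R) - z.2)) * v z.2))%:E)%E.
  by rewrite lee_fin mulr_ge0// mulr_ge0 ?yuk_ge0.
have T := @fubini_tonelli _ _ T3 T3 R leb3 leb3 _ mF F0.
transitivity (\int[leb3]_x \int[leb3]_y (m x * (yuk c (sqn3 ((x : space3 R) - y)) * v y))%:E)%E.
  apply: eq_integral => x _; rewrite /potential.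
  have mY : measurable_fun [set: T3] ((fun y : space3 R => yuk c (sqn3 (x - y)) * v y) : T3 -> R).
    by apply: (measurable_funM _ mv); exact: (measurableT_comp (measurable_yuk c) (measurable_sqn3_subl x)).
  by rewrite -(ge0_integralRZl lebesgue3 (m0 x) mY (fun y => mulr_ge0 (yuk_ge0 _ _) (v0 y))).
rewrite [LHS]T; apply: eq_integral => y _.
have mY : measurable_fun [set: T3] ((fun x : space3 R => m x * yuk c (sqn3 (x - y))) : T3 -> R).
  by apply: (measurable_funM mm); exact: (measurableT_comp (measurable_yuk c) (measurable_sqn3_subr y)).
rewrite -(ge0_integralRZl lebesgue3 (v0 y) mY (fun x => mulr_ge0 (m0 x) (yuk_ge0 _ _))).
by apply: eq_integral => x _; congr EFin => /=; ring.
Qed.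

Lemma exp_yuk (c d : R) x y : 0 <= d -> expR (- (d * norm3 x)) * yuk c (sqn3 (x - y)) <=
  expR (- (d * norm3 y)) * yuk (c - d) (sqn3 (x - y)).
Proof.
move=> d0; rewrite /yuk -norm3E mulrA [leRHS]mulrA ler_wpM2r ?invr_ge0 ?norm3_ge0//.
rewrite -!expRD ler_expR; have h := ler_norm3_dist x y.
have : 0 <= d * (norm3 x + norm3 (x - y) - norm3 y) by rewrite mulr_ge0//; lra.
by rewrite mulrBr mulrDr mulrBl; lra.
Qed.

Lemma japanese_gt0 (s : R) x : 0 < japanese s x.
Proof. by rewrite /japanese powR_gt0// ltr_pwDl ?sqr_ge0. Qed.

Lemma japanese_le1 (s : R) x : s <= 0 -> japanese s x <= 1.
Proof.
move=> s0; rewrite /japanese -[leRHS](powRr0 (1 + norm3 x ^+ 2)).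
by rewrite ler_powR// lerDl sqr_ge0.
Qed.

Lemma measurable_japanese (s : R) : measurable_fun [set: T3] (japanese s : T3 -> R).
Proof.
apply: (@measurableT_comp _ _ _ _ _ _ (fun y : R => y `^ s)) => //.
by apply: measurable_funD => //; apply: measurable_funX; exact: measurable_norm3.
Qed.

Lemma cabsD (a b : R[i]) : cabs (a + b) <= cabs a + cabs b.
Proof.
rewrite -(ler_pXn2r (n := 2))// ?nnegrE ?addr_ge0 ?cabs_ge0// sqrrD !cabsE.
case: a b => a b [c d] /=; rewrite !sqr_sqrtr ?addr_ge0 ?sqr_ge0//.
have := cauchy2 a b c d; move: (Num.sqrt _ * Num.sqrt _) => N h.
by rewrite -subr_ge0 [leRHS](_ : _ = 2 * (N - (a * c + b * d))); [rewrite mulr_ge0// subr_ge0|ring].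
Qed.

Lemma cabsM (a b : R[i]) : cabs (a * b) = cabs a * cabs b.
Proof. by rewrite /cabs Normc.normcM. Qed.

Lemma cabsN (a : R[i]) : cabs (- a) = cabs a.
Proof. by case: a => a b; rewrite !cabsE /= !sqrrN. Qed.

Variables (kap p : R).
Hypotheses (kap0 : 0 < kap) (p1 : 1 < p).

(** Continuity of the Yukawa potential from L_p into a weighted L_1; it controls the error made by
    approximating an element of L_p from the domain of the sandwiched resolvent. *)
Lemma exp_potential_le (d : R) (v : cfun3 R) : 0 < d -> d < kap -> cmeasurable v ->
  (\int[lebesgue3]_x ((expR (- (d * norm3 x)))%:E * potential kap (cabs \o v) x) <=
   (\int[lebesgue3]_x (yuk (kap - d) (sqn3 x))%:E) * (weight_const d p * Lp_norm p v))%E.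
Proof.
move=> d0 dk mv; have c0 : 0 < kap - d by rewrite subr_gt0.
have me : measurable_fun [set: T3] ((fun x : space3 R => expR (- (d * norm3 x))) : T3 -> R).
  have := measurable_expw d (0 : space3 R); rewrite (_ : (fun y => _) = (fun x : space3 R => expR (- (d * norm3 x))))//.
  by apply/funext => y; rewrite sub0r norm3N.
have mc := measurable_cabs mv.
rewrite (potential_swap kap me mc (fun x => expR_ge0 _) (fun x => cabs_ge0 _)).
set I := (\int[lebesgue3]_x (yuk (kap - d) (sqn3 x))%:E)%E.
have IE y : (\int[lebesgue3]_x (yuk (kap - d) (sqn3 (x - y)))%:E = I)%E.
  exact: (ge0_integral_radial _ (measurable_yuk _) (yuk_ge0 _)).
have I0 : (0 <= I)%E by apply: integral_ge0 => x _; rewrite lee_fin yuk_ge0.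
have If : I \is a fin_num.
  by rewrite ge0_fin_numE// -(IE 0); exact: integral_yuk_lty.
have fI0 : 0 <= fine I by exact: fine_ge0.
have mY (c : R) y : measurable_fun [set: T3] ((fun x : space3 R => yuk c (sqn3 (x - y))) : T3 -> R).
  exact: (measurableT_comp (measurable_yuk c) (measurable_sqn3_subr y)).
have mR : measurable_fun [set: T3] ((fun y : space3 R => expR (- (d * norm3 (0 - y))) * cabs (v y)) : T3 -> R).
  by apply: measurable_funM => //; exact: measurable_expw.
apply: (@le_trans _ _ (\int[lebesgue3]_y (fine I * (expR (- (d * norm3 (0 - y))) * cabs (v y)))%:E)%E).
  apply: ge0_le_integral3.
  - apply: emeasurable_funM; first exact/measurable_EFinP.
    have mG : measurable_fun [set: T3 * T3] ((fun z : space3 R * space3 R => (expR (- (d * norm3 z.1)) * yuk kap (sqn3 (z.1 - z.2)))%:E) : T3 * T3 -> \bar R).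
      apply/measurable_EFinP; apply: measurable_funM; first exact: (measurableT_comp me measurable_fst).
      exact: (measurableT_comp (measurable_yuk kap) measurable_sqn3_sub33).
    apply: (@measurable_fun_fubini_tonelli_G _ _ T3 T3 R leb3 _ mG) => z.
    by rewrite lee_fin mulr_ge0 ?expR_ge0 ?yuk_ge0.
  - by apply/measurable_EFinP; apply: measurable_funM.
  - move=> y; rewrite mule_ge0 ?lee_fin ?cabs_ge0//; apply: integral_ge0 => x _.
    by rewrite lee_fin mulr_ge0 ?expR_ge0 ?yuk_ge0.
  move=> y; rewrite sub0r norm3N.
  apply: (@le_trans _ _ ((cabs (v y))%:E * \int[lebesgue3]_x (expR (- (d * norm3 y)) * yuk (kap - d) (sqn3 (x - y)))%:E)%E).
    apply: lee_wpmul2l; first by rewrite lee_fin cabs_ge0.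
    apply: ge0_le_integral3.
    - by apply/measurable_EFinP; apply: measurable_funM.
    - by apply/measurable_EFinP; apply: measurable_funM.
    - by move=> x; rewrite lee_fin mulr_ge0 ?expR_ge0 ?yuk_ge0.
    - by move=> x; rewrite lee_fin; apply: exp_yuk; exact: ltW.
  rewrite (ge0_integralRZl lebesgue3 (expR_ge0 _) (mY _ y) (fun x => yuk_ge0 _ _)) IE -(fineK If) -!EFinM lee_fin.
  by rewrite le_eqVlt; apply/orP; left; apply/eqP; ring.
rewrite (ge0_integralRZl lebesgue3 fI0 mR (fun y => mulr_ge0 (expR_ge0 _) (cabs_ge0 _))) fineK//.
by apply: lee_wpmul2l => //; exact: Lp_weight.
Qed.

End WeightedPotential.

(** * From the sandwiched resolvent to its bounded extension *)

Section SandwichedResolvent.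
Context {R : realType}.
Notation T3 := (measurableTypeR R * measurableTypeR R * measurableTypeR R)%type.
Variables (kap sig p tau : R) (q : cfun3 R) (z : R[i]).
Hypotheses (kap0 : 0 < kap) (p1 : 1 < p) (tau0 : 0 <= tau).
Hypotheses (z1 : complex.Re z = sig ^+ 2 - kap ^+ 2) (z2 : complex.Im z = 2 * sig * kap).
Hypothesis mq : cmeasurable (factor_b tau q).

Definition wa (x : space3 R) : R := japanese (- (tau / 2)) x.
Definition wb (x : space3 R) : R := cabs (factor_b tau q x).

Lemma wa_gt0 x : 0 < wa x. Proof. exact: japanese_gt0. Qed.

Lemma wa_ge0 x : 0 <= wa x. Proof. exact/ltW/wa_gt0. Qed.

Lemma wa_le1 x : wa x <= 1.
Proof. by apply: japanese_le1; rewrite oppr_le0 divr_ge0. Qed.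

Lemma wb_ge0 x : 0 <= wb x. Proof. exact: cabs_ge0. Qed.

Lemma measurable_wa : measurable_fun [set: T3] (wa : T3 -> R).
Proof. exact: measurable_japanese. Qed.

Lemma measurable_wb : measurable_fun [set: T3] (wb : T3 -> R).
Proof. exact: measurable_cabs mq. Qed.

Lemma cabs_factor_a x : cabs (factor_a tau x) = wa x.
Proof. by rewrite /factor_a cabs_real ger0_norm ?wa_ge0. Qed.

Definition wpot (w : cfun3 R) (x : space3 R) : \bar R := potential kap (fun y => wa y * cabs (w y)) x.

(** An output of the sandwiched resolvent is b times the solution of the resolvent equation with
    right-hand side a w, so the Yukawa bound applies to that solution. *)
Lemma sandwiched_pointwise (w f : cfun3 R) : sandwiched_resolvent p tau q z w f ->
  {ae lebesgue3, forall x, ((4 * pi * cabs (f x))%:E <= (wb x)%:E * wpot w x)%E}.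
Proof.
move=> [v [h [wL hL hE] uf] [vL fL fE]].
apply: aeS2 (resolvent_pointwise kap0 p1 z1 z2 uf) fE => x vh /(_ I) ->.
rewrite cabsM -/(wb x) mulrCA EFinM; apply: lee_wpmul2l; first by rewrite lee_fin wb_ge0.
apply: (le_trans vh); rewrite le_eqVlt; apply/orP; left; apply/eqP.
have mY : measurable_fun [set: T3] ((fun y : space3 R => yuk kap (sqn3 (x - y))) : T3 -> R).
  exact: (measurableT_comp (measurable_yuk kap) (measurable_sqn3_subl x)).
have mh := measurable_cabs hL.1; have mw := measurable_cabs wL.1.
apply: ae_eq_integral => //.
- by apply/measurable_EFinP; exact: measurable_funM.
- apply/measurable_EFinP; apply: measurable_funM => //; apply: measurable_funM => //; exact: measurable_wa.
- by apply: aeS hE => y /(_ I) E _ /=; rewrite E cabsM cabs_factor_a.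
Qed.

Variable Q : @operator R.
Hypothesis QP : bounded_extension p (sandwiched_resolvent p tau q z) Q.

Definition cutw (d N : R) (x : space3 R) : R := (wb x <= N)%R%:R * (wa x * expR (- (d * norm3 x))).

Lemma cutw_ge0 d N x : 0 <= cutw d N x.
Proof. by rewrite /cutw mulr_ge0// mulr_ge0 ?wa_ge0 ?expR_ge0. Qed.

Lemma cutw_le d N x : cutw d N x <= wa x * expR (- (d * norm3 x)).
Proof. rewrite /cutw; apply: ler_piMl; first by rewrite mulr_ge0 ?wa_ge0 ?expR_ge0.
by case: (wb x <= N). Qed.

Lemma measurable_exp_norm (d : R) : measurable_fun [set: T3] ((fun x : space3 R => expR (- (d * norm3 x))) : T3 -> R).
Proof.
have := measurable_expw d (0 : space3 R); rewrite (_ : (fun y => _) = (fun x : space3 R => expR (- (d * norm3 x))))//.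
by apply/funext => y; rewrite sub0r norm3N.
Qed.

Lemma measurable_cutw d N : measurable_fun [set: T3] (cutw d N : T3 -> R).
Proof.
apply: measurable_funM; last by apply: measurable_funM; [exact: measurable_wa|exact: measurable_exp_norm].
apply: (measurableT_comp (f := fun b : bool => b%:R : R)) => //.
by apply: measurable_fun_ler => //; exact: measurable_wb.
Qed.

Lemma measurable_wpot (w : cfun3 R) : cmeasurable w -> measurable_fun [set: T3] (wpot w : T3 -> \bar R).
Proof.
move=> mw; apply: measurable_potential; last by move=> y; rewrite mulr_ge0 ?wa_ge0 ?cabs_ge0.
by apply: measurable_funM; [exact: measurable_wa|exact: measurable_cabs mw].
Qed.

Lemma wpot_ge0 w x : (0 <= wpot w x)%E.
Proof. by apply: potential_ge0 => y; rewrite mulr_ge0 ?wa_ge0 ?cabs_ge0. Qed.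

(* The pointwise bound holds on the domain of the sandwiched resolvent only. The
   truncation [wb x <= N] in [cutw] makes both sides continuous for the L_p norm, so
   that the integrated bound extends to [Q] by density. *)
Lemma Q_weighted (w f : cfun3 R) (d N : R) : Q w f -> 0 < d -> d < kap -> 0 <= N ->
  (\int[lebesgue3]_x (cutw d N x * (4 * pi * cabs (f x)))%:E <=
   \int[lebesgue3]_x ((cutw d N x)%:E * ((wb x)%:E * wpot w x)))%E.
Proof.
move=> Qwf d0 dk N0; have [Tdense [Qlin Qdom [M QM]] TQ] := QP.
have [Qin _ _ Qcomb _] := Qlin; have [wL fL] := Qin _ _ Qwf.
have pi0 : 0 <= pi :> R := pi_ge0 R.
set rhs := (\int[lebesgue3]_x ((cutw d N x)%:E * ((wb x)%:E * wpot w x)))%E.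
set I := (\int[lebesgue3]_x (yuk (kap - d) (sqn3 x))%:E)%E.
have I0 : (0 <= I)%E by apply: integral_ge0 => x _; rewrite lee_fin yuk_ge0.
have If : I \is a fin_num.
  rewrite ge0_fin_numE//.
  have IE : (\int[lebesgue3]_x (yuk (kap - d) (sqn3 (x - 0)))%:E = I)%E.
    exact: (ge0_integral_radial _ (measurable_yuk _) (yuk_ge0 _)).
  rewrite -IE.
  by apply: integral_yuk_lty; rewrite subr_gt0.
have wc0 : (0 <= weight_const d p)%E by exact: poweR_ge0.
have wcf : weight_const d p \is a fin_num by rewrite ge0_fin_numE// weight_const_lty.
(* The two summands are the coefficients of the approximation errors in [s5] and [s2]; approximating
   within e / (K + 1) keeps the total error below e. *)
pose K := fine I * fine (weight_const d p) * N + 4 * pi * fine (weight_const d p) * `|M|.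
have K0 : 0 <= K by rewrite addr_ge0// !mulr_ge0 ?fine_ge0.
apply/lee_addgt0Pr => e e0.
have e'0 : 0 < e / (K + 1) by rewrite divr_gt0// ltr_wpDl.
have [v [g [Tvg vlt]]] := Tdense w wL _ e'0.
have Qvg := TQ _ _ Tvg; have [vL gL] := Qin _ _ Qvg.
(* The differences w - v and f - g, in the shape in which linearity of [Q] is stated. *)
pose w' : cfun3 R := fun x => -1 * v x + w x.
pose f' : cfun3 R := fun x => -1 * g x + f x.
have Q' : Q w' f' by exact: Qcomb Qvg Qwf.
have [w'L f'L] := Qin _ _ Q'.
have w'lt : (Lp_norm p w' < (e / (K + 1))%:E)%E.
  by rewrite (_ : w' = (fun x => w x - v x))//; apply/funext => x; rewrite /w' mulN1r addrC.
have f'le : (Lp_norm p f' <= `|M|%:E * (e / (K + 1))%:E)%E.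
  apply: (le_trans (QM _ _ Q')); apply: (@le_trans _ _ (`|M|%:E * Lp_norm p w')%E).
    by apply: lee_wpmul2r; [exact: Lnorm_ge0|rewrite lee_fin ler_norm].
  by apply: lee_wpmul2l; [rewrite lee_fin|exact: ltW].
have mcut := measurable_cutw d N.
have mf := measurable_cabs fL.1; have mg := measurable_cabs gL.1.
have mf' := measurable_cabs f'L.1; have mw' := measurable_cabs w'L.1.
have mw := measurable_cabs wL.1; have mv := measurable_cabs vL.1.
have mpw := measurable_wpot wL.1; have mpv := measurable_wpot vL.1.
have mp' := measurable_potential kap mw' (fun y => cabs_ge0 _).
have mcw : measurable_fun [set: T3] ((fun x : space3 R => (cutw d N x * wb x)%:E) : T3 -> \bar R).
  by apply/measurable_EFinP; apply: measurable_funM => //; exact: measurable_wb.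
have cw0 x : (0 <= (cutw d N x * wb x)%:E)%E by rewrite lee_fin mulr_ge0 ?cutw_ge0 ?wb_ge0.
have pi4 : (0 : R) <= 4 * pi by rewrite mulr_ge0.
(* Where the truncation is active, b is at most N and a at most 1, so only the exponential is
   left. *)
have cwN x : cutw d N x * wb x <= N * expR (- (d * norm3 x)).
  rewrite /cutw; have [h|_] := boolP (wb x <= N); last first.
    by rewrite [X in X * _ * _](_ : _ = 0)// !mul0r mulr_ge0 ?expR_ge0.
  rewrite [X in X * _ * _](_ : _ = 1)// mul1r mulrC; apply: ler_pM => //; rewrite ?wb_ge0 ?mulr_ge0 ?wa_ge0 ?expR_ge0//.
  by rewrite ler_piMl ?expR_ge0// wa_le1.
have s1 : (\int[lebesgue3]_x (cutw d N x * (4 * pi * cabs (f x)))%:E <=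
    \int[lebesgue3]_x (cutw d N x * (4 * pi * cabs (g x)))%:E + \int[lebesgue3]_x (cutw d N x * (4 * pi * cabs (f' x)))%:E)%E.
  rewrite -(ge0_integralD lebesgue3 measurableT).
  - apply: ge0_le_integral3.
    + by apply/measurable_EFinP; apply: measurable_funM => //; exact: measurable_funM.
    + by apply: emeasurable_funD; apply/measurable_EFinP; apply: measurable_funM => //; exact: measurable_funM.
    + by move=> x; rewrite lee_fin mulr_ge0 ?cutw_ge0// mulr_ge0// cabs_ge0.
    + move=> x; rewrite -EFinD lee_fin -mulrDr ler_wpM2l ?cutw_ge0// -mulrDr ler_wpM2l//.
      have {1}-> : f x = g x + f' x by rewrite /f' mulN1r addNKr.
      exact: cabsD.
  - by move=> x _; rewrite lee_fin mulr_ge0 ?cutw_ge0// mulr_ge0// cabs_ge0.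
  - by apply/measurable_EFinP; apply: measurable_funM => //; exact: measurable_funM.
  - by move=> x _; rewrite lee_fin mulr_ge0 ?cutw_ge0// mulr_ge0// cabs_ge0.
  - by apply/measurable_EFinP; apply: measurable_funM => //; exact: measurable_funM.
have s2 : (\int[lebesgue3]_x (cutw d N x * (4 * pi * cabs (f' x)))%:E <= (4 * pi * fine (weight_const d p) * `|M| * (e / (K + 1)))%:E)%E.
  have mR : measurable_fun [set: T3] ((fun y : space3 R => expR (- (d * norm3 (0 - y))) * cabs (f' y)) : T3 -> R).
    by apply: measurable_funM => //; exact: measurable_expw.
  apply: (@le_trans _ _ (\int[lebesgue3]_x (4 * pi * (expR (- (d * norm3 (0 - x))) * cabs (f' x)))%:E)%E).
    apply: ge0_le_integral3.
    + by apply/measurable_EFinP; apply: measurable_funM => //; exact: measurable_funM.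
    + by apply/measurable_EFinP; apply: measurable_funM.
    + by move=> x; rewrite lee_fin mulr_ge0 ?cutw_ge0// mulr_ge0// cabs_ge0.
    + move=> x; rewrite lee_fin sub0r norm3N mulrCA ler_wpM2l// ler_wpM2r ?cabs_ge0//.
      by apply: (le_trans (cutw_le _ _ _)); rewrite ler_piMl ?expR_ge0// wa_le1.
  rewrite (ge0_integralRZl lebesgue3 pi4 mR (fun y => mulr_ge0 (expR_ge0 _) (cabs_ge0 _))).
  rewrite [leRHS](_ : _ = (4 * pi)%:E * (weight_const d p * (`|M|%:E * (e / (K + 1))%:E)))%E; last first.
    by rewrite -[in RHS](fineK wcf) -!EFinM; congr EFin; ring.
  apply: lee_wpmul2l; first by rewrite lee_fin.
  apply: (le_trans (Lp_weight 0 p1 d0 f'L.1)).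
  by apply: lee_wpmul2l.
have s3 : (\int[lebesgue3]_x (cutw d N x * (4 * pi * cabs (g x)))%:E <=
    \int[lebesgue3]_x ((cutw d N x)%:E * ((wb x)%:E * wpot v x)))%E.
  apply: (@ae_ge0_le_integral _ _ _ lebesgue3 _ measurableT).
  - by move=> x _; rewrite lee_fin mulr_ge0 ?cutw_ge0// mulr_ge0// cabs_ge0.
  - by apply/measurable_EFinP; apply: measurable_funM => //; exact: measurable_funM.
  - by move=> x _; rewrite mule_ge0 ?lee_fin ?cutw_ge0// mule_ge0 ?lee_fin ?wb_ge0// wpot_ge0.
  - apply: emeasurable_funM; first exact/measurable_EFinP.
    by apply: emeasurable_funM => //; apply/measurable_EFinP; exact: measurable_wb.
  - apply: aeS (sandwiched_pointwise Tvg) => x h _; rewrite EFinM.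
    by apply: lee_wpmul2l; rewrite ?lee_fin ?cutw_ge0.
(* Here v = w - w'; the factor a is kept on w and bounded by 1 on the error w'. *)
have pvw x : (wpot v x <= wpot w x + potential kap (cabs \o w') x)%E.
  have mY : measurable_fun [set: T3] ((fun y : space3 R => yuk kap (sqn3 (x - y))) : T3 -> R).
    exact: (measurableT_comp (measurable_yuk kap) (measurable_sqn3_subl x)).
  have mwa := measurable_wa.
  rewrite /wpot /potential -ge0_integralD//.
  - apply: ge0_le_integral3.
    + by apply/measurable_EFinP; apply: measurable_funM => //; exact: measurable_funM.
    + by apply: emeasurable_funD; apply/measurable_EFinP; apply: measurable_funM => //; exact: measurable_funM.
    + by move=> y; rewrite lee_fin mulr_ge0 ?yuk_ge0// mulr_ge0 ?wa_ge0 ?cabs_ge0.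
    + move=> y; rewrite -EFinD lee_fin -mulrDr ler_wpM2l ?yuk_ge0//.
      have h : cabs (v y) <= cabs (w y) + cabs (w' y).
        have {1}-> : v y = w y + - w' y by rewrite /w' mulN1r opprD opprK addrCA subrr addr0.
        by rewrite -(cabsN (w' y)); exact: cabsD.
      apply: (@le_trans _ _ (wa y * (cabs (w y) + cabs (w' y)))); first by rewrite ler_wpM2l ?wa_ge0.
      by rewrite mulrDr lerD2l ler_piMl ?cabs_ge0// wa_le1.
  - by move=> y _; rewrite lee_fin mulr_ge0 ?yuk_ge0// mulr_ge0 ?wa_ge0 ?cabs_ge0.
  - by apply/measurable_EFinP; apply: measurable_funM => //; exact: measurable_funM.
  - by move=> y _; rewrite lee_fin mulr_ge0 ?yuk_ge0// cabs_ge0.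
  - by apply/measurable_EFinP; apply: measurable_funM.
have s4 : (\int[lebesgue3]_x ((cutw d N x)%:E * ((wb x)%:E * wpot v x)) <=
    rhs + \int[lebesgue3]_x ((cutw d N x * wb x)%:E * potential kap (cabs \o w') x))%E.
  have -> : rhs = (\int[lebesgue3]_x ((cutw d N x * wb x)%:E * wpot w x))%E.
    by apply: eq_integral => x _; rewrite EFinM muleA.
  rewrite -(ge0_integralD lebesgue3 measurableT).
  - apply: ge0_le_integral3.
    + apply: emeasurable_funM; first exact/measurable_EFinP.
      by apply: emeasurable_funM => //; apply/measurable_EFinP; exact: measurable_wb.
    + by apply: emeasurable_funD; exact: emeasurable_funM.
    + by move=> x; rewrite mule_ge0 ?lee_fin ?cutw_ge0// mule_ge0 ?lee_fin ?wb_ge0// wpot_ge0.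
    + move=> x; rewrite muleA -EFinM.
      rewrite -ge0_muleDr; [|exact: wpot_ge0|by apply: potential_ge0 => y; exact: cabs_ge0].
      by apply: lee_wpmul2l.
  - by move=> x _; rewrite mule_ge0// wpot_ge0.
  - exact: emeasurable_funM.
  - by move=> x _; rewrite mule_ge0//; apply: potential_ge0 => y; exact: cabs_ge0.
  - exact: emeasurable_funM.
have s5 : (\int[lebesgue3]_x ((cutw d N x * wb x)%:E * potential kap (cabs \o w') x) <=
    (fine I * fine (weight_const d p) * N * (e / (K + 1)))%:E)%E.
  have p0' x : (0 <= potential kap (cabs \o w') x)%E by apply: potential_ge0 => y; exact: cabs_ge0.
  have mexp : measurable_fun [set: T3] ((fun x : space3 R => (expR (- (d * norm3 x)))%:E * potential kap (cabs \o w') x)%E : T3 -> \bar R).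
    by apply: emeasurable_funM => //; apply/measurable_EFinP; exact: measurable_exp_norm.
  apply: (@le_trans _ _ (\int[lebesgue3]_x (N%:E * ((expR (- (d * norm3 x)))%:E * potential kap (cabs \o w') x)))%E).
    apply: ge0_le_integral3.
    + exact: emeasurable_funM.
    + by apply: emeasurable_funM.
    + by move=> x; rewrite mule_ge0.
    + by move=> x; rewrite muleA -EFinM; apply: lee_wpmul2r => //; rewrite lee_fin cwN.
  rewrite ge0_integralZl//; last first.
  + by move=> x _; rewrite mule_ge0// lee_fin expR_ge0.
  rewrite [leRHS](_ : _ = N%:E * (I * (weight_const d p * (e / (K + 1))%:E)))%E; last first.
    by rewrite -[in RHS](fineK wcf) -[in RHS](fineK If) -!EFinM; congr EFin; ring.
  apply: lee_wpmul2l; first by rewrite lee_fin.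
  apply: (le_trans (exp_potential_le p1 d0 dk w'L.1)).
  by apply: lee_wpmul2l => //; apply: lee_wpmul2l => //; exact: ltW.
apply: (le_trans s1); apply: (le_trans (leeD (le_trans s3 (le_trans s4 (leeD (lexx _) s5))) s2)).
rewrite -addeA; apply: leeD; first exact: lexx.
have KE : fine I * fine (weight_const d p) * N + 4 * pi * fine (weight_const d p) * `|M| = K by [].
by rewrite -EFinD lee_fin -mulrDl KE mulrCA ler_piMr ?(ltW e0)// ler_pdivrMr ?mul1r ?lerDl// ltr_wpDl.
Qed.

End SandwichedResolvent.

(** * The eigenvalue bound *)

Section Hoelder.
Context d (T : measurableType d) (R : realType) (m : {measure set T -> \bar R}).

Lemma ge0_hoelder (f g : T -> R) (p q : R) : measurable_fun setT f -> measurable_fun setT g ->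
  (forall x, 0 <= f x) -> (forall x, 0 <= g x) -> 0 < p -> 0 < q -> p^-1 + q^-1 = 1 ->
  (\int[m]_x (f x * g x)%:E <= (\int[m]_x (f x `^ p)%:E) `^ p^-1 * (\int[m]_x (g x `^ q)%:E) `^ q^-1)%E.
Proof.
move=> mf mg f0 g0 p0 q0 pq; have := @hoelder _ T R m _ _ p q mf mg p0 q0 pq.
rewrite Lnorm1 !Lnorm_realE.
have -> : (\int[m]_x `|(f x * g x)%:E| = \int[m]_x (f x * g x)%:E)%E.
  by apply: eq_integral => x _; rewrite /= ger0_norm ?mulr_ge0.
have -> : (\int[m]_x (`|f x| `^ p)%:E = \int[m]_x (f x `^ p)%:E)%E.
  by apply: eq_integral => x _; rewrite ger0_norm.
by have -> : (\int[m]_x (`|g x| `^ q)%:E = \int[m]_x (g x `^ q)%:E)%E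
  by apply: eq_integral => x _; rewrite ger0_norm.
Qed.

End Hoelder.

Section CombesThomas.
Context {R : realType}.
Notation T3 := (measurableTypeR R * measurableTypeR R * measurableTypeR R)%type.
Variables (kap sig p tau : R) (q : cfun3 R) (z : R[i]).
Hypotheses (kap0 : 0 < kap) (p1 : 1 < p) (tau0 : 0 <= tau).
Hypotheses (z1 : complex.Re z = sig ^+ 2 - kap ^+ 2) (z2 : complex.Im z = 2 * sig * kap).
Hypothesis mq : cmeasurable (factor_b tau q).
Variable Q : @operator R.
Hypothesis QP : bounded_extension p (sandwiched_resolvent p tau q z) Q.
Variable w : cfun3 R.
Hypotheses (Qw : Q w (fun x => -1 * w x)) (wN0 : ~ aeq w (fun=> 0)).

Notation wa := (wa tau).
Notation wb := (wb tau q).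
Notation wpot := (wpot kap tau).

Let wL : in_Lp p w.
Proof. by have [_ [[Qin _ _ _ _] _ _] _] := QP; have [] := Qin _ _ Qw. Qed.

Let mw : measurable_fun [set: T3] ((fun x => cabs (w x)) : T3 -> R).
Proof. exact: measurable_cabs wL.1. Qed.

Let mwa := measurable_wa tau.
Let mwb : measurable_fun [set: T3] (wb : T3 -> R) := measurable_wb mq.

Definition ct_weight (d : R) (x : space3 R) : R := wa x * expR (- (d * norm3 x)).

Lemma ct_weight_gt0 d x : 0 < ct_weight d x.
Proof. by rewrite mulr_gt0 ?wa_gt0 ?expR_gt0. Qed.

Lemma ct_weight_ge0 d x : 0 <= ct_weight d x.
Proof. exact/ltW/ct_weight_gt0. Qed.

Lemma measurable_ct_weight d : measurable_fun [set: T3] (ct_weight d : T3 -> R).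
Proof. by apply: measurable_funM => //; exact: measurable_exp_norm. Qed.

Lemma ct_weight_integrable d : 0 < d -> lebesgue3.-integrable setT (EFin \o (fun x => ct_weight d x * cabs (w x))).
Proof.
move=> d0; have md := measurable_ct_weight d.
apply: ge0_integrable; first exact: measurable_funM.
  by move=> x; rewrite mulr_ge0 ?ct_weight_ge0 ?cabs_ge0.
apply: le_lt_trans (Lp_weight_lty 0 p1 d0 wL); apply: ge0_le_integral3.
- by apply/measurable_EFinP; exact: measurable_funM.
- by apply/measurable_EFinP; apply: measurable_funM => //; exact: measurable_expw.
- by move=> x; rewrite lee_fin mulr_ge0 ?ct_weight_ge0 ?cabs_ge0.
- move=> x; rewrite lee_fin sub0r norm3N ler_wpM2r ?cabs_ge0// /ct_weight ler_piMl ?expR_ge0//.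
  exact: wa_le1.
Qed.

(** The weight vanishes nowhere, so a zero integral would force the eigenfunction to be zero almost
    everywhere. *)
Lemma ct_weight_Rintegral_gt0 d : 0 < d -> 0 < \int[lebesgue3]_x (ct_weight d x * cabs (w x)).
Proof.
move=> d0; have ic := ct_weight_integrable d0.
have w0 x : 0 <= ct_weight d x * cabs (w x) by rewrite mulr_ge0 ?ct_weight_ge0 ?cabs_ge0.
rewrite lt_neqAle Rintegral_ge0// andbT eq_sym; apply/eqP => E; apply: wN0.
have E' : (\int[lebesgue3]_x `|(ct_weight d x * cabs (w x))%:E| = 0)%E.
  under eq_integral do rewrite gee0_abs ?lee_fin//.
  by rewrite -[LHS]fineK ?[fine _]E//; exact: integral_fune_fin_num ic.
have mf : measurable_fun [set: T3] ((fun x => (ct_weight d x * cabs (w x))%:E) : T3 -> \bar R).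
  by apply/measurable_EFinP; apply: measurable_funM => //; exact: measurable_ct_weight.
have := (ae_eq_integral_abs lebesgue3 measurableT mf).1 E'.
apply: aeS => x /(_ I) [] /eqP; rewrite mulf_eq0 gt_eqF ?ct_weight_gt0//= => /eqP h _.
by rewrite /cabs in h; exact: Normc.eq0_normc.
Qed.

(** [Q_weighted] with image -w, as N tends to infinity. The truncations converge pointwise to the
    full weight, and the right-hand side, if finite, bounds them all. *)
Lemma ct_first d : 0 < d -> d < kap ->
  ((4 * pi * \int[lebesgue3]_x (ct_weight d x * cabs (w x)))%:E <=
   \int[lebesgue3]_x ((ct_weight d x * wb x)%:E * wpot w x))%E.
Proof.
move=> d0 dk; set X := (\int[lebesgue3]_x _)%E.
have cut_ge n x := cutw_ge0 tau q d n%:R x.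
have cut_le n x : cutw tau q d n%:R x <= ct_weight d x := cutw_le tau q d n%:R x.
have mcut n : measurable_fun [set: T3] (cutw tau q d n%:R : T3 -> R) := measurable_cutw mq d n%:R.
have md := measurable_ct_weight d.
have mpw := measurable_wpot kap tau wL.1.
have An n : (\int[lebesgue3]_x (cutw tau q d n%:R x * (4 * pi * cabs (w x)))%:E <= X)%E.
  have h := Q_weighted kap0 p1 tau0 z1 z2 mq QP Qw d0 dk (ler0n _ n).
  apply: (@le_trans _ _ (\int[lebesgue3]_x (cutw tau q d n%:R x * (4 * pi * cabs (-1 * w x)))%:E)%E).
    rewrite le_eqVlt; apply/orP; left; apply/eqP; apply: eq_integral => x _.
    by rewrite mulN1r cabsN.
  apply: (le_trans h); apply: ge0_le_integral3.
  - apply: emeasurable_funM; first exact/measurable_EFinP.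
    by apply: emeasurable_funM => //; exact/measurable_EFinP.
  - by apply: emeasurable_funM => //; apply/measurable_EFinP; exact: measurable_funM.
  - by move=> x; rewrite mule_ge0 ?lee_fin// mule_ge0 ?lee_fin ?wb_ge0// wpot_ge0.
  - move=> x; rewrite muleA -EFinM; apply: lee_wpmul2r; first exact: wpot_ge0.
    by rewrite lee_fin ler_wpM2r ?wb_ge0.
have [->|Xf] := eqVneq X +oo%E; first by rewrite leey.
have X0 : (0 <= X)%E.
  by apply: integral_ge0 => x _; rewrite mule_ge0 ?wpot_ge0// lee_fin mulr_ge0 ?ct_weight_ge0 ?wb_ge0.
have Xfin : X \is a fin_num by rewrite ge0_fin_numE// ltey.
rewrite -(fineK Xfin) lee_fin.
have pi4 : (0 : R) <= 4 * pi by rewrite mulr_ge0 ?pi_ge0.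
have ic := integrableZl_real (4 * pi) (ct_weight_integrable d0).
have c : \int[lebesgue3]_x (cutw tau q d n%:R x * (4 * pi * cabs (w x))) @[n --> \oo] -->
    \int[lebesgue3]_x (4 * pi * (ct_weight d x * cabs (w x))).
  apply: (@Rintegral_dominated _ T3 R lebesgue3 (fun n x => cutw tau q d n%:R x * (4 * pi * cabs (w x))) _ _ _ _ ic).
  - by move=> n; apply: measurable_funM => //; exact: measurable_funM.
  - by apply: measurable_funM => //; exact: measurable_funM.
  - move=> n x; rewrite ger0_norm; last by rewrite mulr_ge0// mulr_ge0 ?cabs_ge0.
    by rewrite [leRHS]mulrCA; apply: ler_wpM2r => //; rewrite mulr_ge0 ?cabs_ge0.
  - move=> x; rewrite mulrCA; apply: cvgM; last exact: cvg_cst.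
    apply: (@cvg_trans _ ((fun=> ct_weight d x) @ \oo)); last exact: cvg_cst.
    apply: near_eq_cvg; exists (Num.trunc (wb x)).+1 => //= n /= hn.
    have h : wb x <= n%:R by apply: le_trans (ltW (truncnS_gt _)) _; rewrite ler_nat.
    by rewrite /cutw h mul1r.
rewrite -RintegralZl//; last exact: ct_weight_integrable.
rewrite -(cvg_lim (@Rhausdorff R) c); apply: limr_le; first by apply/cvg_ex; eexists; exact: c.
apply: nearW => n.
have fn : (\int[lebesgue3]_x (cutw tau q d n%:R x * (4 * pi * cabs (w x)))%:E)%E \is a fin_num.
  rewrite ge0_fin_numE; last by apply: integral_ge0 => x _; rewrite lee_fin mulr_ge0// mulr_ge0 ?cabs_ge0.
  by apply: le_lt_trans (An n) _; rewrite ltey.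
exact: fine_le fn Xfin (An n).
Qed.

(** Once the integrations are exchanged, the inner integral is at most e^(-d |y|) times a bound
    independent of y, by translation invariance of the kernel norm; the outer integral is then the
    one on the left of [ct_first]. *)
Lemma ct_second d r : 0 < d -> d < kap -> 2 < r ->
  (\int[lebesgue3]_x ((ct_weight d x * wb x)%:E * wpot w x) <=
   (\int[lebesgue3]_x (ct_weight d x * cabs (w x)))%:E *
   ((\int[lebesgue3]_x ((wa x * wb x) `^ (r / 2))%:E) `^ (r / 2)^-1 *
    (\int[lebesgue3]_x (yuk (kap - d) (sqn3 x) `^ (r / (r - 2)))%:E) `^ (r / (r - 2))^-1))%E.
Proof.
move=> d0 dk r2; have md := measurable_ct_weight d.
set A := ((\int[lebesgue3]_x ((wa x * wb x) `^ (r / 2))%:E) `^ (r / 2)^-1)%E.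
set Y := (\int[lebesgue3]_x (yuk (kap - d) (sqn3 x) `^ (r / (r - 2)))%:E)%E.
have mab : measurable_fun [set: T3] ((fun x => wa x * wb x) : T3 -> R) by exact: measurable_funM.
have mcb : measurable_fun [set: T3] ((fun x => ct_weight d x * wb x) : T3 -> R) by exact: measurable_funM.
have maw : measurable_fun [set: T3] ((fun x => wa x * cabs (w x)) : T3 -> R) by exact: measurable_funM.
have ab0 x : 0 <= wa x * wb x by rewrite mulr_ge0 ?wa_ge0 ?wb_ge0.
have cb0 x : 0 <= ct_weight d x * wb x by rewrite mulr_ge0 ?ct_weight_ge0 ?wb_ge0.
have aw0 x : 0 <= wa x * cabs (w x) by rewrite mulr_ge0 ?wa_ge0 ?cabs_ge0.
rewrite /wpot (potential_swap kap mcb maw cb0 aw0).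
have mY y : measurable_fun [set: T3] ((fun x : space3 R => yuk (kap - d) (sqn3 (x - y))) : T3 -> R).
  exact: (measurableT_comp (measurable_yuk _) (measurable_sqn3_subr y)).
have mY0 y : measurable_fun [set: T3] ((fun x : space3 R => yuk kap (sqn3 (x - y))) : T3 -> R).
  exact: (measurableT_comp (measurable_yuk _) (measurable_sqn3_subr y)).
have H0 : (0 <= A * Y `^ (r / (r - 2))^-1)%E by rewrite mule_ge0 ?poweR_ge0.
have k0 : 0 < r / (r - 2) by rewrite divr_gt0; lra.
have r20 : 0 < r / 2 by lra.
have conj : (r / 2)^-1 + (r / (r - 2))^-1 = 1.
  by field; rewrite ?gt_eqF//; lra.
have in_le y : (\int[lebesgue3]_x (ct_weight d x * wb x * yuk kap (sqn3 (x - y)))%:E <=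
    (expR (- (d * norm3 y)))%:E * (A * Y `^ (r / (r - 2))^-1))%E.
  apply: (@le_trans _ _ (\int[lebesgue3]_x (expR (- (d * norm3 y)) * (wa x * wb x * yuk (kap - d) (sqn3 (x - y))))%:E)%E).
    apply: ge0_le_integral3.
    - by apply/measurable_EFinP; exact: measurable_funM.
    - by apply/measurable_EFinP; apply: measurable_funM => //; exact: measurable_funM.
    - by move=> x; rewrite lee_fin mulr_ge0 ?yuk_ge0.
    - move=> x; rewrite lee_fin /ct_weight.
      rewrite [leLHS](_ : _ = wa x * wb x * (expR (- (d * norm3 x)) * yuk kap (sqn3 (x - y)))); last by ring.
      by rewrite [leRHS]mulrCA; apply: ler_wpM2l => //; apply: exp_yuk; exact: ltW.
  have mabY : measurable_fun [set: T3] ((fun x : space3 R => wa x * wb x * yuk (kap - d) (sqn3 (x - y))) : T3 -> R).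
    exact: measurable_funM.
  rewrite (ge0_integralRZl lebesgue3 (expR_ge0 _) mabY (fun x => mulr_ge0 (ab0 x) (yuk_ge0 _ _))).
  apply: lee_wpmul2l; first by rewrite lee_fin expR_ge0.
  have := ge0_hoelder lebesgue3 mab (mY y) ab0 (fun x => yuk_ge0 _ _) r20 k0 conj.
  have <- // : (\int[lebesgue3]_x (yuk (kap - d) (sqn3 (x - y)) `^ (r / (r - 2)))%:E = Y)%E.
  have mk : measurable_fun [set: R] (fun s => yuk (kap - d) s `^ (r / (r - 2))).
    by apply: (@measurableT_comp _ _ _ _ _ _ (fun y : R => y `^ _)) => //; exact: measurable_yuk.
  exact: (ge0_integral_radial _ mk (fun s => powR_ge0 _ _)).
apply: (@le_trans _ _ (\int[lebesgue3]_y ((ct_weight d y * cabs (w y))%:E * (A * Y `^ (r / (r - 2))^-1)))%E).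
  apply: ge0_le_integral3.
  - apply: emeasurable_funM; first exact/measurable_EFinP.
    have mG : measurable_fun [set: T3 * T3] ((fun z : space3 R * space3 R => (ct_weight d z.1 * wb z.1 * yuk kap (sqn3 (z.1 - z.2)))%:E) : T3 * T3 -> \bar R).
      apply/measurable_EFinP; apply: measurable_funM; first exact: (measurableT_comp mcb measurable_fst).
      exact: (measurableT_comp (measurable_yuk kap) measurable_sqn3_sub33).
    apply: (@measurable_fun_fubini_tonelli_G _ _ T3 T3 R leb3 _ mG) => z'.
    by rewrite lee_fin mulr_ge0 ?yuk_ge0.
  - by apply: emeasurable_funM => //; apply/measurable_EFinP; exact: measurable_funM.
  - move=> y; rewrite mule_ge0 ?lee_fin//; apply: integral_ge0 => x _.
    by rewrite lee_fin mulr_ge0 ?yuk_ge0.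
  - move=> y; rewrite [leRHS](_ : _ = (wa y * cabs (w y))%:E * ((expR (- (d * norm3 y)))%:E * (A * Y `^ (r / (r - 2))^-1)))%E.
      by apply: lee_wpmul2l; [rewrite lee_fin|exact: in_le].
    by rewrite [RHS]muleA -EFinM; congr (_%:E * _)%E; rewrite /ct_weight; ring.
have ic := ct_weight_integrable d0.
have fS := @integrable_fin_num _ _ _ _ _ measurableT _ ic.
rewrite ge0_integralZr//.
- by rewrite /Rintegral fineK.
- by apply/measurable_EFinP; exact: measurable_funM.
- by move=> y _; rewrite lee_fin mulr_ge0 ?ct_weight_ge0 ?cabs_ge0.
Qed.

Lemma combes_thomas d r : 0 < d -> d < kap -> 2 < r ->
  ((4 * pi)%:E <= (\int[lebesgue3]_x ((wa x * wb x) `^ (r / 2))%:E) `^ (r / 2)^-1 *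
    (\int[lebesgue3]_x (yuk (kap - d) (sqn3 x) `^ (r / (r - 2)))%:E) `^ (r / (r - 2))^-1)%E.
Proof.
move=> d0 dk r2; have S0 := ct_weight_Rintegral_gt0 d0.
have := le_trans (ct_first d0 dk) (ct_second d0 dk r2).
by rewrite [X in (X%:E <= _)%E]mulrC EFinM lee_pmul2l ?lte_fin.
Qed.

End CombesThomas.

Lemma ge0_hoelder_powR d (T : measurableType d) (R : realType) (m : {measure set T -> \bar R})
    (f g : T -> R) (r A B : R) : measurable_fun setT f -> measurable_fun setT g ->
  (forall x, 0 <= f x) -> (forall x, 0 <= g x) ->
  (\int[m]_x (f x `^ r)%:E = A%:E)%E -> (\int[m]_x (g x `^ r)%:E = B%:E)%E ->
  (\int[m]_x ((f x * g x) `^ (r / 2))%:E <= (A `^ 2^-1 * B `^ 2^-1)%:E)%E.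
Proof.
move=> mf mg f0 g0 fA gB.
have mp (h : T -> R) : measurable_fun setT h -> measurable_fun setT (fun x => h x `^ (r / 2)).
  by move=> mh; exact: (@measurableT_comp _ _ _ _ _ _ (fun y : R => y `^ _)).
have h2 : (2 : R)^-1 + 2^-1 = 1 by field.
have := ge0_hoelder m (mp _ mf) (mp _ mg) (fun x => powR_ge0 _ _) (fun x => powR_ge0 _ _) (ltr0Sn _ 1) (ltr0Sn _ 1) h2.
have r2 : r / 2 * 2 = r by field.
under eq_integral do rewrite -powRM//.
under [in X in (_ <= X * _)%E]eq_integral do rewrite -powRrM r2.
under [in X in (_ <= _ * X)%E]eq_integral do rewrite -powRrM r2.
by rewrite fA gB !poweR_EFin -EFinM.
Qed.

Section EigenvalueBound.
Context {R : realType}.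
Notation T3 := (measurableTypeR R * measurableTypeR R * measurableTypeR R)%type.

Lemma wa_powR (tau r : R) (x : space3 R) : wa tau x `^ r = (1 + norm3 x ^+ 2) `^ (- (tau * r / 2)).
Proof. by rewrite /wa /japanese -powRrM; congr (_ `^ _); field. Qed.

Lemma yuk_powR_integral (c k : R) : 0 < c -> 0 < k -> k < 3 ->
  (\int[lebesgue3]_x (yuk c (sqn3 x) `^ k)%:E = (4 * pi * Gamma_fun (3 - k) * (k * c) `^ (k - 3))%:E)%E.
Proof.
move=> c0 k0 k3; have pi4 : 0 < 4 * pi :> R by rewrite mulr_gt0 ?pi_gt0.
pose f (x : space3 R) : R := (expR (- (c * norm3 x)) / (4 * pi * norm3 x)) `^ k.
have f0 x : 0 <= f x by exact: powR_ge0.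
have E x : yuk c (sqn3 x) `^ k = (4 * pi) `^ k * f x.
  rewrite /f -powRM ?(ltW pi4)//; last by rewrite divr_ge0 ?expR_ge0// mulr_ge0 ?(ltW pi4)// sqrtr_ge0.
  congr (_ `^ _); rewrite /yuk -norm3E.
  (* At the origin both sides are 0 by the convention for the inverse of 0. *)
  have [->|n0] := eqVneq (norm3 x) 0; first by rewrite !(mulr0, invr0).
  by move: pi4; move: pi => P P0; field; rewrite n0 /= gt_eqF//; lra.
have mf : measurable_fun [set: T3] (f : T3 -> R).
  have -> : f = (fun x => (4 * pi) `^ (- k) * yuk c (sqn3 x) `^ k).
    by apply/funext => x; rewrite E mulrA -powRDp// addNr powRr0 mul1r.
  apply: measurable_funM => //.
  apply: (@measurableT_comp _ _ _ _ _ _ (fun y : R => y `^ k)) => //.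
  exact: measurableT_comp (measurable_yuk c) measurable_sqn3.
under eq_integral do rewrite E.
rewrite (ge0_integralRZl lebesgue3 (powR_ge0 _ _) mf f0) yukawa_integral// -EFinM.
by rewrite !mulrA -powRDp// addrCA subrr addr0 powRr1// ltW.
Qed.

(** If the bound failed at kap, the midpoint between kap and the critical value D^(1/m) / k would
    already violate it. *)
Lemma le_of_lt_powR (m D k kap : R) : 0 < m -> 0 <= D -> 0 < k -> 0 < kap ->
  (forall c, 0 < c -> c < kap -> (k * c) `^ m <= D) -> (k * kap) `^ m <= D.
Proof.
move=> m0 D0 k0 kap0 h; pose X := D `^ m^-1.
have X0 : 0 <= X by exact: powR_ge0.
have XD : X `^ m = D by rewrite /X -powRrM mulVf ?gt_eqF// powRr1.
rewrite -XD; apply: ge0_ler_powR; rewrite ?nnegrE ?(ltW m0)//; first by rewrite mulr_ge0 ?ltW.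
rewrite mulrC -ler_pdivlMr// leNgt; apply/negP => lt.
have Xk : 0 <= X / k by rewrite divr_ge0// ltW.
have c0 : 0 < (X / k + kap) / 2 by lra.
have ck : (X / k + kap) / 2 < kap by lra.
have := h _ c0 ck; rewrite -XD leNgt => /negP; apply; apply: gt0_ltr_powR => //; rewrite ?nnegrE//.
  by rewrite mulr_ge0 ?ltW.
by rewrite mulrC -ltr_pdivrMr//; lra.
Qed.

Lemma Gamma_fun_ge0 (s : R) : 0 <= Gamma_fun s.
Proof. by apply: Rintegral_ge0 => t _; rewrite mulr_ge0 ?powR_ge0 ?expR_ge0. Qed.

(** Raising to the power r undoes 2 / r on the weights, leaving A B, and turns 1 / k on the kernel
    into r - 2. Of (4 pi)^r the part (4 pi)^(r-2) cancels against the kernel; the rest is the factor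
    (4 pi)^(-2). *)
Lemma eigenvalue_bound_algebra (r c A B G : R) (k := r / (r - 2)) : 3 < r -> 0 < c -> 0 <= A -> 0 <= B -> 0 <= G ->
  4 * pi <= (A `^ 2^-1 * B `^ 2^-1) `^ (r / 2)^-1 * (4 * pi * G * (k * c) `^ (k - 3)) `^ k^-1 ->
  (k * c) `^ (2 * (r - 3)) <= (4 * pi) ^- 2 * G `^ (r - 2) * A * B.
Proof.
move=> r3 c0 A0 B0 G0; rewrite {}/k; have kE : r / (r - 2) - 3 = - (2 * (r - 3) / (r - 2)) by field; rewrite gt_eqF//; lra.
have kN : - (2 * (r - 3) / (r - 2)) * (r - 2) = - (2 * (r - 3)) by field; rewrite gt_eqF//; lra.
have kV : (r / (r - 2))^-1 * r = r - 2 by field; rewrite !gt_eqF//; lra.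
have k0 : 0 < r / (r - 2) by rewrite divr_gt0; lra.
have pi4 : 0 < 4 * pi :> R by rewrite mulr_gt0 ?pi_gt0.
rewrite kE; move: (r / (r - 2)) kV k0 pi4 => k kV k0; move: (4 * pi) => P P0.
have kc0 : 0 < k * c by rewrite mulr_gt0.
set Y := P * G * _; have Y0 : 0 <= Y by rewrite !mulr_ge0 ?powR_ge0 ?(ltW P0).
have rr : 0 <= r by lra.
have YE : (Y `^ k^-1) `^ r = Y `^ (r - 2) by rewrite -powRrM kV.
have AB : ((A `^ 2^-1 * B `^ 2^-1) `^ (r / 2)^-1) `^ r = A * B.
  rewrite -powRrM (_ : (r / 2)^-1 * r = 2); last by field; rewrite gt_eqF//; lra.
  by rewrite powRM ?powR_ge0// -!powRrM mulVf// !powRr1.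
move=> /(ge0_ler_powR rr); rewrite !nnegrE => /(_ (ltW P0)) /(_ (mulr_ge0 (powR_ge0 _ _) (powR_ge0 _ _))).
rewrite [X in _ <= X -> _](etrans (powRM r (powR_ge0 _ _) (powR_ge0 _ _)) (f_equal2 *%R AB YE)).
have -> : P `^ r = P `^ (r - 2) * P ^+ 2.
  by rewrite -powR_mulrn ?(ltW P0)// -powRDp// subrK.
have -> : Y `^ (r - 2) = P `^ (r - 2) * (G `^ (r - 2) / (k * c) `^ (2 * (r - 3))).
  rewrite /Y powRM ?powR_ge0 ?mulr_ge0 ?(ltW P0)// powRM ?(ltW P0)// -mulrA; congr (_ * (_ * _)).
  by rewrite -powRrM -powRN kN.
rewrite [X in _ <= X -> _]mulrCA ler_pM2l ?powR_gt0// mulrA ler_pdivlMr ?powR_gt0// => h.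
rewrite -!mulrA ler_pdivlMl ?exprn_gt0//; apply: le_trans h _.
by rewrite le_eqVlt; apply/orP; left; apply/eqP; ring.
Qed.

Lemma powRV (x a : R) : 0 <= x -> x^-1 `^ a = (x `^ a)^-1.
Proof. by move=> x0; rewrite -[x^-1](powR_inv1 x0) -powRrM mulN1r powRN. Qed.

Lemma eigenvalue_bound_limit (r kap A B G : R) : 3 < r -> 0 < kap -> 0 <= A -> 0 <= B -> 0 <= G ->
  (forall c, 0 < c -> c < kap -> (r / (r - 2) * c) `^ (2 * (r - 3)) <= (4 * pi) ^- 2 * G `^ (r - 2) * A * B) ->
  kap `^ (2 * (r - 3)) <= A * ((4 * pi) ^- 2 * G `^ (r - 2) * ((r - 2) / r) `^ (2 * (r - 3))) * B.
Proof.
move=> r3 kap0 A0 B0 G0 h.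
have r2 : 0 < r - 2 by lra.
have k0 : 0 < r / (r - 2) by rewrite divr_gt0//; lra.
have m0 : 0 < 2 * (r - 3) by lra.
have D0 : 0 <= (4 * pi) ^- 2 * G `^ (r - 2) * A * B.
  by rewrite mulr_ge0// mulr_ge0// mulr_ge0 ?powR_ge0// invr_ge0 exprn_ge0// mulr_ge0 ?pi_ge0.
have := le_of_lt_powR m0 D0 k0 kap0 h.
rewrite powRM ?(ltW k0) ?(ltW kap0)// -ler_pdivlMl ?powR_gt0// => /le_trans; apply.
have -> : ((r / (r - 2)) `^ (2 * (r - 3)))^-1 = ((r - 2) / r) `^ (2 * (r - 3)).
  by rewrite -powRV ?(ltW k0)// invf_div.
by rewrite le_eqVlt; apply/orP; left; apply/eqP; ring.
Qed.

(** Here t will be |lambda| and s = sin(theta/2), with kap = sqrt(t) s; dividing by the power of s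
    moves the sine into the constant. *)
Lemma eigenvalue_bound_rescale (r t s A D B : R) : 3 < r -> 0 <= t -> 0 < s ->
  (Num.sqrt t * s) `^ (2 * (r - 3)) <= A * (D * ((r - 2) / r) `^ (2 * (r - 3))) * B ->
  t `^ (r - 3) <= A * (D * ((r - 2) / (r * s)) `^ (2 * (r - 3))) * B.
Proof.
move=> r3 t0 s0; have r0 : 0 <= (r - 2) / r by rewrite divr_ge0//; lra.
have -> : (Num.sqrt t * s) `^ (2 * (r - 3)) = t `^ (r - 3) * s `^ (2 * (r - 3)).
  by rewrite powRM ?sqrtr_ge0 ?(ltW s0)// -powR12_sqrt// -powRrM mulrA mulVf// mul1r.
rewrite -ler_pdivlMr ?powR_gt0// => /le_trans; apply.
have -> : ((r - 2) / (r * s)) `^ (2 * (r - 3)) = ((r - 2) / r) `^ (2 * (r - 3)) / s `^ (2 * (r - 3)).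
  by rewrite invfM mulrA powRM ?invr_ge0 ?(ltW s0)// powRV// ltW.
by rewrite le_eqVlt; apply/orP; left; apply/eqP; ring.
Qed.

Variables (kap sig p tau r : R) (q : cfun3 R) (z : R[i]).
Hypotheses (kap0 : 0 < kap) (p1 : 1 < p) (r3 : 3 < r) (taur : 3 < tau * r).
Hypotheses (z1 : complex.Re z = sig ^+ 2 - kap ^+ 2) (z2 : complex.Im z = 2 * sig * kap).
Hypothesis qL : in_Lp r (factor_b tau q).
Variable Q : @operator R.
Hypothesis QP : bounded_extension p (sandwiched_resolvent p tau q z) Q.
Hypothesis Qev : eigenvalue_of Q (-1).

Notation A := (2 * pi * Beta_fun (3 / 2) (tau * r / 2 - 3 / 2) : R).
Notation Bi := (\int[lebesgue3]_x (wb tau q x `^ r)%:E)%E.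
Notation k := (r / (r - 2)).

Lemma tau_ge0 : 0 <= tau.
Proof.
have h3 := r3; have ht := taur; rewrite leNgt; apply/negP => t0.
have : tau * r < 0 by rewrite nmulr_rlt0//; lra.
by lra.
Qed.

Lemma potential_integral_fin : Bi \is a fin_num.
Proof.
have h3 := r3; have B0 : (0 <= Bi)%E by apply: integral_ge0 => x _; rewrite lee_fin powR_ge0.
have [_] := qL; rewrite Lp_normE; last by lra.
rewrite ge0_fin_numE// !ltey; apply: contra => /eqP ->.
by rewrite poweRyr// invr_eq0 gt_eqF//; lra.
Qed.

Lemma weights_hoelder :
  (\int[lebesgue3]_x ((wa tau x * wb tau q x) `^ (r / 2))%:E <= (A `^ 2^-1 * fine Bi `^ 2^-1)%:E)%E.
Proof.
apply: ge0_hoelder_powR => //.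
- exact: measurable_wa.
- exact: measurable_wb qL.1.
- exact: wa_ge0.
- exact: wb_ge0.
- have ht := taur; rewrite -japanese_integral; last by lra.
  by apply: eq_integral => x _; rewrite wa_powR.
- by rewrite fineK// potential_integral_fin.
Qed.

Lemma eigenvalue_bound_lt c : 0 < c -> c < kap ->
  (k * c) `^ (2 * (r - 3)) <= (4 * pi) ^- 2 * Gamma_fun (2 * (r - 3) / (r - 2)) `^ (r - 2) * A * fine Bi.
Proof.
move=> c0 ck; have h3 := r3; have [w [Qw wN0]] := Qev.
(* The weight has rate d = kap - c, so that the kernel keeps exactly the rate c. *)
have d0 : 0 < kap - c by lra.
have dk : kap - c < kap by lra.
have r2 : 2 < r by lra.
have k0 : 0 < k by rewrite divr_gt0; lra.
(* Equivalent to r > 3: the k-th power of the kernel is integrable at its singularity. *)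
have k3 : k < 3 by rewrite ltr_pdivrMr; lra.
have := combes_thomas kap0 p1 tau_ge0 z1 z2 qL.1 QP Qw wN0 d0 dk r2.
rewrite (_ : kap - (kap - c) = c); last by ring.
rewrite yuk_powR_integral// poweR_EFin.
have -> : 3 - k = 2 * (r - 3) / (r - 2) by field; rewrite gt_eqF//; lra.
have A0 : 0 <= A by rewrite !mulr_ge0 ?pi_ge0//; apply: Rintegral_ge0 => t _; rewrite mulr_ge0 ?powR_ge0.
have B0 : 0 <= fine Bi by apply: fine_ge0; apply: integral_ge0 => x _; rewrite lee_fin powR_ge0.
move=> h; apply: eigenvalue_bound_algebra => //; rewrite ?Gamma_fun_ge0//.
rewrite -lee_fin; apply: (le_trans h); rewrite [leRHS]EFinM.
apply: lee_wpmul2r; first by rewrite lee_fin powR_ge0.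
rewrite -poweR_EFin; apply: gt0_ler_poweR; last exact: weights_hoelder.
- by rewrite invr_ge0; lra.
- by rewrite in_itv /= leey andbT; apply: integral_ge0 => x _; rewrite lee_fin powR_ge0.
- by rewrite in_itv /= leey andbT lee_fin mulr_ge0 ?powR_ge0.
Qed.

Lemma eigenvalue_bound :
  kap `^ (2 * (r - 3)) <= A * ((4 * pi) ^- 2 * Gamma_fun (2 * (r - 3) / (r - 2)) `^ (r - 2) * ((r - 2) / r) `^ (2 * (r - 3))) * fine Bi.
Proof.
have A0 : 0 <= A by rewrite !mulr_ge0 ?pi_ge0//; apply: Rintegral_ge0 => t _; rewrite mulr_ge0 ?powR_ge0.
have B0 : 0 <= fine Bi by apply: fine_ge0; apply: integral_ge0 => x _; rewrite lee_fin powR_ge0.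
by apply: eigenvalue_bound_limit; rewrite ?Gamma_fun_ge0//; exact: eigenvalue_bound_lt.
Qed.

End EigenvalueBound.

Lemma cabs_eq0 (R : realType) (z : R[i]) : cabs z = 0 -> z = 0.
Proof. exact: Normc.eq0_normc. Qed.

Unset Implicit Arguments.

Theorem corollary3p4 (R : realType) (p p' r tau : R) (q : space3 R -> R[i])
  (H : @operator R) (lambda : R[i]) (theta : R) :
  1 < p ->
  p^-1 + p'^-1 = 1 ->
  cmeasurable q ->
  standing_assumptions p p' tau q ->
  in_Lp r (factor_b tau q) ->
  3 < tau * r ->
  (p <= 3 -> 3 < r) ->
  (3 < p -> p <= r) ->
  schroedinger_operator p tau q H ->
  ~ nonneg_axis lambda ->
  eigenvalue_of H lambda ->
  0 < theta -> theta < 2 * pi ->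
  lambda = (cabs lambda * cos theta) +i* (cabs lambda * sin theta) ->
  ((cabs lambda `^ (r - 3))%:E <=
    (C1_const tau r theta)%:E *
      \int[lebesgue3]_x (cabs (factor_b tau q x) `^ r)%:E)%E.
Proof.
move=> p1 _ _ _ qL taur rle3 rgt3 [_ _ _ _ HQ] lamN ev th0 th2 lamE.
(* For p > 3 this follows from p <= r; the two cases on p are needed for nothing else. *)
have r3 : 3 < r by have [/rle3//|p3] := lerP p 3; exact: lt_le_trans p3 (rgt3 p3).
have [Q QP Qev] := (HQ _ lamN).1 ev.
set t := cabs lambda in lamE *.
have t0 : 0 < t.
  rewrite lt_neqAle cabs_ge0 andbT eq_sym; apply/eqP => /cabs_eq0 l0.
  by apply: lamN; rewrite /nonneg_axis l0.
have s0 : 0 < sin (theta / 2) by apply: sin_gt0_pi; lra.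
(* The square root of lambda with argument theta/2, which lies in (0, pi); its imaginary part kap is
   therefore positive, and the double-angle formulas give lambda = (sig + i kap)^2. *)
pose kap := Num.sqrt t * sin (theta / 2); pose sig := Num.sqrt t * cos (theta / 2).
have kap0 : 0 < kap by rewrite mulr_gt0 ?sqrtr_gt0.
have tE : t = Num.sqrt t ^+ 2 by rewrite sqr_sqrtr// ltW.
have thE : theta = theta / 2 + theta / 2 by field.
have z1 : complex.Re lambda = sig ^+ 2 - kap ^+ 2.
  by rewrite lamE /= {1}thE cosD {1}tE /kap /sig; ring.
have z2 : complex.Im lambda = 2 * sig * kap.
  by rewrite lamE /= {1}thE sinD {1}tE /kap /sig; ring.
have bound := eigenvalue_bound kap0 p1 r3 taur z1 z2 qL QP Qev.
rewrite -(fineK (potential_integral_fin r3 qL)) -EFinM lee_fin.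
exact: eigenvalue_bound_rescale r3 (ltW t0) s0 bound.
Qed.
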